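(* Let $T>0$, $1<p<\infty$, $\frac1p<\alpha<1$ and $p<q<\infty$. Let $f:[0,T]\times\mathbb{R}\to\mathbb{R}$ be a Carathéodory function, put $F(t,\xi)=\int_0^{\xi}f(t,\sigma)\,d\sigma$, and suppose that: (i) there exists $C>0$ such that $|f(t,\xi)|\le C(1+|\xi|^{q-1})$ for a.e. $t\in[0,T]$ and all $\xi\in\mathbb{R}$; (ii) there exist $\mu>p$ and $r>0$ such that $0<\mu F(t,\xi)\le \xi f(t,\xi)$ for a.e. $t\in[0,T]$ and all $\xi\in\mathbb{R}$ with $|\xi|\ge r$; (iii) $\lim_{\xi\to0}\frac{f(t,\xi)}{|\xi|^{p-1}}=0$ uniformly for a.e. $t\in[0,T]$. Then the problem $$ {}_tD_T^{\alpha}\left(|{}_0D_t^{\alpha}u(t)|^{p-2}\,{}_0D_t^{\alpha}u(t)\right)=f(t,u(t)),\quad t\in[0,T],\qquad u(0)=u(T)=0, $$ has a nontrivial weak solution in $E_0^{\alpha,p}$, i.e. there exists $u\in E_0^{\alpha,p}$, $u\neq0$, such that $$\int_0^T|{}_0D_t^{\alpha}u(t)|^{p-2}\,{}_0D_t^{\alpha}u(t)\,{}_0D_t^{\alpha}\varphi(t)\,dt=\int_0^Tf(t,u(t))\varphi(t)\,dt\quad\text{for all }\varphi\in E_0^{\alpha,p}.$$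
   Context: For $0<\alpha<1$, the left and right Riemann–Liouville fractional derivatives on $[0,T]$ are ${}_0D_t^{\alpha}u(t)=\frac{d}{dt}\left[\frac{1}{\Gamma(1-\alpha)}\int_0^t(t-s)^{-\alpha}u(s)\,ds\right]$ and ${}_tD_T^{\alpha}u(t)=-\frac{d}{dt}\left[\frac{1}{\Gamma(1-\alpha)}\int_t^T(s-t)^{-\alpha}u(s)\,ds\right]$. The fractional derivative space is $E_0^{\alpha,p}=\overline{C_0^\infty[0,T]}$, the closure of $C_0^\infty[0,T]$ (real-valued smooth functions with compact support in $(0,T)$) with respect to the norm $\left(\int_0^T|u|^p\,dt+\int_0^T|{}_0D_t^{\alpha}u|^p\,dt\right)^{1/p}$; it is identified with $\{u\in L^p[0,T]:{}_0D_t^{\alpha}u\in L^p[0,T],\ u(0)=u(T)=0\}$. For $u\in E_0^{\alpha,p}$, ${}_0D_t^\alpha u$ is the $L^p$-limit of ${}_0D_t^\alpha u_k$ for $u_k\in C_0^\infty[0,T]$ converging to $u$ in this norm. An expression $|z|^{p-2}z$ is read as $0$ when $z=0$. Carathéodory function: $f(\cdot,\xi)$ is measurable for every $\xi\in\mathbb{R}$ and $f(t,\cdot)$ is continuous for a.e. $t\in[0,T]$. *)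

(* Defs.v *)
From HB Require Import structures.
From mathcomp Require Import all_boot all_order all_algebra.
From mathcomp Require Import all_classical all_reals all_analysis.

Set Implicit Arguments.
Unset Strict Implicit.
Unset Printing Implicit Defensive.

Import Order.TTheory GRing.Theory Num.Theory.
Import numFieldNormedType.Exports.

Local Open Scope classical_set_scope.
Local Open Scope ring_scope.

(* Functions on [0, T] are represented by total functions R -> R of which only
   the values on `[0, T] matter; elements of L^p are represented by Borel
   functions, equality being equality almost everywhere on `[0, T]. *)

Section fractional_derivative.
Context {R : realType}.
Local Notation mu := (@lebesgue_measure R).
Implicit Types (alpha p T : R) (u v : R -> R).

Definition Gamma (x : R) : R :=
  \int[mu]_(s in `]0, +oo[) (s `^ (x - 1) * expR (- s)).

(* The derivative is two-sided, hence irrelevant at the (negligible) endpoints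
   of [0, T]. *)
Definition left_RL_derivative alpha u : R -> R :=
  (fun t => (Gamma (1 - alpha))^-1 *
            \int[mu]_(s in `[0, t]) ((t - s) `^ (- alpha) * u s))^`()%classic.

Definition smooth u := forall n x, derivable (derive1n n u) x 1.

Definition C0infty T : set (R -> R) :=
  [set u : R -> R | [/\ smooth u, compact (closure [set t | u t != 0]) &
               closure [set t | u t != 0] `<=` `]0, T[]].

Definition in_Lp p T : set (R -> R) :=
  [set u : R -> R | measurable_fun `[0, T] u /\
           (\int[mu]_(t in `[0%R, T]) (`|u t| `^ p)%:E < +oo)%E].

(* The norm of E_0^{alpha,p} at u, with v in the role of the fractional
   derivative of u. *)
Definition E0_norm p T u v : \bar R :=
  ((\int[mu]_(t in `[0%R, T]) (`|u t| `^ p)%:E +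
    \int[mu]_(t in `[0%R, T]) (`|v t| `^ p)%:E) `^ p^-1)%E.

(* Some sequence of C0infty functions converges to u in the norm, its
   fractional derivatives converging to v in L^p. *)
Definition E0_limit alpha p T u v : Prop :=
  exists2 w : nat -> R -> R, (forall k, C0infty T (w k)) &
    E0_norm p T (w k \- u) (left_RL_derivative alpha (w k) \- v)
      @[k --> \oo] --> 0%E.

Definition E0 alpha p T : set (R -> R) :=
  [set u : R -> R | in_Lp p T u /\ exists2 v : R -> R, in_Lp p T v & E0_limit alpha p T u v].

(* For u in E0, the fractional derivative of u, unique up to a.e. equality *)
Definition E0_derivative alpha p T u : R -> R :=
  get [set v : R -> R | in_Lp p T v /\ E0_limit alpha p T u v].

(* int_0^x g, oriented *)
Definition primitive0 (g : R -> R) (x : R) : R :=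
  if 0 <= x then \int[mu]_(s in `[0, x]) g s
  else - \int[mu]_(s in `[x, 0]) g s.

(* Measurability with respect to the completed (Caratheodory) Lebesgue
   sigma-algebra, whereas [measurable_fun] on R is Borel measurability.
   A Lebesgue measurable function is a.e. equal to a Borel one, and the integral
   against [lebesgue_measure], being defined for all functions as a supremum
   over Borel simple functions, does not change under a.e. equality. *)
Definition lebesgue_measurable_fun (D : set R) (g : R -> R) : Prop :=
  @measurable_fun _ _ (caratheodory_type (wlength (@idfun R))^*%mu)
    (measurableTypeR R) D g.

Definition caratheodory_function T (f : R -> R -> R) : Prop :=
  (forall xi, lebesgue_measurable_fun `[0, T] (f ^~ xi)) /\
  {ae mu, forall t, t \in `[0, T] -> continuous (f t)}.

End fractional_derivative.

(* Main.v *)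
Require Import Defs.
From HB Require Import structures.
From mathcomp Require Import all_boot all_order all_algebra.
From mathcomp Require Import all_classical all_reals all_analysis.
From mathcomp Require Import measurable_realfun.
From mathcomp Require Import ring lra.

Set Implicit Arguments.
Unset Strict Implicit.
Unset Printing Implicit Defensive.

Import Order.TTheory GRing.Theory Num.Theory.
Import numFieldNormedType.Exports.

Local Open Scope classical_set_scope.
Local Open Scope ring_scope.

Section mountain_pass.
Context {R : realType} {X : lmodType R}.
Variables (S : set X) (N Phi : X -> R) (dPhi : X -> X -> R).

Definition segment_below (c : R) (x y : X) : Prop :=
  forall s : R, 0 <= s <= 1 -> Phi (x + s *: (y - x)) < c.

Inductive linked (c : R) : X -> Prop :=
| linked_start : linked c 0
| linked_step x y :
    linked c x -> S y -> segment_below c x y -> linked c y.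

Inductive chain (eta c rad : R) : X -> Prop :=
| chain_start : chain eta c rad 0
| chain_step x y : chain eta c rad x -> N x < rad ->
    S y -> Phi y < c -> N (y - x) <= eta -> chain eta c rad y.

Hypothesis S0 : S 0.
Hypothesis SD : forall (a : R) x y, S x -> S y -> S (x + a *: y).
Hypothesis N0 : N 0 = 0.
Hypothesis NZ : forall a x, S x -> N (a *: x) = `|a| * N x.
Hypothesis ND : forall x y, S x -> S y -> N (x + y) <= N x + N y.

Let SZ (a : R) x : S x -> S (a *: x).
Proof. by move=> Sx; rewrite -[_ *: _]add0r; exact: SD. Qed.

Let SB x y : S x -> S y -> S (x - y).
Proof. by move=> Sx Sy; rewrite -scaleN1r; exact: SD. Qed.

Let NB x y : S x -> S y -> N (x - y) = N (y - x).
Proof.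
by move=> Sx Sy; rewrite -[LHS]mul1r -(normrN1 R) -NZ ?scaleN1r ?opprB; [|exact: SB].
Qed.

Lemma linked_closed c x : linked c x -> S x.
Proof. by case. Qed.

Lemma chain_closed eta c rad x : chain eta c rad x -> S x.
Proof. by case. Qed.

Lemma chain_bounded eta c rad x : 0 < eta -> 0 < rad ->
  chain eta c rad x -> N x <= rad + eta.
Proof.
move=> eta0 rad0; case=> [|{}x y /chain_closed Sx xrad Sy _ yx].
  by rewrite N0 addr_ge0// ltW.
rewrite -(subrK x y) (le_trans (ND _ _))//; first exact: SB.
by rewrite addrC lerD// ltW.
Qed.

Lemma chain_widen eta c c' rad x : c <= c' ->
  chain eta c rad x -> chain eta c' rad x.
Proof.
move=> cc'; elim=> [|{}x y _ xc xr Sy yc yx]; first exact: chain_start.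
by apply: chain_step xc _ Sy _ yx => //; exact: lt_le_trans cc'.
Qed.

(** Subdividing the edges of a polygon makes its steps short; cutting it at its
    first node outside of the ball keeps it bounded. *)
Lemma linked_chain eta c rad z : 0 < eta -> linked c z ->
  chain eta c rad z \/ exists2 x, chain eta c rad x & rad <= N x.
Proof.
move=> eta0; elim=> [|x y linx [chx|ex] Sy xy]; first by left; exact: chain_start.
- have Sx := linked_closed linx.
  set k := (Num.truncn (N (y - x) / eta)).+1.
  have k0 : 0 < k%:R :> R by rewrite ltr0n.
  have kP : N (y - x) / k%:R <= eta.
    rewrite ler_pdivrMr// mulrC -ler_pdivrMr//.
    by apply: ltW; exact: truncnS_gt.
  suff : forall i, (i <= k)%N ->
      chain eta c rad (x + (i%:R / k%:R) *: (y - x)) \/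
      exists2 x, chain eta c rad x & rad <= N x.
    move=> /(_ k (leqnn _)); rewrite divff ?gt_eqF// scale1r addrC subrK.
    by move=> [|]; [left|right].
  elim=> [_|i IH ik]; first by left; rewrite mul0r scale0r addr0.
  have [chi|] := IH (ltnW ik); last by right.
  have [ri|ri] := leP rad (N (x + (i%:R / k%:R) *: (y - x))).
    by right; exists (x + (i%:R / k%:R) *: (y - x)).
  left; apply: chain_step chi ri _ _ _.
  + by apply: SD => //; exact: SB.
  + apply: xy; rewrite divr_ge0 ?ler0n//=.
    by rewrite ler_pdivrMr// mul1r ler_nat.
  + rewrite opprD addrACA subrr add0r -scalerBl -mulrBl -natrB ?leqnSn//.
    rewrite subSn// subnn NZ; last exact: SB.
    by rewrite mul1r gtr0_norm ?invr_gt0// mulrC.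
- by right.
Qed.

(** Lowering of a level: each node of a chain is moved by [tau] along a descent
    direction of its own; neighbouring nodes remain connected below the level, by
    the detour which pushes the whole edge much farther, by [r]. *)
Lemma chain_push (c eps delta0 r tau delta rad : R) :
  0 < eps -> 0 < rad -> 0 < r -> 0 < tau -> 0 < delta -> tau <= 1 ->
  2 * tau <= r ->
  4 * delta <= delta0 -> 8 * delta <= tau * eps -> 8 * delta <= r * eps ->
  Phi 0 < c - delta ->
  (forall x, S x -> N x <= rad + 1 -> `|Phi x - c| <= delta0 ->
    exists e, [/\ S e, N e <= 1, (rad <= N x -> rad <= N (x + tau *: e)) &
      forall z h, S z -> N (z - x) <= r -> 0 <= h <= r ->
        Phi (z + h *: e) <= Phi z - h * eps]) ->
  (forall x z, S x -> S z -> N x <= rad + 1 -> N (z - x) <= 2 * tau ->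
    8 * (Phi z - Phi x) <= r * eps /\ 4 * (Phi z - Phi x) <= delta0) ->
  forall x, chain tau (c + delta) rad x ->
    exists y, [/\ linked (c - delta) y, Phi y < c - delta, N (y - x) <= tau &
      (rad <= N x -> rad <= N y)].
Proof.
move=> eps0 rad0 r0 tau0 delta_gt0 tau1 tau2 dd0 dte dre Phi0 desc ucont.
move=> x chx; elim: (chx) => [|{chx}x z chx [y [liny Phiy yx _]] xr Sz Phiz zx].
  exists 0; split => //; first exact: linked_start.
  by rewrite subrr N0 ltW.
have Sx := chain_closed chx.
have Sy := linked_closed liny.
have zr : N z <= rad + 1.
  have : chain tau (c + delta) rad z by exact: chain_step chx xr Sz Phiz zx.
  by move/(chain_bounded tau0 rad0)/le_trans; apply; rewrite lerD2l.
have yz : N (y - z) <= 2 * tau.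
  rewrite -(subrKA x) (le_trans (ND _ _))//; try exact: SB.
  by rewrite mulr_natl mulr2n lerD// NB.
(* the balls centred at [z] are convex *)
have near w w' s : S w -> S w' -> N (w - z) <= 2 * tau -> N (w' - z) <= 2 * tau ->
    0 <= s <= 1 -> S (w + s *: (w' - w)) /\ N (w + s *: (w' - w) - z) <= 2 * tau.
  move=> Sw Sw' wz w'z /andP[s0 s1]; split; first by apply: SD => //; exact: SB.
  have -> : w + s *: (w' - w) - z = (1 - s) *: (w - z) + s *: (w' - z).
    rewrite scalerBl scale1r -[RHS]addrA [- _ + _]addrC -scalerBr opprB.
    by rewrite addrA subrK addrAC.
  rewrite (le_trans (ND _ _))//; try by apply: SZ; exact: SB.
  rewrite !NZ; try exact: SB.
  rewrite (ger0_norm s0) ger0_norm ?subr_ge0//.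
  have -> : 2 * tau = (1 - s) * (2 * tau) + s * (2 * tau) by ring.
  rewrite lerD//.
    by rewrite ler_wpM2l// subr_ge0.
  by rewrite ler_wpM2l.
have [PhizL|PhizL] := ltP (Phi z) (c - delta0).
- exists z; split => //.
  + apply: (linked_step liny Sz) => s s01.
    have zz : N (z - z) <= 2 * tau by rewrite subrr N0 mulr_ge0// ltW.
    have [Sw wz] := near y z s Sy Sz yz zz s01.
    have [_ ?] := ucont _ _ Sz Sw zr wz.
    lra.
  + lra.
  + by rewrite subrr N0 ltW.
have [|e [Se Ne eout ed]] := desc z Sz zr.
  rewrite ler_norml; lra.
have tr0 : 0 <= tau <= r by lra.
have zz : N (z - z) <= r by rewrite subrr N0 ltW.
have Szt : S (z + tau *: e) by exact: SD.
have Phizt : Phi (z + tau *: e) < c - delta.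
  have := ed z tau Sz zz tr0; lra.
have ztz : N (z + tau *: e - z) <= tau.
  by rewrite addrAC subrr add0r NZ// gtr0_norm// -[leRHS]mulr1 ler_pM2l.
have ztz2 : N (z + tau *: e - z) <= 2 * tau by lra.
have yzr : N (y - z) <= r by lra.
have ztzr : N (z + tau *: e - z) <= r by lra.
have lin1 : linked (c - delta) (y + r *: e).
  apply: (linked_step liny); first exact: SD.
  move=> s /andP[s0 s1]; rewrite [_ + r *: e]addrC addrK scalerA.
  have := ed y (s * r) Sy yzr; rewrite mulr_ge0 ?(ltW r0)//=.
  rewrite ler_piMl ?(ltW r0)// => /(_ isT)/le_lt_trans; apply.
  rewrite (le_lt_trans _ Phiy)// gerBl.
  by rewrite !mulr_ge0// ltW.
have lin2 : linked (c - delta) (z + tau *: e + r *: e).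
  apply: (linked_step lin1); first exact: SD.
  move=> s s01.
  have -> : y + r *: e + s *: (z + tau *: e + r *: e - (y + r *: e)) =
      y + s *: (z + tau *: e - y) + r *: e.
    rewrite opprD addrACA subrr addr0 -!addrA; congr (_ + _).
    by rewrite addrC.
  have [Sw wz] := near _ _ s Sy Szt yz ztz2 s01.
  have [? _] := ucont _ _ Sz Sw zr wz.
  have wzr := le_trans wz tau2.
  have r0r : 0 <= r <= r by rewrite lexx ltW.
  have := ed _ r Sw wzr r0r; lra.
exists (z + tau *: e); split => //.
apply: (linked_step lin2 Szt) => s /andP[s0 s1].
have -> : z + tau *: e + r *: e + s *: (z + tau *: e - (z + tau *: e + r *: e)) =
    z + tau *: e + ((1 - s) * r) *: e.
  rewrite opprD addrA subrr add0r scalerN scalerA -!addrA; do 2 congr (_ + _).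
  by rewrite mulrBl mul1r scalerBl.
have s1' : 0 <= 1 - s by rewrite subr_ge0.
have := ed _ ((1 - s) * r) Szt ztzr; rewrite mulr_ge0 ?(ltW r0)//=.
rewrite ler_piMl ?(ltW r0)//; last by rewrite gerBl.
move=> /(_ isT)/le_lt_trans; apply.
rewrite (le_lt_trans _ Phizt)// gerBl.
by rewrite !mulr_ge0// ltW.
Qed.

(** Mountain pass principle.  If no point of the ball of radius [rad + 1] were
    almost critical, the minimax level [c] of the polygons leading from [0] out of
    the ball of radius [rad] could be lowered by [chain_push]; the radial direction
    being one of descent on the boundary, pushed polygons still leave the
    ball.  No completeness is involved, the point found being only almost
    critical. *)
Theorem mountain_pass (e0 : X) (rho kappa rad cbar eta : R) :
  0 < rho -> rho <= rad -> 0 < kappa -> 0 < eta -> S e0 -> 0 < N e0 -> Phi 0 = 0 ->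
  (forall x, S x -> rho <= 2 * N x <= 2 * rho -> kappa <= Phi x) ->
  (forall s, 0 <= s -> Phi (s *: e0) <= cbar) ->
  (forall x, S x -> rad <= N x <= rad + 1 -> Phi x <= cbar + 2 ->
    dPhi x ((N x)^-1 *: x) <= - eta) ->
  (forall M eps, 0 < M -> 0 < eps -> exists2 r, 0 < r & forall x z e h,
    S x -> S z -> S e -> N x <= M -> N (z - x) <= r -> N e <= 1 -> 0 <= h <= r ->
    Phi (z + h *: e) <= Phi z + h * (dPhi x e + eps)) ->
  (forall M eps, 0 < M -> 0 < eps -> exists2 r, 0 < r & forall x z,
    S x -> S z -> N x <= M -> N (z - x) <= r -> Phi z - Phi x <= eps) ->
  forall eps, 0 < eps -> exists x, [/\ S x, N x <= rad + 1, kappa <= 2 * Phi x &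
    forall e, S e -> N e <= 1 -> - eps <= dPhi x e].
Proof.
move=> rho0 rhorad kappa0 eta0 Se0 Ne0 Phi0 ring ray outw sdiff ucont eps eps0.
apply: contrapT => /forallNP nocrit.
have rad0 : 0 < rad by exact: lt_le_trans rhorad.
pose A := [set c | exists2 z, linked c z & rad <= N z].
have A1 : A (cbar + 1).
  exists ((rad / N e0) *: e0); last first.
    by rewrite NZ// gtr0_norm ?divr_gt0// divfK// gt_eqF.
  apply: (linked_step (linked_start _)); first exact: SZ.
  move=> s /andP[s0 s1]; rewrite subr0 add0r scalerA.
  rewrite (le_lt_trans (ray _ _)) ?ltrDl//.
  by rewrite mulr_ge0// divr_ge0// ltW.
have Ak : lbound A kappa.
  move=> c [z linz zrad]; have rho2 : 0 < rho / 2 by rewrite divr_gt0.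
  have [x chx xrho] : exists2 x, chain (rho / 2) c (rho / 2) x & rho / 2 <= N x.
    have [chz|//] := linked_chain (rho / 2) rho2 linz.
    by exists z => //; lra.
  have xrho' := chain_bounded rho2 rho2 chx.
  case: chx xrho xrho' => [|{}x y _ _ Sy Phiy _ yrho yrho'].
    by rewrite N0 leNgt rho2.
  by rewrite (le_trans (ring y Sy _)) ?(ltW Phiy)//; lra.
have infA : has_inf A by split; [exists (cbar + 1)|exists kappa].
set c := inf A.
have kc : kappa <= c by apply: lb_le_inf => //; exists (cbar + 1).
have cc : c <= cbar + 1 by apply: ge_inf => //; exists kappa.
pose d0 := Num.min (kappa / 2) 1.
have d00 : 0 < d0 by rewrite lt_min divr_gt0//=.
have [d0k d01] : d0 <= kappa / 2 /\ d0 <= 1.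
  by split; rewrite ge_min lexx ?orbT.
pose ep := Num.min eps eta.
have ep0 : 0 < ep by rewrite lt_min eps0.
have [epe epeta] : ep <= eps /\ ep <= eta by split; rewrite ge_min lexx ?orbT.
have rad1 : 0 < rad + 1 by rewrite addr_gt0.
have ep2 : 0 < ep / 2 by rewrite divr_gt0.
have [r1 r10 sd] := sdiff (rad + 1) (ep / 2) rad1 ep2.
pose r := Num.min r1 1.
have r0 : 0 < r by rewrite lt_min r10/=.
have rr1 : r <= r1 by rewrite ge_min lexx.
have rep : 0 < r * (ep / 2) / 8 by rewrite divr_gt0// mulr_gt0.
have d04 : 0 < d0 / 4 by rewrite divr_gt0.
have [t1 t10 uc1] := ucont (rad + 1) _ rad1 rep.
have [t2 t20 uc2] := ucont (rad + 1) _ rad1 d04.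
pose tau := Num.min (r / 2) (Num.min (t1 / 2) (t2 / 2)).
have tau0 : 0 < tau by rewrite !lt_min !divr_gt0.
have [taur taut1 taut2] : [/\ 2 * tau <= r, 2 * tau <= t1 & 2 * tau <= t2].
  have : [&& tau <= r / 2, tau <= t1 / 2 & tau <= t2 / 2] by rewrite -!le_min.
  by move=> /and3P[? ? ?]; split; lra.
have tauep : 0 < tau * (ep / 2) by rewrite mulr_gt0.
pose delta := Num.min (d0 / 4) (Num.min (tau * (ep / 2) / 8) (r * (ep / 2) / 8)).
have delta0 : 0 < delta by rewrite !lt_min d04 rep divr_gt0.
have [dd0 dtau dr] : [/\ 4 * delta <= d0, 8 * delta <= tau * (ep / 2) &
    8 * delta <= r * (ep / 2)].
  have : [&& delta <= d0 / 4, delta <= tau * (ep / 2) / 8 &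
    delta <= r * (ep / 2) / 8] by rewrite -!le_min.
  by move=> /and3P[? ? ?]; split; lra.
have r1' : r <= 1 by rewrite ge_min lexx orbT.
have [c1 [z1 linz1 z1rad] c1c] := inf_adherent delta0 infA.
have [z chz zrad] : exists2 z, chain tau (c + delta) rad z & rad <= N z.
  have [chz|[z chz zrad]] := linked_chain rad tau0 linz1.
    by exists z1 => //; apply: chain_widen chz; exact: ltW.
  by exists z => //; apply: chain_widen chz; exact: ltW.
suff push : exists y, [/\ linked (c - delta) y, Phi y < c - delta,
    N (y - z) <= tau & (rad <= N z -> rad <= N y)].
  have [y [liny _ _ /(_ zrad) yrad]] := push.
  have : c <= c - delta by apply: ge_inf; [exists kappa|exists y].
  lra.
apply: (@chain_push c (ep / 2) d0 r tau delta rad) chz => //.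
- lra.
- lra.
- move=> x Sx xr xd.
  have dsc e : S e -> N e <= 1 -> dPhi x e <= - ep ->
      forall w h, S w -> N (w - x) <= r -> 0 <= h <= r ->
        Phi (w + h *: e) <= Phi w - h * (ep / 2).
    move=> Se Ne de w h Sw wx /andP[h0 hr].
    rewrite (le_trans (sd x w e h _ _ _ _ _ _ _))//.
    + exact: le_trans rr1.
    + by rewrite h0 (le_trans hr).
    + by rewrite lerD2l -mulrN ler_wpM2l//; lra.
  have Phix : Phi x <= cbar + 2 /\ kappa <= 2 * Phi x.
    by move: xd; rewrite ler_norml; lra.
  have [xlow|xhigh] := ltP (N x) rad.
    have /existsNP[e] : ~ (forall e, S e -> N e <= 1 -> - eps <= dPhi x e).
      by move=> H; apply: (nocrit x); split => //; case: Phix.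
    move=> /not_implyP[Se /not_implyP[Ne]] /negP; rewrite -ltNge => de.
    exists e; split => //; apply: dsc => //.
    by rewrite (le_trans (ltW de))// lerN2.
  have Nx0 : 0 < N x by lra.
  exists ((N x)^-1 *: x); split.
  + exact: SZ.
  + by rewrite NZ// gtr0_norm ?invr_gt0// mulVf// gt_eqF.
  + move=> _; rewrite scalerA -[X in X + _]scale1r -scalerDl NZ//.
    rewrite ger0_norm ?addr_ge0//; last by rewrite divr_ge0// ltW.
    by rewrite mulrDl mul1r (le_trans xhigh)// lerDl mulr_ge0// ?divr_ge0 ?ltW.
  + apply: dsc; first exact: SZ.
      by rewrite NZ// gtr0_norm ?invr_gt0// mulVf// gt_eqF.
    by rewrite (le_trans (outw _ _ _ _)) ?xhigh//; [case: Phix|rewrite lerN2].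
- move=> x y Sx Sy xr yx; split.
  + have := uc1 _ _ Sx Sy xr (le_trans yx taut1); lra.
  + have := uc2 _ _ Sx Sy xr (le_trans yx taut2); lra.
Qed.

End mountain_pass.

Section duality_map.
Context {R : realType}.
Variable p : R.
Hypothesis p1 : 1 < p.

Definition dualmap (a : R) : R := `|a| `^ (p - 2) * a.

Let p0 : 0 < p. Proof. exact: lt_trans p1. Qed.
Let pm1 : 0 < p - 1. Proof. by rewrite subr_gt0. Qed.

Lemma powR_subr1M (x : R) : 0 <= x -> x `^ (p - 1) * x = x `^ p.
Proof. by move=> x0; rewrite mulrC mulr_powRB1. Qed.

Lemma ge0_dualmap (a : R) : 0 <= a -> dualmap a = a `^ (p - 1).
Proof.
move=> a0; rewrite /dualmap ger0_norm//.
have [->|an0] := eqVneq a 0; first by rewrite mulr0 powR0// gt_eqF.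
rewrite -[X in _ * X](powRr1 a0) -powRD ?an0 ?implybT//.
by congr (_ `^ _); ring.
Qed.

Lemma dualmapN (a : R) : dualmap (- a) = - dualmap a.
Proof. by rewrite /dualmap normrN mulrN. Qed.

Lemma normr_dualmap (a : R) : `|dualmap a| = `|a| `^ (p - 1).
Proof.
by rewrite -ge0_dualmap// /dualmap normrM normr_id norm_powR// normr_id.
Qed.

Lemma dualmapM (a : R) : dualmap a * a = `|a| `^ p.
Proof.
rewrite -(@powR_subr1M _)// -ge0_dualmap// /dualmap normr_id -!mulrA.
by rewrite -!expr2 real_normK// num_real.
Qed.

Lemma dualmap_mono : {homo dualmap : x y / x <= y}.
Proof.
have mono (x y : R) : 0 <= x -> x <= y -> dualmap x <= dualmap y.
  move=> x0 xy; have y0 := le_trans x0 xy; rewrite !ge0_dualmap//.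
  by rewrite ge0_ler_powR// ltW.
move=> x y xy; have [x0|/ltW x0] := leP 0 x; first exact: mono.
have [y0|/ltW y0] := leP 0 y.
  rewrite (@le_trans _ _ 0)//; last by rewrite ge0_dualmap// powR_ge0.
  by rewrite -oppr_ge0 -dualmapN ge0_dualmap ?oppr_ge0// powR_ge0.
by rewrite -lerN2 -!dualmapN mono ?oppr_ge0// lerN2.
Qed.

Lemma dualmap_mono_ge0 (a b : R) : 0 <= (dualmap a - dualmap b) * (a - b).
Proof.
have [ab|/ltW ab] := leP a b.
  by rewrite mulr_le0// subr_le0// dualmap_mono.
by rewrite mulr_ge0// subr_ge0// dualmap_mono.
Qed.

(** Young's inequality, in the form used: exponents matter, constants do not. *)
Lemma young_weightl (eps : R) : 0 < eps -> exists2 C, 0 < C & forall x y : R,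
  0 <= x -> 0 <= y -> x `^ (p - 1) * y <= eps * x `^ p + C * y `^ p.
Proof.
move=> e0; exists ((eps^-1) `^ (p - 1)); first by rewrite powR_gt0 ?invr_gt0.
move=> x y x0 y0; have [yx|xy] := leP y (eps * x).
  rewrite (@le_trans _ _ (eps * x `^ p))//; last first.
    by rewrite lerDl mulr_ge0// powR_ge0.
  rewrite -(@powR_subr1M x)// mulrCA.
  by rewrite ler_wpM2l// powR_ge0.
rewrite (@le_trans _ _ ((eps^-1) `^ (p - 1) * y `^ p))//; last first.
  by rewrite lerDr mulr_ge0 ?powR_ge0// ltW.
rewrite -(@powR_subr1M y)// mulrA ler_wpM2r//.
rewrite -powRM ?invr_ge0 ?(ltW e0)// ge0_ler_powR ?nnegrE ?(ltW pm1)//.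
  by rewrite mulr_ge0// invr_ge0 ltW.
by rewrite mulrC ler_pdivlMr// mulrC ltW.
Qed.

Lemma young_weightr (eps : R) : 0 < eps -> exists2 C, 0 < C & forall x y : R,
  0 <= x -> 0 <= y -> x `^ (p - 1) * y <= C * x `^ p + eps * y `^ p.
Proof.
move=> e0; pose K := eps^-1 `^ ((p - 1)^-1).
have K0 : 0 < K by rewrite powR_gt0 ?invr_gt0.
exists K => // x y x0 y0; have [yx|xy] := leP y (K * x).
  rewrite (@le_trans _ _ (K * x `^ p))//; last first.
    by rewrite lerDl mulr_ge0 ?powR_ge0// ltW.
  rewrite -(@powR_subr1M x)// mulrCA.
  by rewrite ler_wpM2l// powR_ge0.
rewrite (@le_trans _ _ (eps * y `^ p))//; last first.
  by rewrite lerDr mulr_ge0 ?powR_ge0// ltW.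
rewrite -(@powR_subr1M y)// mulrA ler_wpM2r//.
rewrite mulrC -ler_pdivrMr//.
have -> : x `^ (p - 1) / eps = (K * x) `^ (p - 1).
  rewrite powRM ?(ltW K0)// /K -powRrM mulVf ?gt_eqF// powRr1 ?invr_ge0 ?ltW//.
  by rewrite mulrC.
rewrite ge0_ler_powR ?nnegrE ?(ltW pm1)// ?mulr_ge0 ?(ltW K0)//.
exact: ltW.
Qed.

Lemma young_simple (x y : R) : 0 <= x -> 0 <= y ->
  x `^ (p - 1) * y <= x `^ p + y `^ p.
Proof.
move=> x0 y0; have [yx|/ltW xy] := leP y x.
  rewrite (@le_trans _ _ (x `^ p)) ?lerDl ?powR_ge0//.
  by rewrite -(@powR_subr1M x)// ler_wpM2l// powR_ge0.
rewrite (@le_trans _ _ (y `^ p)) ?lerDr ?powR_ge0//.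
by rewrite -(@powR_subr1M y)// ler_wpM2r// ge0_ler_powR// ltW.
Qed.

Lemma powR_normD (a b : R) :
  `|a + b| `^ p <= 2 `^ p * (`|a| `^ p + `|b| `^ p).
Proof.
wlog ab : a b / `|b| <= `|a|.
  move=> h; have [|/ltW] := leP `|b| `|a|; first exact: h.
  by rewrite addrC [X in _ * X]addrC; exact: h.
rewrite (@le_trans _ _ ((2 * `|a|) `^ p))//.
  rewrite ge0_ler_powR ?nnegrE ?(ltW p0)// ?mulr_ge0//.
  by rewrite (le_trans (ler_normD _ _))// mulr_natl mulr2n lerD2l.
by rewrite powRM// ler_wpM2l ?powR_ge0// lerDl powR_ge0.
Qed.

Lemma powR_convex_tangent (a b : R) :
  `|b| `^ p - `|a| `^ p <= p * (dualmap b * (b - a)).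
Proof.
rewrite mulrBr dualmapM.
have : dualmap b * a <= (p - 1) / p * `|b| `^ p + p^-1 * `|a| `^ p.
  rewrite (le_trans (ler_norm _))// normrM normr_dualmap.
  have q0 : 0 < p / (p - 1) by rewrite divr_gt0.
  have pq : (p / (p - 1))^-1 + p^-1 = 1 by field; rewrite !gt_eqF.
  have := @conjugate_powR _ (`|b| `^ (p - 1)) `|a| (p / (p - 1)) p
    (powR_ge0 _ _) (normr_ge0 _) q0 p0 pq.
  rewrite -powRrM mulrCA divff ?gt_eqF// mulr1 invf_div.
  by rewrite (mulrC (`|b| `^ p)) (mulrC (`|a| `^ p)).
rewrite -(ler_pM2l p0) => h; rewrite mulrBr; move: h.
have -> : p * ((p - 1) / p * `|b| `^ p + p^-1 * `|a| `^ p) =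
  (p - 1) * `|b| `^ p + `|a| `^ p by field; rewrite gt_eqF.
lra.
Qed.

(* Symmetries reduce a two-point inequality to the case where the largest of the
   two values is positive and comes first. *)
Lemma two_point_wlog (P : R -> R -> Prop) :
  (forall a b, P a b -> P b a) -> (forall a b, P a b -> P (- a) (- b)) ->
  (forall a b, `|b| <= a -> P a b) -> forall a b, P a b.
Proof.
move=> sym opp pos.
have aux a b : `|b| <= `|a| -> P a b.
  move=> ba; have [a0|a0] := leP 0 a; first by apply: pos; rewrite -(ger0_norm a0).
  rewrite -(opprK a) -(opprK b); apply/opp/pos.
  by rewrite normrN -(ltr0_norm a0).
move=> a b; have [|/ltW] := leP `|b| `|a|; first exact: aux.
by move=> ab; apply/sym/aux.
Qed.

(** By homogeneity, the modulus of continuity of the duality map at [1] governs it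
    everywhere. *)
Lemma dualmap_continuity (eps : R) : 0 < eps -> exists2 C, 0 < C & forall a b : R,
  `|dualmap a - dualmap b| <=
  eps * (`|a| `^ (p - 1) + `|b| `^ (p - 1)) + C * `|a - b| `^ (p - 1).
Proof.
move=> e0.
have cont : {for (1 : R), continuous (fun x : R => x `^ (p - 1))}.
  apply: differentiable_continuous; apply/derivable1_diffP.
  by apply: derivable_powR; rewrite in_itv/= ltr01.
have /cvgrPdist_le/(_ _ e0)[th0 /= th00 thP] := cont.
pose th := Num.min (th0 / 2) (1 / 2).
have thgt0 : 0 < th by rewrite lt_min !divr_gt0.
have [th2 thth0] : th <= 1 / 2 /\ th < th0.
  split; first by rewrite ge_min lexx orbT.
  by rewrite gt_min; apply/orP; left; lra.
pose C := 2 * (th^-1 `^ (p - 1)).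
have C0 : 0 < C by rewrite mulr_gt0// powR_gt0 ?invr_gt0.
exists C => //.
apply: two_point_wlog => [a b|a b|a b ba].
- by rewrite distrC addrC [in leRHS](distrC a) [X in eps * X]addrC addrC.
- by rewrite !dualmapN -!opprD !normrN.
have a0 : 0 <= a := le_trans (normr_ge0 _) ba.
have pos1 x : 0 <= x `^ (p - 1) by exact: powR_ge0.
have [abl|abl] := leP (th * a) `|a - b|.
  rewrite (@le_trans _ _ (C * `|a - b| `^ (p - 1)))//; last first.
    by rewrite lerDr mulr_ge0 ?addr_ge0// ltW.
  rewrite (@le_trans _ _ (2 * a `^ (p - 1)))//.
    rewrite (le_trans (ler_normB _ _))// !normr_dualmap (ger0_norm a0).
    by rewrite mulr_natl mulr2n lerD2l ge0_ler_powR// ?nnegrE// ltW.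
  rewrite /C -mulrA ler_pM2l// -powRM ?invr_ge0 ?(ltW thgt0)//.
  rewrite ge0_ler_powR ?nnegrE ?(ltW pm1)//.
    by rewrite mulr_ge0 ?invr_ge0 ?(ltW thgt0).
  by rewrite mulrC ler_pdivlMr// mulrC.
have agt0 : 0 < a.
  rewrite lt_neqAle a0 andbT; apply/eqP => a00; move: abl.
  by rewrite -a00 mulr0 ltNge normr_ge0.
have ba' : b <= a := le_trans (ler_norm b) ba.
have b0 : 0 <= b.
  move: abl; rewrite ger0_norm ?subr_ge0// => abl.
  have : th * a <= 1 / 2 * a by rewrite ler_pM2r.
  lra.
rewrite (@le_trans _ _ (eps * a `^ (p - 1)))//; last first.
  rewrite (ger0_norm a0) mulrDr -addrA lerDl addr_ge0//.
    by rewrite mulr_ge0// ltW.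
  by rewrite mulr_ge0// ltW.
rewrite !ge0_dualmap//.
have -> : b `^ (p - 1) = a `^ (p - 1) * (b / a) `^ (p - 1).
  by rewrite -powRM ?divr_ge0// mulrC divfK// gt_eqF.
rewrite -[X in X - _]mulr1 -mulrBr normrM ger0_norm// mulrC ler_pM2r ?powR_gt0//.
have := thP (b / a); rewrite powR1; apply => /=.
rewrite -[X in X - _](divff (lt0r_neq0 agt0)) -mulrBl normrM normfV.
by rewrite (gtr0_norm agt0) ltr_pdivrMr// (lt_trans abl)// ltr_pM2r.
Qed.

Lemma dualmap_continuityM (eps : R) : 0 < eps -> exists2 C, 0 < C & forall a b e : R,
  `|dualmap a - dualmap b| * `|e| <=
  eps * (`|a| `^ p + `|b| `^ p + `|e| `^ p) + C * `|a - b| `^ p.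
Proof.
move=> e0; have e40 : 0 < eps / 4 by rewrite divr_gt0.
have [C C0 HC] := dualmap_continuity e40.
have e20 : 0 < eps / 2 / C by rewrite !divr_gt0.
have [K K0 HK] := young_weightr e20.
exists (C * K); first by rewrite mulr_gt0.
move=> a b e; rewrite (le_trans (ler_wpM2r (normr_ge0 e) (HC a b)))//.
have h1 := young_simple (normr_ge0 a) (normr_ge0 e).
have h2 := young_simple (normr_ge0 b) (normr_ge0 e).
have h3 := HK _ _ (normr_ge0 (a - b)) (normr_ge0 e).
have h3' := ler_wpM2l (ltW C0) h3; have h12 := ler_wpM2l (ltW e40) (lerD h1 h2).
have ea : 0 <= eps * `|a| `^ p by rewrite mulr_ge0 ?powR_ge0// ltW.
have eb : 0 <= eps * `|b| `^ p by rewrite mulr_ge0 ?powR_ge0// ltW.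
have ee : 0 <= eps * `|e| `^ p by rewrite mulr_ge0 ?powR_ge0// ltW.
have Ce : C * (eps / 2 / C * `|e| `^ p) = eps / 2 * `|e| `^ p.
  by field; rewrite gt_eqF.
rewrite mulrDr Ce in h3'; lra.
Qed.

(** Uniform monotonicity: the quantitative form, on [L^p], of strict convexity. *)
Lemma dualmap_unif_monotone (eps : R) : 0 < eps -> exists2 C, 0 < C & forall a b : R,
  `|a - b| `^ p <= eps * (`|a| `^ p + `|b| `^ p) +
                   C * ((dualmap a - dualmap b) * (a - b)).
Proof.
move=> e0; pose th := Num.min (eps `^ p^-1) 1.
have th0 : 0 < th by rewrite lt_min powR_gt0//=.
have [th1 the] : th <= 1 /\ th `^ p <= eps.
  split; first by rewrite ge_min lexx orbT.
  rewrite (@le_trans _ _ ((eps `^ p^-1) `^ p))//.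
    rewrite ge0_ler_powR ?nnegrE ?(ltW p0) ?(ltW th0) ?powR_ge0//.
    by rewrite ge_min lexx.
  by rewrite -powRrM mulVf ?gt_eqF// powRr1// ltW.
pose d := 1 - (1 - th) `^ (p - 1).
have d0 : 0 < d.
  rewrite subr_gt0 -[ltRHS](_ : 1 `^ (p - 1) = 1); last by rewrite powR1.
  rewrite gt0_ltr_powR ?nnegrE ?subr_ge0//.
  by rewrite gtrBl.
pose C := 2 `^ p / (d * th).
have C0 : 0 < C by rewrite divr_gt0 ?powR_gt0// mulr_gt0.
exists C => //.
apply: two_point_wlog => [a b|a b|a b ba].
- by rewrite distrC (addrC (_ `^ p)) -(opprB a b) -(opprB (dualmap a)) mulrNN.
- by rewrite !dualmapN -!opprD !normrN mulrNN.
have a0 : 0 <= a := le_trans (normr_ge0 _) ba.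
have ba' : b <= a := le_trans (ler_norm b) ba.
have [abl|abl] := leP `|a - b| (th * a).
  rewrite (@le_trans _ _ (eps * `|a| `^ p))//; last first.
    rewrite mulrDr -addrA lerDl addr_ge0 ?(mulr_ge0 (ltW e0)) ?powR_ge0//.
    by rewrite mulr_ge0 ?(ltW C0)// dualmap_mono_ge0.
  rewrite (@le_trans _ _ ((th * a) `^ p))//.
    by rewrite ge0_ler_powR ?nnegrE ?(ltW p0)// mulr_ge0// ltW.
  by rewrite powRM ?(ltW th0)// (ger0_norm a0) ler_wpM2r// powR_ge0.
rewrite (@le_trans _ _ (C * ((dualmap a - dualmap b) * (a - b))))//; last first.
  by rewrite lerDr mulr_ge0 ?addr_ge0 ?powR_ge0// ltW.
have agt0 : 0 < a.
  rewrite lt_neqAle a0 andbT; apply/eqP => a00; move: abl ba.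
  by rewrite -a00 mulr0 normr_le0 => + /eqP b0; rewrite b0 subrr normr0 ltxx.
rewrite (@le_trans _ _ ((2 * a) `^ p))//.
  rewrite ge0_ler_powR ?nnegrE ?(ltW p0) ?mulr_ge0//.
  by rewrite (le_trans (ler_normB _ _))// (ger0_norm a0) mulr_natl mulr2n lerD2l.
rewrite powRM// /C -mulrA ler_wpM2l ?powR_ge0// mulrC ler_pdivlMr ?mulr_gt0//.
move: abl; rewrite ger0_norm ?subr_ge0// => abl.
rewrite -(@powR_subr1M _)// (_ : _ * (d * th) = (a `^ (p - 1) * d) * (th * a)).
  rewrite ler_pM ?mulr_ge0 ?powR_ge0 ?(ltW d0) ?(ltW th0) ?(ltW abl)//.
  rewrite mulrBr mulr1 ge0_dualmap// lerD2l lerN2 -powRM ?subr_ge0//.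
  rewrite -ge0_dualmap ?mulr_ge0 ?subr_ge0//; apply: dualmap_mono.
  lra.
by ring.
Qed.

End duality_map.

Section affine.
Context {R : realType}.
Local Notation mu := (@lebesgue_measure R).

Lemma lebesgue_measure_affine (a b : R) (A : set R) : a != 0 -> measurable A ->
  (mu A = `|a|%:E * mu ((fun x => a * x + b)%R @^-1` A))%E.
Proof.
move=> a0 mA; pose phi (x : R) := a * x + b.
have mphi : @measurable_fun _ _ (measurableTypeR R) (measurableTypeR R) setT phi.
  by apply: measurable_funD => //; exact: measurable_funM.
pose k : {nonneg R} := NngNum (normr_ge0 a).
pose nu : {measure set (measurableTypeR R) -> \bar R} :=
  mscale k (measure_function_pushforward__canonical__measure_function_Measure mu mphi).
have aneg : ~~ (0 < a) -> a < 0 by rewrite -leNgt le_eqVlt (negbTE a0).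
have -> : mu A = nu A; last by [].
apply: (@lebesgue_measure_unique _ nu) => // X [[x y] _ <-] /=.
rewrite /nu /mscale /=.
have pre : phi @^-1` `]x, y] = if 0 < a then `](x - b) / a, (y - b) / a]%classic
                               else `[(y - b) / a, (x - b) / a[%classic.
  apply/seteqP; split => z; rewrite /phi /=.
    rewrite in_itv/= => /andP[xz zy]; case: ifPn => [agt0|].
      by rewrite /= in_itv/= ltr_pdivrMr// ler_pdivlMr// mulrC ltrBlDr xz lerBrDr.
    move=> /aneg alt0.
    by rewrite /= in_itv/= ler_ndivrMr// ltr_ndivlMr// mulrC ltrBlDr xz lerBrDr zy.
  case: ifPn => [agt0|]; rewrite /= !in_itv/=.
    by rewrite ltr_pdivrMr// ler_pdivlMr// mulrC ltrBlDr lerBrDr.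
  move=> /aneg alt0.
  by rewrite ler_ndivrMr// ltr_ndivlMr// mulrC ltrBlDr lerBrDr andbC.
rewrite [X in (_ * X)%E](_ : _ = mu (phi @^-1` `]x, y])) // pre; case: ifPn => [agt0|].
  rewrite !lebesgue_measure_itv/= !lte_fin ltr_pM2r ?invr_gt0// ltrD2r.
  case: ifPn => _; last by rewrite mule0.
  rewrite -EFinD -EFinM -mulrBl opprB addrA subrK gtr0_norm//.
  by rewrite mulrC divfK.
move=> /aneg alt0.
rewrite !lebesgue_measure_itv/= !lte_fin ltr_nM2r ?invr_lt0// ltrD2r.
case: ifPn => _; last by rewrite mule0.
rewrite -EFinD -EFinM -mulrBl opprB addrA subrK ltr0_norm//.
by rewrite mulrC mulrN divfK// opprB.
Qed.

Lemma ge0_integral_affine (a b : R) (f : R -> \bar R) : a != 0 ->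
  measurable_fun setT f -> (forall x, 0 <= f x)%E ->
  (\int[mu]_x f x = `|a|%:E * \int[mu]_x f (a * x + b)%R)%E.
Proof.
move=> a0 mf f0; pose phi (x : R) := a * x + b.
have mphi : @measurable_fun _ _ (measurableTypeR R) (measurableTypeR R) setT phi.
  by apply: measurable_funD => //; exact: measurable_funM.
pose k : {nonneg R} := NngNum (normr_ge0 a).
pose pf := measure_function_pushforward__canonical__measure_function_Measure mu mphi.
rewrite (@eq_measure_integral _ _ _ _ (mscale k pf)) /=; last first.
  by move=> A mA _; rewrite (@lebesgue_measure_affine a b).
rewrite ge0_integral_mscale//; congr (_ * _)%E.
by rewrite ge0_integral_pushforward// preimage_setT.
Qed.

Lemma integral_reflection (b : R) (f : R -> \bar R) : measurable_fun setT f ->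
  (\int[mu]_x f x = \int[mu]_x f (b - x)%R)%E.
Proof.
move=> mf; rewrite integralE [RHS]integralE.
have aux (g : R -> \bar R) : measurable_fun setT g -> (forall x, 0 <= g x)%E ->
    (\int[mu]_x g x = \int[mu]_x g (b - x)%R)%E.
  move=> mg g0; rewrite (@ge0_integral_affine (-1) b)// ?oppr_eq0 ?oner_eq0//.
  rewrite normrN1 mul1e; apply: eq_integral => x _.
  by congr g; rewrite mulN1r addrC.
congr (_ - _)%E.
  rewrite aux; [by apply: eq_integral => x _; rewrite !funeposE|exact: measurable_funepos|by []].
rewrite aux; [by apply: eq_integral => x _; rewrite !funenegE|exact: measurable_funeneg|by []].
Qed.

Lemma integrable_reflection (b : R) (f : R -> \bar R) :
  mu.-integrable setT f -> mu.-integrable setT (fun x => f (b - x)).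
Proof.
move=> /integrableP[mf foo]; apply/integrableP; split.
  by apply: measurableT_comp => //; exact: measurable_funB.
by rewrite -(@integral_reflection b (abse \o f))//; exact: measurableT_comp.
Qed.

End affine.

Section power_integrals.
Context {R : realType}.
Local Notation mu := (@lebesgue_measure R).

Lemma integral_derive (f F : R -> R) (u v : R) : u <= v ->
  (forall x, u <= x <= v -> derivable F x 1) ->
  (forall x, u <= x <= v -> F^`()%classic x = f x) ->
  (forall x, u <= x <= v -> {for x, continuous f}) ->
  (\int[mu]_(x in `[u, v]) (f x)%:E = (F v - F u)%:E)%E.
Proof.
rewrite le_eqVlt => /predU1P[-> _ _ _|uv dF F'f cf].
  by rewrite set_itv1 integral_set1 subrr.
have cF x : u <= x <= v -> {for x, continuous F}.
  by move=> uxv; apply: differentiable_continuous; apply/derivable1_diffP/dF.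
rewrite (@continuous_FTC2 _ f F u v)//.
- apply/continuous_within_itvP => //; split.
  + by move=> x xuv; apply: cf; rewrite !ltW ?(itvP xuv).
  + by apply: cvg_at_right_filter; apply: cf; rewrite lexx ltW.
  + by apply: cvg_at_left_filter; apply: cf; rewrite lexx ltW.
- split.
  + by move=> x xuv; apply: dF; rewrite !ltW ?(itvP xuv).
  + by apply: cvg_at_right_filter; apply: cF; rewrite lexx ltW.
  + by apply: cvg_at_left_filter; apply: cF; rewrite lexx ltW.
- by move=> x xuv; rewrite F'f// !ltW ?(itvP xuv).
Qed.

Definition kern (b x : R) : R := if 0 < x then x `^ b else 0.

Lemma kern_ge0 b x : 0 <= kern b x.
Proof. by rewrite /kern; case: ifP => // _; exact: powR_ge0. Qed.

Lemma kernE b x : 0 < x -> kern b x = x `^ b.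
Proof. by rewrite /kern => ->. Qed.

Lemma kern_le0 b x : x <= 0 -> kern b x = 0.
Proof. by rewrite /kern leNgt => /negbTE ->. Qed.

Lemma kern_ge0E b x : b != 0 -> 0 <= x -> kern b x = x `^ b.
Proof.
move=> b0; rewrite le_eqVlt => /predU1P[<-|/kernE//].
by rewrite kern_le0// powR0.
Qed.

Lemma measurable_kern b : measurable_fun setT (kern b).
Proof.
apply: measurable_fun_ifT => //.
by apply: measurable_fun_ltr => //; exact: measurable_id.
Qed.

Lemma integral_kern (b a : R) : -1 < b -> 0 <= a ->
  (\int[mu]_(x in `[0%R, a]) (kern b x)%:E = (a `^ (b + 1) / (b + 1))%:E)%E.
Proof.
move=> b1; have b10 : 0 < b + 1 by rewrite -ltrBlDr sub0r.
rewrite le_eqVlt => /predU1P[<-|a0].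
  by rewrite set_itv1 integral_set1 powR0 ?gt_eqF// mul0r.
rewrite -integral_itv_obnd_cbnd; last first.
  by apply/measurable_EFinP/measurable_funTS; exact: measurable_kern.
pose F i := [set` `[a / i.+1%:R, a]] : set R.
have aF i : 0 < a / i.+1%:R by rewrite divr_gt0.
have FE : \bigcup_i F i = `]0, a]%classic.
  apply/seteqP; split => [x [i _]|x]; rewrite /F /= !in_itv/=.
    by move=> /andP[ix ->]; rewrite (lt_le_trans (aF i) ix).
  move=> /andP[x0 xa]; exists (Num.truncn (a / x)) => //.
  rewrite /F /= in_itv/= xa andbT ler_pdivrMr// mulrC -ler_pdivrMr//.
  by rewrite ltW// truncnS_gt.
rewrite -FE.
have mk i : measurable_fun (F i) (fun x => (kern b x)%:E).
  by apply/measurable_EFinP/measurable_funTS; exact: measurable_kern.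
have nF : nondecreasing_seq F.
  apply/nondecreasing_seqP => i; rewrite subsetEset => x /=. rewrite /F /= !in_itv/=.
  move=> /andP[ix ->]; rewrite andbT (le_trans _ ix)// ler_pM2l// lef_pV2 ?posrE//.
  by rewrite ler_nat.
have mF i : measurable (F i) by exact: measurable_itv.
have k0 (i : nat) x : F i x -> (0 <= (kern b x)%:E)%E by rewrite lee_fin kern_ge0.
have cvg1 := ge0_nondecreasing_set_cvg_integral nF mF mk k0 (mu := mu).
have FF i : (\int[mu]_(x in F i) (kern b x)%:E =
    ((a `^ (b + 1) / (b + 1)) - ((a / i.+1%:R) `^ (b + 1) / (b + 1)))%:E)%E.
  have ia : a / i.+1%:R <= a.
    by rewrite ler_pdivrMr// ler_peMr// ?ler1n// ltW.
  have pos x : a / i.+1%:R <= x <= a -> 0 < x.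
    by move=> /andP[ix _]; exact: lt_le_trans ix.
  transitivity (\int[mu]_(x in F i) (x `^ b)%:E)%E.
    apply: eq_integral => x; rewrite inE /F/= in_itv/= => /pos x0.
    by rewrite kernE.
  have der (x : R) : 0 < x -> is_derive x 1 (fun x : R => x `^ (b + 1) / (b + 1)) (x `^ b).
    move=> x0.
    have dx : derivable (fun x : R => x `^ (b + 1)) x 1.
      by apply: derivable_powR; rewrite in_itv/= x0.
    have D1 : is_derive x 1 (fun x : R => x `^ (b + 1)) ((b + 1) * x `^ b).
      split => //; rewrite -derive1E powR_derive1 ?in_itv/= ?x0// addrK.
      by [].
    have -> : (fun x : R => x `^ (b + 1) / (b + 1)) =
        (fun x : R => (b + 1)^-1 *: x `^ (b + 1)).
      by apply/funext => z; rewrite mulrC.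
    apply: is_derive_eq.
    by rewrite /GRing.scale/= mulrA mulVf ?gt_eqF// mul1r.
  apply: (@integral_derive _ (fun x : R => x `^ (b + 1) / (b + 1))) => //.
  - by move=> x /pos /der[].
  - by move=> x /pos /der[? <-]; rewrite derive1E.
  - move=> x /pos x0; apply: differentiable_continuous; apply/derivable1_diffP.
    by apply: derivable_powR; rewrite in_itv/= x0.
rewrite (funext FF) in cvg1; apply: (cvg_unique _ cvg1) => //.
apply: cvg_EFin; first exact: nearW.
rewrite -[X in _ --> X]subr0; apply: cvgB; first exact: cvg_cst.
rewrite -(mul0r (b + 1)^-1); apply: cvgMl.
have c0 : (a / i.+1%:R) @[i --> \oo] --> (0 : R).
  rewrite -(mulr0 a); apply: cvgMr; exact: cvg_harmonic.
exact: (cvg_at_rightP _ _ _).1 (powR_cvg0 b10) _ (conj aF c0).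
Qed.

End power_integrals.

Section kernels.
Context {R : realType}.
Local Notation mu := (@lebesgue_measure R).

Lemma kernM (b a x : R) : 0 < a -> kern b (a * x) = a `^ b * kern b x.
Proof.
move=> a0; rewrite /kern pmulr_rgt0//; case: ifP => x0; last by rewrite mulr0.
by rewrite powRM ?ltW.
Qed.

Lemma ge0_integral_itv_reflection (g : R -> R) (u v : R) :
  measurable_fun setT g -> (forall x, 0 <= g x) ->
  (\int[mu]_(s in `[u, v]) (g (v - s)%R)%:E =
   \int[mu]_(s in `[0%R, (v - u)%R]) (g s)%:E)%E.
Proof.
move=> mg g0; rewrite integral_mkcond [RHS]integral_mkcond/=.
rewrite [RHS](@ge0_integral_affine _ (-1) v)/= ?oppr_eq0 ?oner_eq0//.
- rewrite normrN1 mul1e; apply: eq_integral => x _; rewrite !patchE.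
  rewrite mulN1r (addrC (- x)); congr (if _ then _ else _).
  apply/idP/idP; rewrite !inE/= !in_itv/= subr_ge0 lerD2l lerN2 andbC//.
- apply/(measurable_restrictT _ _).1 => //.
  by apply/measurable_EFinP/measurable_funTS.
- by move=> x; rewrite patchE; case: ifP => // _; rewrite lee_fin.
Qed.

Lemma integral_kern_reflection (b u v : R) : -1 < b -> u <= v ->
  (\int[mu]_(s in `[u, v]) (kern b (v - s)%R)%:E =
   ((v - u) `^ (b + 1) / (b + 1))%:E)%E.
Proof.
move=> b1 uv; rewrite ge0_integral_itv_reflection.
- by rewrite integral_kern// subr_ge0.
- exact: measurable_kern.
- exact: kern_ge0.
Qed.

Lemma Gamma_gt0 (alpha : R) : 0 < alpha < 1 -> 0 < Gamma (1 - alpha).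
Proof.
move=> /andP[a0 a1]; rewrite /Gamma.
pose g (s : R) := s `^ (1 - alpha - 1) * expR (- s).
have gE s : 0 < s -> g s = kern (- alpha) s * expR (- s).
  by move=> s0; rewrite /g kernE//; congr (_ `^ _ * _); ring.
have mg : measurable_fun setT g.
  apply: measurable_funM => //.
  by apply: measurableT_comp => //; exact: measurableT_comp.
have mk : measurable_fun setT (kern (- alpha) : R -> R) by exact: measurable_kern.
have ek : (\int[mu]_(s in `[0%R, 1%R]) (kern (- alpha) s)%:E =
    (1 `^ (- alpha + 1) / (- alpha + 1))%:E)%E.
  by rewrite integral_kern// ltrN2.
have up : (\int[mu]_(s in `]0%R, +oo[) (g s)%:E < +oo)%E.
  pose h s := kern (- alpha) s * \1_(`[0, 1]) s + exponential_pdf 1 s.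
  have mh1 : measurable_fun setT (fun s : R => kern (- alpha) s * \1_(`[0, 1]) s).
    by apply: measurable_funM => //; exact: measurable_indic.
  have p0 (s : R) : 0 <= exponential_pdf 1 s by exact: exponential_pdf_ge0.
  apply: (@le_lt_trans _ _ (\int[mu]_(s in setT) (h s)%:E)%E).
    apply: (@le_trans _ _ (\int[mu]_(s in `]0%R, +oo[) (h s)%:E)%E).
      apply: ge0_le_integral => //.
      - by move=> x _; rewrite lee_fin mulr_ge0 ?powR_ge0 ?expR_ge0.
      - by apply/measurable_EFinP/measurable_funTS.
      - apply/measurable_EFinP/measurable_funTS/measurable_funD => //.
        exact: measurable_exponential_pdf.
      - move=> x; rewrite /= in_itv/= andbT => x0; rewrite lee_fin /h gE//.
        have [x1|x1] := leP x 1.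
          rewrite indicE mem_set/= ?in_itv/= ?x1 ?(ltW x0)// mulr1.
          rewrite (@le_trans _ _ (kern (- alpha) x))//; last by rewrite lerDl.
          by rewrite ler_piMr ?kern_ge0// expR_le1 oppr_le0 ltW.
        rewrite ler_wpDl ?mulr_ge0 ?kern_ge0//.
        rewrite (_ : exponential_pdf 1 x = expR (- x)); last first.
          by rewrite exponential_pdfE ?ltW//= mul1r mulN1r.
        rewrite ler_piMl ?expR_ge0// kernE// -(powRr0 x).
        by rewrite ler_powR ?oppr_le0 ?ltW.
    apply: ge0_subset_integral => //.
      apply/measurable_EFinP/measurable_funD => //.
      exact: measurable_exponential_pdf.
    by move=> x _; rewrite lee_fin addr_ge0// mulr_ge0 ?kern_ge0.
  under eq_integral do rewrite EFinD.
  rewrite ge0_integralD//=; first last.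
  - by apply/measurable_EFinP; exact: measurable_exponential_pdf.
  - by move=> x _; rewrite lee_fin.
  - exact/measurable_EFinP.
  - by move=> x _; rewrite lee_fin mulr_ge0// kern_ge0.
  rewrite integral_exponential_pdf// lte_add_pinfty ?ltry//.
  suff -> : (\int[mu]_s (kern (- alpha) s * \1_(`[0, 1]) s)%:E =
      \int[mu]_(s in `[0%R, 1%R]) (kern (- alpha) s)%:E)%E by rewrite ek ltry.
  rewrite [RHS]integral_mkcond; apply: eq_integral => s _.
  by rewrite patchE indicE; case: ifP => _; rewrite ?mulr1 ?mulr0.
have low : ((expR (- 1))%:E <= \int[mu]_(s in `]0%R, +oo[) (g s)%:E)%E.
  apply: (@le_trans _ _ (\int[mu]_(s in `]0%R, 1%R]) (expR (- 1))%:E)%E).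
    rewrite integral_cst//= lebesgue_measure_itv/= lte_fin ltr01.
    by rewrite oppr0 adde0 mule1.
  apply: (@le_trans _ _ (\int[mu]_(s in `]0%R, 1%R]) (g s)%:E)%E).
    apply: ge0_le_integral => //.
    - by apply/measurable_EFinP/measurable_funTS.
    - move=> x; rewrite /= in_itv/= => /andP[x0 x1]; rewrite lee_fin gE//.
      rewrite -[leLHS]mul1r ler_pM ?expR_ge0 ?ler_expR ?lerN2// kernE//.
      by rewrite -[leLHS](powRr0 x) ger_powR ?x0// oppr_le0 ltW.
  apply: ge0_subset_integral => //.
    by apply/measurable_EFinP/measurable_funTS.
    by move=> x _; rewrite lee_fin mulr_ge0 ?powR_ge0 ?expR_ge0.
  by move=> x /=; rewrite !in_itv/= andbT => /andP[].
rewrite /Rintegral fine_gt0// up andbT (lt_le_trans _ low)//.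
Qed.

(** Euler's Beta integral, of which only positivity and finiteness matter. *)
Lemma beta_kern (alpha : R) : 0 < alpha < 1 -> exists2 c : R, 0 < c &
  (\int[mu]_s (kern (alpha - 1) (1 - s)%R * kern (- alpha) s)%:E = c%:E)%E.
Proof.
move=> /andP[a0 a1].
pose g (s : R) := kern (alpha - 1) (1 - s) * kern (- alpha) s.
have mk b : measurable_fun setT (kern b : R -> R) by exact: measurable_kern.
have mk1 b : measurable_fun setT (fun s : R => kern b (1 - s)).
  by apply: measurableT_comp => //; exact: measurable_funB.
have mg : measurable_fun setT g by exact: measurable_funM.
have g0 s : 0 <= g s by rewrite mulr_ge0 ?kern_ge0.
pose h (s : R) := 2 * kern (- alpha) s + 2 * kern (alpha - 1) (1 - s).
have mh : measurable_fun setT h.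
  by apply: measurable_funD; exact: measurable_funM.
have h0 s : 0 <= h s by rewrite addr_ge0// mulr_ge0// kern_ge0.
have half (b x : R) : -1 <= b -> b <= 0 -> 1 / 2 <= x <= 1 -> kern b x <= 2.
  move=> b1 b0 /andP[x2 x1]; have x0 : 0 < x by lra.
  rewrite kernE// (@le_trans _ _ (x `^ (-1)))//.
    by rewrite ger_powR ?x0.
  by rewrite powR_inv1 ?(ltW x0)// -div1r ler_pdivrMr//; lra.
have gh s : 0 <= s <= 1 -> g s <= h s.
  move=> /andP[s0 s1]; have [s2|s2] := leP s (1 / 2).
    rewrite /g /h ler_wpDr ?mulr_ge0 ?kern_ge0// ler_wpM2r ?kern_ge0// half//; lra.
  rewrite /g /h ler_wpDl ?mulr_ge0 ?kern_ge0// mulrC ler_wpM2r ?kern_ge0// half//; lra.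
have gT : (\int[mu]_s (g s)%:E = \int[mu]_(s in `[0%R, 1%R]) (g s)%:E)%E.
  rewrite [RHS]integral_mkcond; apply: eq_integral => s _; rewrite patchE.
  case: ifPn => //; rewrite notin_setE/= in_itv/= => /negP.
  rewrite negb_and -!ltNge => /orP[s0|s1]; rewrite /g.
    by rewrite [kern (- alpha) s]kern_le0 ?ltW// mulr0.
  by rewrite [kern (alpha - 1) _]kern_le0 ?mul0r// subr_le0 ltW.
have up : (\int[mu]_s (g s)%:E < +oo)%E.
  rewrite gT; apply: (@le_lt_trans _ _ (\int[mu]_(s in `[0%R, 1%R]) (h s)%:E)%E).
    apply: ge0_le_integral => //.
    - by move=> x _; rewrite lee_fin.
    - by apply/measurable_EFinP/measurable_funTS.
    - by apply/measurable_EFinP/measurable_funTS.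
  under eq_integral do rewrite EFinD.
  have k20 (b x : R) : (0 <= (2 * kern b x)%:E)%E by rewrite lee_fin mulr_ge0// kern_ge0.
  have k0 (b x : R) : (0 <= (kern b x : R)%:E)%E by rewrite lee_fin kern_ge0.
  have m1 : measurable_fun (`[0, 1]%classic : set R) (fun x : R => (kern (- alpha) x)%:E).
    by apply/measurable_EFinP/measurable_funTS.
  have m2 : measurable_fun (`[0, 1]%classic : set R) (fun x : R => (kern (alpha - 1) (1 - x))%:E).
    by apply/measurable_EFinP/measurable_funTS.
  have m3 : measurable_fun (`[0, 1]%classic : set R) (fun x : R => (2 * kern (- alpha) x)%:E).
    by apply/measurable_EFinP/measurable_funTS/measurable_funM.
  have m4 : measurable_fun (`[0, 1]%classic : set R) (fun x : R => (2 * kern (alpha - 1) (1 - x))%:E).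
    by apply/measurable_EFinP/measurable_funTS/measurable_funM.
  rewrite ge0_integralD//=.
  under eq_integral do rewrite EFinM.
  under [X in (_ + X)%E]eq_integral do rewrite EFinM.
  rewrite !ge0_integralZl_EFin//.
  rewrite integral_kern ?ltrN2// integral_kern_reflection//; last by lra.
  by rewrite -!EFinM -EFinD ltry.
have low : (1 <= \int[mu]_s (g s)%:E)%E.
  apply: (@le_trans _ _ (\int[mu]_(s in `]0%R, 1%R[) (1%:E))%E).
    by rewrite integral_cst//= lebesgue_measure_itv/= lte_fin ltr01 oppr0 adde0 mule1.
  apply: (@le_trans _ _ (\int[mu]_(s in `]0%R, 1%R[) (g s)%:E)%E).
    apply: ge0_le_integral => //.
    - by apply/measurable_EFinP/measurable_funTS.
    - move=> x; rewrite /= in_itv/= => /andP[x0 x1]; rewrite lee_fin /g.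
      rewrite -[leLHS]mul1r; apply: ler_pM => //; rewrite kernE ?subr_gt0//.
        by rewrite -[leLHS](powRr0 (1 - x)) ger_powR ?subr_gt0 ?x1//=; lra.
      by rewrite -[leLHS](powRr0 x) ger_powR ?x0 ?(ltW x1)// oppr_le0 ltW.
  apply: ge0_subset_integral => //.
    by apply/measurable_EFinP.
  by move=> x _; rewrite lee_fin.
exists (fine (\int[mu]_s (g s)%:E)); first by rewrite fine_gt0// up (lt_le_trans _ low).
by rewrite fineK// ge0_fin_numE// (le_trans _ low).
Qed.

(** The composition of the kernels of orders [alpha] and [1 - alpha] is constant:
    an affine change of variable brings it to Euler's Beta integral. *)
Lemma kern_composition (alpha c : R) :
  (\int[mu]_s (kern (alpha - 1) (1 - s)%R * kern (- alpha) s)%:E = c%:E)%E ->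
  forall x t, (\int[mu]_s (kern (alpha - 1) (t - s)%R * kern (- alpha) (s - x)%R)%:E
    = (if x < t then c else 0)%:E)%E.
Proof.
move=> cE x t; case: ifPn => [xt|]; last first.
  rewrite -leNgt => tx; rewrite integral0_eq// => s _.
  have [st|ts] := leP s t.
    by rewrite [kern (- alpha) _]kern_le0 ?mulr0// subr_le0 (le_trans st).
  by rewrite kern_le0 ?mul0r// subr_le0 ltW.
have mk b : measurable_fun setT (kern b : R -> R) by exact: measurable_kern.
have tx0 : 0 < t - x by rewrite subr_gt0.
rewrite (@ge0_integral_affine _ (t - x) x) ?gt_eqF//; last 2 first.
- apply/measurable_EFinP/measurable_funM; apply: measurableT_comp => //.
  + exact: measurable_funB.
  + exact: measurable_funB.
- by move=> s; rewrite lee_fin mulr_ge0 ?kern_ge0.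
rewrite -cE -ge0_integralZl_EFin//=.
- apply: eq_integral => s _; rewrite -EFinM; congr EFin.
  rewrite addrK kernM// [X in kern (alpha - 1) X](_ : _ = (t - x) * (1 - s)); last by ring.
  have AB : (t - x) * ((t - x) `^ (alpha - 1) * (t - x) `^ (- alpha)) = 1.
    rewrite -powRD; last by apply/implyP => _; rewrite gt_eqF.
    have -> : alpha - 1 + - alpha = -1 by ring.
    by rewrite powR_inv1 ?(ltW tx0)// mulfV// gt_eqF.
  rewrite kernM// gtr0_norm//.
  move: AB (kern _ (1 - s)) (kern _ s).
  move: (_ `^ (alpha - 1)) (_ `^ (- alpha)) => A B AB k1 k2.
  by rewrite -[RHS]mul1r -[1]AB; ring.
- by move=> s _; rewrite lee_fin mulr_ge0 ?kern_ge0.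
- apply/measurable_EFinP/measurable_funM; apply: measurableT_comp => //.
    by apply: measurable_funB => //; apply: measurable_funD => //; exact: measurable_funM.
  by apply: measurable_funB => //; apply: measurable_funD => //; exact: measurable_funM.
Qed.
End kernels.

Section test_functions.
Context {R : realType}.
Implicit Types (u v w : R -> R) (T : R).

Lemma smooth_derivable u : smooth u -> forall x, derivable u x 1.
Proof. by move=> su x; exact: (su 0%N). Qed.

Lemma smooth_derive1 u : smooth u -> smooth u^`()%classic.
Proof. by move=> su n x; have := su n.+1 x; rewrite /derive1n iterSr. Qed.

Lemma derivable_continuous u : (forall x, derivable u x 1) -> continuous u.
Proof.
by move=> du x; apply: differentiable_continuous; apply/derivable1_diffP/du.
Qed.

Lemma derive1n_lin (a : R) u v : smooth u -> smooth v ->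
  forall n, derive1n n (u + a *: v) = derive1n n u + a *: derive1n n v.
Proof.
move=> su sv; elim=> [//|n IH]; rewrite /derive1n !iterS -!/(derive1n _ _) IH.
apply/funext => x; rewrite !derive1E.
have dv : derivable (a *: derive1n n v) x 1 by apply: derivableZ; exact: sv.
by rewrite deriveD//= deriveZ -?derive1E//; exact: sv.
Qed.

Lemma smooth_lin (a : R) u v : smooth u -> smooth v -> smooth (u + a *: v).
Proof.
move=> su sv n x; rewrite derive1n_lin//.
by apply: derivableD; [exact: su|apply: derivableZ; exact: sv].
Qed.

Lemma C0infty_lin T (a : R) u v : C0infty T u -> C0infty T v ->
  C0infty T (u + a *: v).
Proof.
move=> [su cu uT] [sv cv vT].
have sub : closure [set t | (u + a *: v) t != 0] `<=`
    closure [set t | u t != 0] `|` closure [set t | v t != 0].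
  rewrite -closureU; apply: closure_subset => t /=.
  have [u0|//] := eqVneq (u t) 0; last by left.
  have [v0|//] := eqVneq (v t) 0; last by right.
  by rewrite !fctE u0 v0 scaler0 addr0 eqxx.
split; first exact: smooth_lin.
- by apply: (subclosed_compact _ (compactU cu cv) sub); exact: closed_closure.
- by apply: (subset_trans sub); rewrite subUset.
Qed.

Lemma C0infty0 T : C0infty T (0 : R -> R).
Proof.
have E : [set t | (0 : R -> R) t != 0] = set0.
  by apply/seteqP; split => t //=; rewrite eqxx.
split; rewrite ?E ?closure0//; last exact: compact0.
have d0 : forall n, derive1n n (0 : R -> R) = (0 : R -> R).
  elim=> [//|n IH]; rewrite /derive1n iterS -/(derive1n _ _) IH.
  by apply/funext => x; exact: derive1_cst.
by move=> n x; rewrite d0; exact: derivable_cst.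
Qed.

Lemma C0infty_support T w x : C0infty T w -> x \notin `]0, T[ -> w x = 0.
Proof.
move=> [_ _ wT] xT; apply/eqP; apply: contraNT xT => wx.
by apply: wT; exact: subset_closure.
Qed.

Lemma C0infty_derive1_support T w (x : R) :
  C0infty T w -> x \notin `]0, T[ -> w^`()%classic x = 0.
Proof.
move=> [_ _ wT] xT; rewrite derive1E.
have xs : (~` closure [set t | w t != 0]) x.
  by move=> /wT; apply/negP.
rewrite -[RHS](derive_cst (0 : R) x 1); apply: near_eq_derive.
have : nbhs x (~` closure [set t | w t != 0]).
  by apply: open_nbhs_nbhs; split => //; apply: closed_openC; exact: closed_closure.
apply: filterS => y yw; apply/eqP/negPn/negP => wy; apply: yw.
exact: subset_closure.
Qed.

Lemma C0infty_continuous T w : C0infty T w -> continuous w.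
Proof. by move=> [sw _ _]; apply: derivable_continuous; exact: smooth_derivable. Qed.

Lemma C0infty_derive1_continuous T w : C0infty T w -> continuous w^`()%classic.
Proof.
move=> [sw _ _]; apply: derivable_continuous.
exact/smooth_derivable/smooth_derive1.
Qed.

Lemma continuous_support_bounded T (g : R -> R) : 0 <= T -> continuous g ->
  (forall x, x \notin `]0, T[ -> g x = 0) ->
  exists2 M, 0 <= M & forall x, `|g x| <= M.
Proof.
move=> T0 cg gT.
have cng : {within `[0, T], continuous (fun x => `|g x|)}.
  by apply: continuous_subspaceT => x; apply: cvg_norm; exact: cg.
have [c _ cM] := EVT_max T0 cng.
exists `|g c| => // x; have [xT|/gT ->] := boolP (x \in `]0, T[).
  by apply: cM; exact: subset_itv_oo_cc.
by rewrite normr0.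
Qed.

End test_functions.

Section riemann_liouville.
Context {R : realType}.
Local Notation mu := (@lebesgue_measure R).
Variables (alpha T : R).
Hypothesis alpha01 : 0 < alpha < 1.
Hypothesis T0 : 0 < T.

Let Na1 : -1 < - alpha. Proof. by case/andP: alpha01 => _ ?; rewrite ltrN2. Qed.
Let Na0 : - alpha != 0.
Proof. by case/andP: alpha01 => ? _; rewrite oppr_eq0 gt_eqF. Qed.

(* Integral of order [1 - alpha], up to the factor [Gamma (1 - alpha)]. *)
Definition rlint (g : R -> R) (t : R) : R :=
  \int[mu]_(s in `[0, t]) ((t - s) `^ (- alpha) * g s).

(* The same, the singularity being fixed: one may differentiate it in [t]. *)
Let H (g : R -> R) (t : R) : R :=
  \int[mu]_(s in `[0, T + 1]) (kern (- alpha) s * g (t - s)).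

(* continuous functions supported in [[0, T]] *)
Let adm (g : R -> R) := continuous g /\ forall x : R, x \notin `]0, T[ -> g x = 0.

Let adm0 g x : adm g -> x <= 0 -> g x = 0.
Proof. by move=> [_ gT] x0; apply: gT; rewrite in_itv/= ltNge x0. Qed.

Let admM g : adm g -> exists2 M, 0 <= M & forall x, `|g x| <= M.
Proof. by move=> [cg gT]; exact: (continuous_support_bounded (ltW T0)). Qed.

Let adm_meas g : adm g -> measurable_fun setT g.
Proof. by move=> [cg _]; exact: continuous_measurable_fun. Qed.

Lemma integrable_kern (b u v : R) : -1 < b ->
  mu.-integrable `[u, v] (fun s => (kern b (v - s))%:E).
Proof.
move=> b1; have [vu|uv] := ltP v u.
  by rewrite set_itv_ge ?bnd_simp -?ltNge//; exact: integrable_set0.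
apply/integrableP; split.
  apply/measurable_EFinP/measurable_funTS; apply: measurableT_comp.
    exact: measurable_kern.
  exact: measurable_funB.
under eq_integral do rewrite gee0_abs ?lee_fin ?kern_ge0//.
by rewrite integral_kern_reflection// ltry.
Qed.

Lemma integrable_kern0 (b u : R) : -1 < b ->
  mu.-integrable `[0, u] (fun s => (kern b s)%:E).
Proof.
move=> b1; have [vu|uv] := ltP u 0.
  by rewrite set_itv_ge ?bnd_simp -?ltNge//; exact: integrable_set0.
apply/integrableP; split.
  by apply/measurable_EFinP/measurable_funTS; exact: measurable_kern.
under eq_integral do rewrite gee0_abs ?lee_fin ?kern_ge0//.
by rewrite integral_kern// ltry.
Qed.

(* a kernel times a bounded measurable function *)
Lemma integrable_scale (D : set (measurableTypeR R)) (k : R -> R) (M : R) :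
  measurable D -> mu.-integrable D (EFin \o k) ->
  mu.-integrable D (fun x => (M * k x)%:E).
Proof. by move=> mD ik; exact: integrableZl mD M _ ik. Qed.

Lemma integrable_bounded_mul (D : set (measurableTypeR R)) (k g : R -> R) (M : R) : measurable D ->
  mu.-integrable D (EFin \o k) -> measurable_fun D g ->
  (forall x, D x -> `|g x| <= M) -> mu.-integrable D (fun x => (k x * g x)%:E).
Proof.
move=> mD ik mg gM; have mk : measurable_fun D k.
  by apply/measurable_EFinP; exact: measurable_int ik.
have iMk := integrable_scale M mD ik.
apply: (le_integrable mD _ _ iMk).
  by apply/measurable_EFinP/measurable_funM.
move=> x Dx /=; rewrite lee_fin !normrM mulrC ler_wpM2r//.
by rewrite (le_trans (gM x Dx))// ler_norm.
Qed.

Let conv_integrable g t : adm g ->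
  mu.-integrable setT (fun s => (kern (- alpha) (t - s) * g s)%:E).
Proof.
move=> ag; have [M M0 gM] := admM ag.
rewrite (_ : (fun s => _) = (fun s => (kern (- alpha) (t - s) * g s)%:E) \_ `[0, t]).
  apply: (iffLR (integrable_mkcond _ _)); first exact: measurable_itv.
  apply: (@integrable_bounded_mul _ (fun s => kern (- alpha) (t - s)) g M) => //.
  - exact: integrable_kern.
  - by apply: measurable_funTS; exact: adm_meas.
apply/funext => s; rewrite patchE; case: ifPn => //.
rewrite notin_setE/= in_itv/= => /negP; rewrite negb_and -!ltNge => /orP[s0|ts].
  by rewrite (adm0 ag) ?mulr0// ltW.
by rewrite kern_le0 ?mul0r// subr_le0 ltW.
Qed.

Let rlintE g t : adm g ->
  (rlint g t)%:E = (\int[mu]_s (kern (- alpha) (t - s) * g s)%:E)%E.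
Proof.
move=> ag; rewrite -[RHS]fineK; last exact: integrable_fin_num (conv_integrable t ag).
congr EFin; rewrite /rlint Rintegral_mkcond; congr fine.
apply: eq_integral => s _; rewrite patchE; congr EFin; case: ifPn.
  rewrite inE/= in_itv/= => /andP[s0 st].
  by rewrite kern_ge0E// subr_ge0.
rewrite notin_setE/= in_itv/= => /negP; rewrite negb_and -!ltNge => /orP[s0|ts].
  by rewrite (adm0 ag) ?mulr0// ltW.
by rewrite kern_le0 ?mul0r// subr_le0 ltW.
Qed.

Let rlintH g t : adm g -> t <= T + 1 -> rlint g t = H g t.
Proof.
move=> ag tT; apply: EFin_inj; rewrite rlintE// (integral_reflection t); last first.
  exact: measurable_int (conv_integrable t ag).
rewrite /H Rintegral_mkcond.
have -> : (\int[mu]_x (kern (- alpha) (t - (t - x)) * g (t - x)%R)%:E =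
    \int[mu]_x (((fun s => kern (- alpha) s * g (t - s)) \_ `[0%R, (T + 1)%R]) x)%:E)%E.
  apply: eq_integral => s _; rewrite subKr patchE; congr EFin; case: ifPn => //.
  rewrite notin_setE/= in_itv/= => /negP; rewrite negb_and -!ltNge => /orP[s0|ts].
    by rewrite kern_le0 ?mul0r// ltW.
  by rewrite (adm0 ag) ?mulr0// subr_le0 (le_trans tT)// ltW.
rewrite fineK//; apply: integrable_fin_num => //.
have := integrable_reflection t (conv_integrable t ag).
apply: eq_integrable => // s _; rewrite subKr patchE; congr EFin; case: ifPn => //.
rewrite notin_setE/= in_itv/= => /negP; rewrite negb_and -!ltNge => /orP[s0|ts].
  by rewrite kern_le0 ?mul0r// ltW.
by rewrite (adm0 ag) ?mulr0// subr_le0 (le_trans tT)// ltW.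
Qed.

Let H_integrable g t : adm g ->
  mu.-integrable `[0, T + 1] (fun s => (kern (- alpha) s * g (t - s))%:E).
Proof.
move=> ag; have [M M0 gM] := admM ag.
apply: (@integrable_bounded_mul _ _ _ M) => //.
  exact: integrable_kern0.
apply/measurable_funTS/measurableT_comp; first exact: adm_meas.
exact: measurable_funB.
Qed.

Let H_continuous g t : adm g -> -1 < t < T + 1 -> {for t, continuous (H g)}.
Proof.
move=> ag tT; have [M M0 gM] := admM ag.
have mI : measurable (`[0, T + 1]%classic : set (measurableTypeR R)).
  exact: measurable_itv.
have iMk := integrable_scale M mI (integrable_kern0 (T + 1) Na1).
apply: (@continuity_under_integral _ _ _ mu
  (fun t s => kern (- alpha) s * g (t - s)) _ _ (-1) (T + 1) _ _
  (fun s => M * kern (- alpha) s)) => //.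
- by move=> x _; exact: H_integrable.
- apply/nearW => s _ x _; apply: cvgMr; apply: continuous_comp; last by case: ag => cg _; exact: cg.
  by apply: cvgB; [exact: cvg_id|exact: cvg_cst].
- move=> x _; apply/nearW => s _; rewrite normrM mulrC (ger0_norm (kern_ge0 _ _)).
  by rewrite ler_wpM2r// kern_ge0.
- by rewrite inE /= in_itv.
Qed.

Let adm_C0infty w : C0infty T w -> adm w.
Proof.
move=> Cw; split; first exact: C0infty_continuous Cw.
by move=> x; exact: C0infty_support.
Qed.

Let adm_derive w : C0infty T w -> adm w^`()%classic.
Proof.
move=> Cw; split; first exact: C0infty_derive1_continuous Cw.
by move=> x; exact: C0infty_derive1_support.
Qed.

Let H_derive w t : C0infty T w -> -1 < t < T + 1 ->
  is_derive t 1 (H w) (H w^`()%classic t).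
Proof.
move=> Cw tT; have [M M0 gM] := admM (adm_derive Cw).
have mI : measurable (`[0, T + 1]%classic : set (measurableTypeR R)).
  exact: measurable_itv.
have iMk := integrable_scale M mI (integrable_kern0 (T + 1) Na1).
pose F (t s : R) := kern (- alpha) s * w (t - s).
have dF (x s : R) : is_derive x 1 (F ^~ s) (kern (- alpha) s * w^`()%classic (x - s)).
  have [sw _ _] := Cw.
  have dw : is_derive (x - s) 1 w (w^`()%classic (x - s)).
    by rewrite derive1E; apply: DeriveDef => //; exact: smooth_derivable.
  have -> : F ^~ s = kern (- alpha) s *: (w \o (fun x => x - s)) by [].
  have dc : is_derive x 1 (w \o (fun x => x - s)) (w^`()%classic (x - s)).
    have sh : is_derive x 1 (fun x : R => x - s) 1 := is_derive_shift x 1 (- s).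
    by rewrite -[w^`()%classic _]mulr1; exact: is_derive1_comp.
  exact: is_deriveZ.
have d1 (x s : R) : partial1of2 F x s = kern (- alpha) s * w^`()%classic (x - s).
  by rewrite /partial1of2 derive1E; have [_ ->] := dF x s.
have It : `]-1, T + 1[%classic t by rewrite /= in_itv.
have aw := adm_C0infty Cw.
have iF (x : R) : `]-1, T + 1[%classic x -> mu.-integrable `[0, T + 1] (EFin \o F x).
  by move=> _; exact: H_integrable.
have dF' (x s : R) : `]-1, T + 1[%classic x -> `[0, T + 1]%classic s ->
    derivable (F ^~ s) x 1 by move=> _ _; have [] := dF x s.
have G0 (s : measurableTypeR R) : 0 <= M * kern (- alpha) s by rewrite mulr_ge0// kern_ge0.
have Gub (x s : R) : `]-1, T + 1[%classic x -> `[0, T + 1]%classic s ->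
    `|partial1of2 F x s| <= M * kern (- alpha) s.
  move=> _ _; rewrite d1 normrM mulrC (ger0_norm (kern_ge0 _ _)).
  by rewrite ler_wpM2r// kern_ge0.
apply: DeriveDef.
  exact: (derivable_under_integral mI It iF dF' G0 iMk Gub).
rewrite -derive1E.
rewrite (differentiation_under_integral mI It iF dF' G0 iMk Gub).
by apply: eq_Rintegral => s _; rewrite d1.
Qed.


Local Notation D := (left_RL_derivative alpha).
Local Notation Ga := (Gamma (1 - alpha)).

Let near_itv t : -1 < t < T + 1 -> \forall x \near t, -1 < x < T + 1.
Proof.
move=> tT; have : t \in `]-1, T + 1[ by rewrite in_itv.
by move/near_in_itvoo; apply: filterS => x; rewrite in_itv.
Qed.

Let Ga_rlint w t : C0infty T w -> -1 < t < T + 1 ->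
  is_derive t 1 (fun t => Ga^-1 * rlint w t) (Ga^-1 * H w^`()%classic t).
Proof.
move=> Cw tT; have aw := adm_C0infty Cw.
apply: (@near_eq_is_derive _ _ _ (fun t => Ga^-1 * H w t)).
  near=> x; rewrite rlintH//.
  have /andP[_ /ltW//] : -1 < x < T + 1 by near: x; exact: near_itv.
have := H_derive Cw tT => dH.
exact: (@is_deriveZ _ _ _ (H w) Ga^-1).
Unshelve. all: by end_near. Qed.

Let DE w t : C0infty T w -> -1 < t < T + 1 -> D w t = Ga^-1 * H w^`()%classic t.
Proof.
move=> Cw tT; rewrite /left_RL_derivative derive1E.
by have [_ ->] := Ga_rlint Cw tT.
Qed.

Let itvT t : 0 <= t <= T -> -1 < t < T + 1.
Proof. by move=> /andP[t0 tT]; apply/andP; split; lra. Qed.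

Lemma RLd_continuous w t : C0infty T w -> 0 <= t <= T -> {for t, continuous (D w)}.
Proof.
move=> Cw /itvT tT.
have cH : {for t, continuous (fun x => Ga^-1 * H w^`()%classic x)}.
  by apply: cvgMr; exact: (H_continuous (adm_derive Cw) tT).
have /near_eq_cvg : {near t, (fun x => Ga^-1 * H w^`()%classic x) =1 D w}.
  by have := near_itv tT; apply: filterS => x xT; rewrite DE.
by move/cvg_trans => Dt; apply: Dt; rewrite DE.
Qed.

Let rlint_lin (a : R) g h t : adm g -> adm h -> adm (g + a *: h) ->
  rlint (g + a *: h) t = rlint g t + a * rlint h t.
Proof.
move=> ag ah agh; apply: EFin_inj; rewrite EFinD EFinM !rlintE//.
have ig := conv_integrable t ag; have ih := conv_integrable t ah.
rewrite -integralZl// -integralD//; last exact: integrableZl.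
apply: eq_integral => s _; rewrite -EFinM -EFinD; congr EFin.
by rewrite !fctE /GRing.scale/=; ring.
Qed.

Lemma RLd_lin (a : R) u v t : C0infty T u -> C0infty T v -> 0 <= t <= T ->
  D (u + a *: v) t = D u t + a * D v t.
Proof.
move=> Cu Cv /itvT tT; have Cuv := C0infty_lin a Cu Cv.
have [su _ _] := Cu; have [sv _ _] := Cv.
have E : (u + a *: v)^`()%classic = u^`()%classic + a *: v^`()%classic.
  exact: (derive1n_lin a su sv 1%N).
have tT1 : t <= T + 1 by case/andP: tT => _ /ltW.
have Aw := adm_derive Cuv; have Au := adm_derive Cu; have Av := adm_derive Cv.
rewrite !DE// -!rlintH// E rlint_lin -?E//.
by ring.
Qed.

Lemma RLd0 t : 0 <= t <= T -> D 0 t = 0.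
Proof.
move=> tT; have C0 := C0infty0 (R := R) T.
have := RLd_lin 1 C0 C0 tT; rewrite scaler0 addr0 mul1r => /eqP.
by rewrite -[X in X == _]addr0 (inj_eq (addrI _)) eq_sym => /eqP.
Qed.

Lemma RLd_bounded w : C0infty T w ->
  exists2 M, 0 <= M & forall t, 0 <= t <= T -> `|D w t| <= M.
Proof.
move=> Cw; have cD : {within `[0, T], continuous (fun x => `|D w x|)}.
  apply: continuous_in_subspaceT => x; rewrite inE/= in_itv/= => xT.
  by apply: cvg_norm; exact: RLd_continuous.
have [c _ cM] := EVT_max (ltW T0) cD.
by exists `|D w c| => // t tT; apply: cM; rewrite in_itv.
Qed.

Lemma RLd_measurable w : C0infty T w -> measurable_fun `[0, T] (D w).
Proof.
move=> Cw; apply: subspace_continuous_measurable_fun => //.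
apply: continuous_in_subspaceT => x; rewrite inE/= in_itv/= => xT.
exact: RLd_continuous.
Qed.

Lemma integral_RLd w t : C0infty T w -> 0 <= t <= T ->
  \int[mu]_(s in `[0, t]) D w s = Ga^-1 * rlint w t.
Proof.
move=> Cw /andP[t0 tT].
have sub x : 0 <= x <= t -> 0 <= x <= T.
  by move=> /andP[-> xt]; exact: le_trans tT.
rewrite /Rintegral (@integral_derive _ (D w) (fun t => Ga^-1 * rlint w t))//=.
- rewrite [rlint w 0]/rlint set_itv1 Rintegral_set1 mulr0 subr0//.
- by move=> x /sub /itvT xT; have [] := Ga_rlint Cw xT.
- by move=> x /sub xT; apply: RLd_continuous.
Qed.

(* Fubini's theorem for the composition of the two fractional integrals, one of
   them being applied to the derivative [g] *)
Let conv_composition g c t : adm g -> 0 < c -> 0 <= t ->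
  (\int[mu]_s (kern (alpha - 1) (1 - s)%R * kern (- alpha) s)%:E = c%:E)%E ->
  (\int[mu]_s (kern (alpha - 1) (t - s) * rlint g s)%:E =
   \int[mu]_(x in `[0%R, t]) (c * g x)%:E)%E.
Proof.
move=> ag c0 t0 cE; have [M M0 gM] := admM ag.
have mk b : measurable_fun setT (kern b : R -> R) by exact: measurable_kern.
pose F (z : measurableTypeR R * measurableTypeR R) : \bar R :=
  (kern (alpha - 1) (t - z.1) * kern (- alpha) (z.1 - z.2) * g z.2)%:E.
have mF : measurable_fun setT F.
  apply/measurable_EFinP/measurable_funM; last first.
    by apply: measurableT_comp => //; exact: adm_meas.
  apply: measurable_funM.
    by apply: measurableT_comp => //; exact: measurable_funB.
  by apply: measurableT_comp => //; exact: measurable_funB.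
have mkk x : measurable_fun setT
    (fun s : R => (kern (alpha - 1) (t - s) * kern (- alpha) (s - x))%:E).
  apply/measurable_EFinP/measurable_funM; apply: measurableT_comp => //.
    exact: measurable_funB.
  exact: measurable_funB.
have kk0 (x s : R) : (0 <= (kern (alpha - 1) (t - s) * kern (- alpha) (s - x))%:E)%E.
  by rewrite lee_fin mulr_ge0 ?kern_ge0.
have kkE x := kern_composition cE x t.
have ikk x : mu.-integrable setT
    (fun s : R => (kern (alpha - 1) (t - s) * kern (- alpha) (s - x))%:E).
  apply/integrableP; split; first exact: mkk.
  by under eq_integral do rewrite gee0_abs//; rewrite kkE ltry.
have iF : (mu \x mu)%E.-integrable setT F.
  apply/integrable21ltyP => //.
  apply: (@le_lt_trans _ _ (\int[mu]_(x in `[0%R, t]) (c * M)%:E)%E).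
    rewrite [leRHS]integral_mkcond; apply: ge0_le_integral => //.
    - by move=> x _; exact: integral_ge0.
    - apply: (measurable_fun_fubini_tonelli_G (abse \o F)) => //.
      exact: measurableT_comp.
      by move=> z; exact: abse_ge0.
    - by apply: (iffLR (measurable_restrictT _ _)) => //; exact: measurable_itv.
    - move=> x _.
      have -> : (\int[mu]_s `|F (s, x)| = (if x < t then c else 0)%:E * `|g x|%:E)%E.
        rewrite -kkE -ge0_integralZr//; last exact: mkk.
        apply: eq_integral => s _.
        by rewrite /F/= normrM EFinM ger0_norm// mulr_ge0 ?kern_ge0.
      rewrite patchE.
      case: ifPn => [xt|]; case: ifPn => //.
      + by rewrite -EFinM lee_fin ler_wpM2l// ltW.
      + rewrite notin_setE/= in_itv/= (ltW xt) andbT => /negP; rewrite -ltNge => x0.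
        by rewrite (adm0 ag) ?normr0 ?mule0// ltW.
      + by rewrite mul0e lee_fin mulr_ge0// ltW.
      + by rewrite mul0e.
  rewrite integral_cst//= lebesgue_measure_itv/=; case: ifPn => _.
    by rewrite -EFinD -EFinM ltry.
  by rewrite mule0.
have := Fubini iF; rewrite /F/=.
have -> : (\int[mu]_x \int[mu]_y
    (kern (alpha - 1) (t - x) * kern (- alpha) (x - y) * g y)%:E =
    \int[mu]_s (kern (alpha - 1) (t - s) * rlint g s)%:E)%E.
  apply: eq_integral => s _; rewrite EFinM rlintE// -integralZl//; last first.
    exact: conv_integrable.
  by apply: eq_integral => x _; rewrite -EFinM mulrA.
move=> ->; rewrite -integral_itv_bndo_bndc; last first.
  by apply/measurable_EFinP/measurable_funTS/measurable_funM => //; exact: adm_meas.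
rewrite [RHS]integral_mkcond; apply: eq_integral => x _.
under eq_integral do rewrite EFinM.
rewrite integralZr// kkE -EFinM patchE.
case: ifPn => [xt|]; case: ifPn => //.
- rewrite notin_setE/= in_itv/= xt andbT => /negP; rewrite -ltNge => x0.
  by rewrite (adm0 ag) ?mulr0// ltW.
- by rewrite inE/= in_itv/= => /andP[_ ->].
- by rewrite mul0r.
Qed.

(** A test function is the fractional integral of its fractional derivative. *)
Lemma RLd_inversion : exists2 k : R, 0 < k & forall w t, C0infty T w ->
  0 <= t <= T ->
  w t = k * \int[mu]_(s in `[0, t]) (kern (alpha - 1) (t - s) * D w s).
Proof.
have [c c0 cE] := beta_kern alpha01.
have Ga0 : 0 < Ga by exact: Gamma_gt0.
exists (Ga / c) => [|w t Cw /andP[t0 tT]]; first by rewrite divr_gt0.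
have Aw := adm_derive Cw; have [sw _ _] := Cw.
have := conv_composition Aw c0 t0 cE.
have dw x : derivable w x 1 by exact: smooth_derivable.
rewrite [RHS](@integral_derive _ _ (fun x => c * w x))//; last first.
- by move=> x _; apply: cvgMr; case: Aw => cw _; exact: cw.
- by move=> x _; rewrite derive1Ml.
- by move=> x _; exact: (@derivableZ _ _ _ w c).
rewrite (C0infty_support Cw (x := 0)) ?in_itv/= ?ltxx// mulr0 subr0.
have -> : (\int[mu]_s (kern (alpha - 1) (t - s) * rlint w^`()%classic s)%:E =
    \int[mu]_(s in `[0%R, t]) (Ga * (kern (alpha - 1) (t - s) * D w s)%R)%:E)%E.
  rewrite [RHS]integral_mkcond; apply: eq_integral => s _; rewrite patchE.
  case: ifPn.
    rewrite inE/= in_itv/= => /andP[s0 st].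
    have sT : -1 < s < T + 1 by apply: itvT; rewrite s0 (le_trans st).
    rewrite DE// -rlintH//; last by case/andP: sT => _ /ltW.
    by congr EFin; field; rewrite gt_eqF.
  rewrite notin_setE/= in_itv/= => /negP; rewrite negb_and -!ltNge => /orP[s0|ts].
    rewrite rlintH//; last by rewrite (le_trans (ltW s0))// addr_ge0// ltW.
    rewrite /H (@eq_Rintegral _ _ _ mu _ (fun=> 0)); last first.
      move=> x; rewrite inE/= in_itv/= => /andP[x0 _].
      by rewrite (adm0 Aw) ?mulr0// subr_le0 (le_trans (ltW s0)).
    by rewrite Rintegral_cst ?mul0r ?mulr0//; exact: measurable_itv.
  by rewrite kern_le0 ?mul0r// subr_le0 ltW.
have [M M0 DM] := RLd_bounded Cw.
have iK : mu.-integrable `[0, t] (fun s => (kern (alpha - 1) (t - s) * D w s)%:E).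
  apply: (@integrable_bounded_mul _ (fun s => kern (alpha - 1) (t - s)) _ M) => //.
  - by apply: integrable_kern; case/andP: alpha01 => ? _; lra.
  - apply: measurable_funS (RLd_measurable Cw) => //.
    by apply: subset_itvl; rewrite bnd_simp.
  - move=> s; rewrite /= in_itv/= => /andP[s0 st].
    by apply: DM; rewrite s0 (le_trans st).
move=> E; apply: (@mulfI _ c); first by rewrite gt_eqF.
rewrite mulrA mulrCA divff ?gt_eqF// mulr1 -RintegralZl//.
by rewrite /Rintegral E.
Qed.

End riemann_liouville.

Section bounded_measurable.
Context {R : realType}.
Local Notation mu := (@lebesgue_measure R).
Variable T : R.

Let mT : measurable (`[0, T]%classic : set (measurableTypeR R)).
Proof. exact: measurable_itv. Qed.

Definition integrable_itv (g : R -> R) : Prop := mu.-integrable `[0, T] (EFin \o g).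

Definition bounded_mfun (g : R -> R) : Prop :=
  measurable_fun `[0, T] g /\ exists M : R, forall t, 0 <= t <= T -> `|g t| <= M.

Lemma bounded_mfun_integrable g : bounded_mfun g -> integrable_itv g.
Proof.
move=> [mg [M gM]]; apply: measurable_bounded_integrable => //.
- rewrite /= lebesgue_measure_itv/=; case: ifPn => // _.
  by rewrite -EFinD ltry.
- exists M; split; first exact: num_real.
  move=> x Mx t /=; rewrite in_itv/= => tT.
  by rewrite (le_trans (gM t tT))// ltW.
Qed.

Lemma bounded_mfun_cst c : bounded_mfun (fun=> c).
Proof. by split; [exact: measurable_cst|exists `|c|]. Qed.

Lemma bounded_mfunD g h : bounded_mfun g -> bounded_mfun h ->
  bounded_mfun (fun t => g t + h t).
Proof.
move=> [mg [M gM]] [mh [K hK]]; split; first exact: measurable_funD.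
exists (M + K) => t tT; rewrite (le_trans (ler_normD _ _))//.
by rewrite lerD ?gM ?hK.
Qed.

Lemma bounded_mfunM g h : bounded_mfun g -> bounded_mfun h ->
  bounded_mfun (fun t => g t * h t).
Proof.
move=> [mg [M gM]] [mh [K hK]]; split; first exact: measurable_funM.
exists (M * K) => t tT; rewrite normrM.
by rewrite ler_pM ?gM ?hK.
Qed.

Lemma bounded_mfunB g h : bounded_mfun g -> bounded_mfun h ->
  bounded_mfun (fun t => g t - h t).
Proof.
move=> [mg [M gM]] [mh [K hK]]; split; first exact: measurable_funB.
exists (M + K) => t tT; rewrite (le_trans (ler_normB _ _))//.
by rewrite lerD ?gM ?hK.
Qed.

Lemma bounded_mfun_norm g : bounded_mfun g -> bounded_mfun (fun t => `|g t|).
Proof.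
move=> [mg [M gM]]; split; first exact: measurableT_comp.
by exists M => t tT; rewrite normr_id gM.
Qed.

Lemma measurable_norm_powR (D : set R) (g : R -> R) (r : R) : measurable_fun D g ->
  measurable_fun D (fun t => `|g t| `^ r).
Proof.
move=> mg; apply: (measurableT_comp (measurable_powR r)).
exact: measurableT_comp.
Qed.

Lemma bounded_mfun_powR (g : R -> R) (r : R) : 0 <= r -> bounded_mfun g ->
  bounded_mfun (fun t => `|g t| `^ r).
Proof.
move=> r0 [mg [M gM]]; split; first exact: measurable_norm_powR.
exists (M `^ r) => t tT; rewrite ger0_norm ?powR_ge0//.
have gtM := gM t tT; rewrite ge0_ler_powR ?nnegrE//.
exact: le_trans gtM.
Qed.

Lemma measurable_dualmap (D : set R) (g : R -> R) (p : R) : measurable_fun D g ->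
  measurable_fun D (fun t => dualmap p (g t)).
Proof. by move=> mg; apply: measurable_funM => //; exact: measurable_norm_powR. Qed.

Lemma bounded_mfun_dualmap (g : R -> R) (p : R) : 1 < p -> bounded_mfun g ->
  bounded_mfun (fun t => dualmap p (g t)).
Proof.
move=> p1 bg; have [|_ [M gM]] := @bounded_mfun_powR g (p - 1) _ bg.
  by rewrite subr_ge0 ltW.
split; first by apply: measurable_dualmap; case: bg.
by exists M => t tT; rewrite normr_dualmap// -[leLHS]ger0_norm ?powR_ge0// gM.
Qed.

Lemma integrable_itvD (g h : R -> R) : integrable_itv g -> integrable_itv h ->
  integrable_itv (fun t => g t + h t).
Proof. by move=> ig ih; exact: (integrableD mT ig ih). Qed.

Lemma integrable_itvZ (a : R) (g : R -> R) : integrable_itv g ->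
  integrable_itv (fun t => a * g t).
Proof. by move=> ig; exact: (integrableZl mT a ig). Qed.

Lemma integrable_itvN (g : R -> R) : integrable_itv g -> integrable_itv (fun t => - g t).
Proof. by move=> ig; exact: (integrableN ig). Qed.

Lemma integrable_itvB (g h : R -> R) : integrable_itv g -> integrable_itv h ->
  integrable_itv (fun t => g t - h t).
Proof. by move=> ig ih; apply: integrable_itvD => //; exact: integrable_itvN. Qed.

Lemma integrable_itv_le (g h : R -> R) : measurable_fun `[0, T] g ->
  (forall t, 0 <= t <= T -> `|g t| <= h t) -> integrable_itv h -> integrable_itv g.
Proof.
move=> mg gh ih; apply: (le_integrable mT _ _ ih).
  exact/measurable_EFinP.
move=> t /=; rewrite in_itv/= => /gh ght; rewrite lee_fin.
exact: le_trans (ler_norm _).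
Qed.

Lemma integral_itv_le (g h : R -> R) : integrable_itv g -> integrable_itv h ->
  (forall t, 0 <= t <= T -> g t <= h t) ->
  \int[mu]_(t in `[0, T]) g t <= \int[mu]_(t in `[0, T]) h t.
Proof.
by move=> ig ih gh; exact: le_Rintegral.
Qed.

Lemma integral_itvD (g h : R -> R) : integrable_itv g -> integrable_itv h ->
  \int[mu]_(t in `[0, T]) (g t + h t) =
  \int[mu]_(t in `[0, T]) g t + \int[mu]_(t in `[0, T]) h t.
Proof. by move=> ig ih; exact: (RintegralD mT). Qed.

Lemma integral_itvB (g h : R -> R) : integrable_itv g -> integrable_itv h ->
  \int[mu]_(t in `[0, T]) (g t - h t) =
  \int[mu]_(t in `[0, T]) g t - \int[mu]_(t in `[0, T]) h t.
Proof. by move=> ig ih; exact: (RintegralB mT). Qed.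

Lemma integral_itvZ (a : R) (g : R -> R) : integrable_itv g ->
  \int[mu]_(t in `[0, T]) (a * g t) = a * \int[mu]_(t in `[0, T]) g t.
Proof. by move=> ig; exact: RintegralZl. Qed.

Lemma integral_itv_norm (g : R -> R) : integrable_itv g ->
  `|\int[mu]_(t in `[0, T]) g t| <= \int[mu]_(t in `[0, T]) `|g t|.
Proof. by move=> ig; exact: (le_normr_Rintegral mT). Qed.

Lemma integrable_itv_norm (g : R -> R) : integrable_itv g -> integrable_itv (fun t => `|g t|).
Proof. by move=> ig; exact: (integrable_norm ig). Qed.

Lemma integral_itv_ge0 (g : R -> R) : (forall t, 0 <= t <= T -> 0 <= g t) ->
  0 <= \int[mu]_(t in `[0, T]) g t.
Proof. by move=> g0; apply: Rintegral_ge0 => t /=; rewrite in_itv; exact: g0. Qed.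

Lemma integral_itv_cst (c : R) : 0 <= T -> \int[mu]_(t in `[0, T]) c = c * T.
Proof.
move=> T0; rewrite Rintegral_cst; last exact: mT.
congr (_ * _).
rewrite /= lebesgue_measure_itv/= lte_fin; case: ifPn; first by rewrite oppr0 adde0.
by rewrite -leNgt => T0'; apply/eqP; rewrite eq_le T0 T0'.
Qed.

Lemma integrable_itv_fin (g : R -> R) : integrable_itv g ->
  (\int[mu]_(t in `[0%R, T]) (g t)%:E = (\int[mu]_(t in `[0, T]) g t)%:E)%E.
Proof.
by move=> ig; rewrite fineK//; exact: (integrable_fin_num mT ig).
Qed.

Lemma integral_itv_eq (g h : R -> R) : (forall t, 0 <= t <= T -> g t = h t) ->
  \int[mu]_(t in `[0, T]) g t = \int[mu]_(t in `[0, T]) h t.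
Proof. by move=> gh; apply: eq_Rintegral => t; rewrite inE/= in_itv; exact: gh. Qed.

End bounded_measurable.

(** Locked, to keep unification from comparing integrands. *)
HB.lock Definition energy {R : realType} (alpha T p : R) (w : R -> R) : R :=
  \int[@lebesgue_measure R]_(t in `[0, T]) `|left_RL_derivative alpha w t| `^ p.

Section embedding.
Context {R : realType}.
Local Notation mu := (@lebesgue_measure R).
Variables (alpha T p : R).
Hypothesis p1 : 1 < p.
Hypothesis ap : p^-1 < alpha.
Hypothesis a1 : alpha < 1.
Hypothesis T0 : 0 < T.

Local Notation D := (left_RL_derivative alpha).
Local Notation C0 := (C0infty T).

Let p0 : 0 < p. Proof. exact: lt_trans p1. Qed.
Let pm1 : 0 < p - 1. Proof. by rewrite subr_gt0. Qed.

Let alpha01 : 0 < alpha < 1.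
Proof. by rewrite a1 andbT (lt_trans _ ap)// invr_gt0. Qed.

(* exponent of the kernel of order [alpha] to the power [p / (p - 1)] *)
Let beta := (alpha - 1) * (p / (p - 1)).

Let beta1 : -1 < beta.
Proof.
rewrite /beta mulrA ltr_pdivlMr// mulN1r opprB.
have : 1 < alpha * p by rewrite -ltr_pdivrMr// div1r.
by rewrite mulrBl mul1r; lra.
Qed.

Let beta10 : 0 < beta + 1. Proof. by rewrite -ltrBlDr sub0r. Qed.

Lemma RLd_bounded_mfun w : C0 w -> bounded_mfun T (D w).
Proof.
move=> Cw; split; first exact: RLd_measurable.
by have [M _ DM] := RLd_bounded alpha01 T0 Cw; exists M.
Qed.

Lemma C0infty_bounded_mfun w : C0 w -> bounded_mfun T w.
Proof.
move=> Cw; split.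
  apply: measurable_funTS; apply: continuous_measurable_fun.
  exact: C0infty_continuous Cw.
have [M _ wM] := continuous_support_bounded (ltW T0) (C0infty_continuous Cw)
  (fun x => C0infty_support Cw).
by exists M.
Qed.

(* functions vanishing on [s > t] *)
Lemma patch_itv t (f : R -> R) : t <= T -> (forall s, t < s -> f s = 0) ->
  f \_ `[0, T] = f \_ `[0, t].
Proof.
move=> tT ft; apply/funext => s; rewrite !patchE.
case: ifPn => [|sT]; case: ifPn => // st.
  rewrite inE/= in_itv/= => /andP[s0 _]; apply: ft; rewrite ltNge.
  move: st; rewrite notin_setE/= in_itv/= s0 => /negP.
  by [].
exfalso; move: sT st; rewrite notin_setE inE/= !in_itv/= => + /andP[s0 st].
by rewrite s0 (le_trans st).
Qed.

Let mT : measurable (`[0, T]%classic : set (measurableTypeR R)).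
Proof. exact: measurable_itv. Qed.

Lemma integral_kern_itv b t : -1 < b -> 0 <= t <= T ->
  integrable_itv T (fun s => kern b (t - s)) /\
  \int[mu]_(s in `[0, T]) kern b (t - s) = t `^ (b + 1) / (b + 1).
Proof.
move=> b1 /andP[t0 tT].
have kt s : t < s -> kern b (t - s) = 0.
  by move=> ts; rewrite kern_le0// subr_le0 ltW.
have E := patch_itv tT kt; split.
  apply: (iffRL (integrable_mkcond _ _)); first exact: measurable_itv.
  rewrite restrict_EFin E -restrict_EFin.
  apply: (iffLR (integrable_mkcond _ _)); first exact: measurable_itv.
  exact: integrable_kern.
rewrite Rintegral_mkcond E -Rintegral_mkcond /Rintegral.
by rewrite integral_kern_reflection//= subr0.
Qed.

Lemma RLd_inversion_itv : exists2 k : R, 0 < k & forall w t, C0 w -> 0 <= t <= T ->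
  w t = k * \int[mu]_(s in `[0, T]) (kern (alpha - 1) (t - s) * D w s).
Proof.
have [k k0 kE] := RLd_inversion alpha01 T0; exists k => // w t Cw tT.
rewrite (kE w t)//; congr (_ * _).
rewrite Rintegral_mkcond [RHS]Rintegral_mkcond (@patch_itv t)//.
  by case/andP: tT.
by move=> s ts; rewrite kern_le0 ?mul0r// subr_le0 ltW.
Qed.

Lemma powR_superadditive (r a b : R) : 1 <= r -> 0 <= b <= a ->
  (a - b) `^ r <= a `^ r - b `^ r.
Proof.
move=> r1 /andP[b0 ba]; have a0 := le_trans b0 ba.
have r0 : r != 0 by rewrite gt_eqF// (lt_le_trans ltr01).
have [a00|agt0] := eqVneq 0 a.
  have b00 : b = 0 by lra.
  by rewrite b00 -a00 subr0 powR0// subr0.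
have {}agt0 : 0 < a by rewrite lt_neqAle agt0.
have aux x : 0 <= x <= a -> x `^ r <= x / a * a `^ r.
  move=> /andP[]; rewrite le_eqVlt => /predU1P[<- _|x0 xa].
    by rewrite powR0// !mul0r.
  rewrite -[X in X `^ r](divfK (lt0r_neq0 agt0)) ge1r_powRZ//.
  by rewrite divr_gt0//= ler_pdivrMr// mul1r.
have h1 : b `^ r <= b / a * a `^ r by apply: aux; rewrite b0 ba.
have h2 : (a - b) `^ r <= (a - b) / a * a `^ r.
  by apply: aux; rewrite subr_ge0 ba gerBl.
have : (a - b) / a * a `^ r + b / a * a `^ r = a `^ r.
  by rewrite -mulrDl -mulrDl subrK divff ?mul1r// gt_eqF.
lra.
Qed.

(* Hoelder's inequality in the form: an integral against a kernel is small when the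
   integral of the conjugate power of the kernel is small. *)
Let weighted_bound (eps : R) : 0 < eps -> exists2 C, 0 < C & forall (k v : R),
  `|k * v| <= C * `|k| `^ (p / (p - 1)) + eps * `|v| `^ p.
Proof.
move=> e0; have [C C0' HC] := young_weightr p1 e0; exists C => // k v.
have := HC (`|k| `^ ((p - 1)^-1)) `|v| (powR_ge0 _ _) (normr_ge0 _).
rewrite -!powRrM mulVf ?gt_eqF// powRr1// normrM.
by rewrite (mulrC (_^-1)).
Qed.

Let kern_conj z : `|kern (alpha - 1) z| `^ (p / (p - 1)) = kern beta z.
Proof.
rewrite ger0_norm ?kern_ge0// /kern; case: ifP => z0; last first.
  by rewrite powR0// gt_eqF// divr_gt0.
by rewrite -powRrM.
Qed.

Lemma integrable_kern_RLd w t : C0 w -> 0 <= t <= T ->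
  integrable_itv T (fun s => kern (alpha - 1) (t - s) * D w s).
Proof.
move=> Cw tT; have [mD [M DM]] := RLd_bounded_mfun Cw.
have b1 : -1 < alpha - 1 by case/andP: alpha01 => ? _; lra.
have [ik _] := integral_kern_itv b1 tT.
exact: (@integrable_bounded_mul _ _ (fun s => kern (alpha - 1) (t - s)) _ M).
Qed.

Lemma integrable_energy w : C0 w -> integrable_itv T (fun t => `|D w t| `^ p).
Proof.
move=> Cw; apply: bounded_mfun_integrable; apply: bounded_mfun_powR.
  exact: ltW.
exact: RLd_bounded_mfun.
Qed.

Local Notation energy := (energy alpha T p).

Lemma energy_ge0 w : 0 <= energy w.
Proof. by rewrite energy.unlock; apply: integral_itv_ge0 => t _; exact: powR_ge0. Qed.

Lemma energyZ (a : R) w : C0 w -> energy (a *: w) = `|a| `^ p * energy w.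
Proof.
move=> Cw; rewrite !energy.unlock -integral_itvZ; last exact: integrable_energy.
apply: integral_itv_eq => t tT.
have := RLd_lin alpha01 T0 a (C0infty0 T) Cw tT.
by rewrite add0r (RLd0 alpha01 T0 tT) add0r => ->; rewrite normrM powRM.
Qed.

Lemma sup_le_energy_unit : exists2 c : R, 0 < c & forall w t, C0 w ->
  0 <= t <= T -> energy w <= 1 -> `|w t| <= c.
Proof.
have [k k0 kE] := RLd_inversion_itv; have [C C00 HC] := weighted_bound ltr01.
pose X := T `^ (beta + 1) / (beta + 1).
have X0 : 0 <= X by rewrite divr_ge0 ?powR_ge0// ltW.
exists (k * (C * X + 1)).
  by rewrite mulr_gt0// ltr_wpDl// mulr_ge0// ltW.
move=> w t Cw tT; rewrite energy.unlock => w1; rewrite (kE w t)// normrM gtr0_norm// ler_pM2l//.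
have iw := integrable_kern_RLd Cw tT.
have [ib Eb] := integral_kern_itv beta1 tT.
rewrite (le_trans (integral_itv_norm iw))//.
apply: (@le_trans _ _ (\int[mu]_(s in `[0, T])
    (C * kern beta (t - s) + 1 * `|D w s| `^ p))).
  apply: integral_itv_le.
  - exact: integrable_itv_norm.
  - apply: integrable_itvD; apply: integrable_itvZ => //.
    exact: integrable_energy.
  - by move=> s _; rewrite -kern_conj; exact: HC.
rewrite integral_itvD; last 2 first.
- exact: integrable_itvZ.
- by apply: integrable_itvZ; exact: integrable_energy.
rewrite !integral_itvZ//; last exact: integrable_energy.
rewrite Eb mul1r lerD// ler_wpM2l ?(ltW C00)// /X ler_pM2r ?invr_gt0//.
by case/andP: tT => t0 tT; rewrite ge0_ler_powR ?nnegrE// ltW.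
Qed.

(** The embedding of the energy space into bounded functions, by homogeneity. *)
Lemma sup_le_energy : exists2 c : R, 0 < c & forall w t, C0 w ->
  0 <= t <= T -> `|w t| <= c * energy w `^ p^-1.
Proof.
have [c c0 H] := sup_le_energy_unit; exists c => // w t Cw tT.
have CZ a : C0 (a *: w).
  by rewrite -[_ *: _]add0r; apply: C0infty_lin => //; exact: C0infty0.
have sc (a : R) : (a *: w) t = a * w t by [].
have [E0|E0] := eqVneq (energy w) 0.
  rewrite E0 powR0 ?invr_neq0 ?gt_eqF// mulr0 leNgt; apply/negP => w0.
  have := H ((2 * c / `|w t|) *: w) t (CZ _) tT.
  rewrite energyZ// E0 mulr0 => /(_ ler01).
  rewrite sc normrM (ger0_norm (divr_ge0 _ _)) ?mulr_ge0 ?(ltW c0)//.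
  rewrite divfK ?gt_eqF//; lra.
have {}E0 : 0 < energy w by rewrite lt_neqAle eq_sym E0 energy_ge0.
set n := energy w `^ p^-1; have n0 : 0 < n by rewrite powR_gt0.
have np : n `^ p = energy w.
  by rewrite /n -powRrM mulVf ?gt_eqF// powRr1// ltW.
have := H (n^-1 *: w) t (CZ _) tT.
rewrite energyZ// gtr0_norm ?invr_gt0// -np -powRM ?invr_ge0 ?(ltW n0)//.
rewrite mulVf ?gt_eqF// powR1 => /(_ (lexx _)).
rewrite sc normrM gtr0_norm ?invr_gt0//.
by rewrite mulrC ler_pdivrMr.
Qed.

Lemma energy_equicontinuous (M eps : R) : 0 < M -> 0 < eps ->
  exists2 d, 0 < d & forall w t t', C0 w -> energy w <= M ->
    0 <= t <= T -> 0 <= t' <= T -> `|t - t'| <= d -> `|w t - w t'| <= eps.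
Proof.
move=> M0 e0; have [k k0 kE] := RLd_inversion_itv.
have e20 : 0 < eps / 2 / k / M by rewrite !divr_gt0.
have [C C00 HC] := weighted_bound e20.
pose X := eps / 2 / k / (C * (2 / (beta + 1))).
have X0 : 0 < X by rewrite !divr_gt0// mulr_gt0// divr_gt0.
exists (X `^ (beta + 1)^-1); first by rewrite powR_gt0.
suff H w t t' : C0 w -> energy w <= M -> 0 <= t <= T -> 0 <= t' <= T ->
    t' <= t -> `|t - t'| <= X `^ (beta + 1)^-1 -> `|w t - w t'| <= eps.
  move=> w t t' Cw wM tT t'T; have [t't|/ltW tt'] := leP t' t; first exact: H.
  by rewrite distrC (distrC (w t)); exact: H.
move=> Cw; rewrite energy.unlock => wM tT t'T t't td.
have b1 : -1 < alpha - 1 by case/andP: alpha01 => ? _; lra.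
have i1 := integrable_kern_RLd Cw tT; have i2 := integrable_kern_RLd Cw t'T.
rewrite (kE w t)// (kE w t')// -mulrBr -integral_itvB//.
rewrite normrM gtr0_norm//.
have [ib Eb] := integral_kern_itv beta1 tT.
have [ib' Eb'] := integral_kern_itv beta1 t'T.
pose J s := kern beta (t - s) * \1_(`[t', t]) s.
have sub : `[t', t] `<=` (`[0, T] : set R).
  move=> s /=; rewrite !in_itv/= => /andP[t's st].
  by case/andP: tT => _ tT; case/andP: t'T => t'0 _; rewrite (le_trans t'0)// (le_trans st).
have iJ : integrable_itv T J.
  apply: (@integrable_bounded_mul _ _ (fun s => kern beta (t - s)) _ 1) => //.
  - by move=> s _; rewrite indicE; case: (_ \in _); rewrite ?normr1 ?normr0.
have EJ : \int[mu]_(s in `[0, T]) J s = (t - t') `^ (beta + 1) / (beta + 1).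
  have -> : (t - t') `^ (beta + 1) / (beta + 1) =
      \int[mu]_(s in `[t', t]) kern beta (t - s).
    by rewrite /Rintegral integral_kern_reflection.
  rewrite Rintegral_mkcond [RHS]Rintegral_mkcond; congr fine.
  apply: eq_integral => s _; rewrite !patchE /J indicE; congr EFin.
  case: (boolP (s \in `[t', t]%classic)) => st; last by rewrite mulr0; case: ifP.
  by rewrite mulr1 mem_set//; apply: sub; rewrite inE in st.
pose G s := kern beta (t' - s) - kern beta (t - s) + 2 * J s.
have iG : integrable_itv T G.
  apply: integrable_itvD; first exact: integrable_itvB.
  exact: integrable_itvZ.
have EG : \int[mu]_(s in `[0, T]) G s <= 2 * ((t - t') `^ (beta + 1) / (beta + 1)).
  rewrite /G integral_itvD; last 2 first.
  - exact: integrable_itvB.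
  - exact: integrable_itvZ.
  rewrite integral_itvB// integral_itvZ// Eb Eb' EJ gerDr -mulrBl.
  rewrite mulr_le0_ge0 ?invr_ge0 ?(ltW beta10)// subr_le0.
  by case/andP: tT => ? _; case/andP: t'T => ? _; rewrite ge0_ler_powR ?nnegrE// ltW.
have GP s : `|kern (alpha - 1) (t - s) - kern (alpha - 1) (t' - s)| `^ (p / (p - 1))
    <= G s.
  rewrite /G /J; have [st'|t's] := ltP s t'.
    have st := lt_le_trans st' t't.
    rewrite indicE memNset/= ?mulr0 ?addr0; last first.
      by rewrite in_itv/= leNgt st'.
    have anti : kern (alpha - 1) (t - s) <= kern (alpha - 1) (t' - s).
      rewrite !kernE ?subr_gt0// -[alpha - 1]opprB !powRN lef_pV2 ?posrE.
      - by apply: ge0_ler_powR;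
          rewrite ?nnegrE ?lerD2r ?subr_ge0 ?(ltW a1) ?(ltW st') ?(ltW st).
      - by rewrite powR_gt0// subr_gt0.
      - by rewrite powR_gt0// subr_gt0.
    rewrite distrC -!kern_conj ger0_norm ?subr_ge0// !ger0_norm ?kern_ge0//.
    apply: powR_superadditive.
      by rewrite ler_pdivlMr// mul1r gerBl.
    by rewrite kern_ge0.
  have kt' b : kern b (t' - s) = 0 by rewrite kern_le0// subr_le0.
  rewrite !kt' subr0 kern_conj sub0r.
  have [st|ts] := leP s t.
    by rewrite indicE mem_set/= ?in_itv/= ?t's ?st// mulr1; lra.
  by rewrite kern_le0 ?mul0r ?subr_le0 ?(ltW ts)//; lra.
have isum : integrable_itv T (fun s => C * G s + eps / 2 / k / M * `|D w s| `^ p).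
  apply: integrable_itvD; first exact: integrable_itvZ.
  by apply: integrable_itvZ; exact: integrable_energy.
have step : `|\int[mu]_(s in `[0, T]) (kern (alpha - 1) (t - s) * D w s -
      kern (alpha - 1) (t' - s) * D w s)| <=
    \int[mu]_(s in `[0, T]) (C * G s + eps / 2 / k / M * `|D w s| `^ p).
  have i12 := integrable_itvB i1 i2.
  rewrite (le_trans (integral_itv_norm i12))//; apply: integral_itv_le => //.
    exact: integrable_itv_norm.
  move=> s _; rewrite -mulrBl (le_trans (HC _ _))// lerD2r ler_pM2l//.
rewrite -ler_pdivlMl// (le_trans step)//.
rewrite integral_itvD; last 2 first.
- exact: integrable_itvZ.
- by apply: integrable_itvZ; exact: integrable_energy.
rewrite !integral_itvZ//; last exact: integrable_energy.
have h1 : eps / 2 / k / M * \int[mu]_(s in `[0, T]) `|D w s| `^ p <= eps / 2 / k.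
  by rewrite -[leRHS](divfK (lt0r_neq0 M0)) ler_pM2l.
have h2 : (t - t') `^ (beta + 1) <= X.
  rewrite ger0_norm ?subr_ge0// in td.
  rewrite (@le_trans _ _ ((X `^ (beta + 1)^-1) `^ (beta + 1)))//.
    by rewrite ge0_ler_powR ?nnegrE ?subr_ge0 ?powR_ge0// ltW.
  by rewrite -powRrM mulVf ?gt_eqF// powRr1// ltW.
have h3 : C * \int[mu]_(s in `[0, T]) G s <= eps / 2 / k.
  rewrite (@le_trans _ _ (C * (2 * (X / (beta + 1)))))//.
    rewrite ler_pM2l// (le_trans EG)// ler_pM2l// ler_pM2r ?invr_gt0//.
  rewrite /X le_eqVlt; apply/orP; left; apply/eqP; field.
  by rewrite !gt_eqF.
rewrite (le_trans (lerD h3 h1))// mulrC le_eqVlt; apply/orP; left; apply/eqP.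
by field; rewrite gt_eqF.
Qed.

End embedding.

Section bump.
Context {R : realType}.

Lemma smooth_closed_class (S : set (R -> R)) :
  (forall f, S f -> (forall x, derivable f x 1) /\ S f^`()%classic) ->
  forall f, S f -> smooth f.
Proof.
move=> cS f Sf n; suff [] : (forall x, derivable (derive1n n f) x 1) /\
    S (derive1n n.+1 f) by [].
elim: n => [|n [_ IH]]; first exact: cS.
by rewrite /derive1n iterS; exact: cS.
Qed.

Definition flat (n : nat) (x : R) : R :=
  if 0 < x then x^-1 ^+ n * expR (- x^-1) else 0.

Lemma flat_ge0 n x : 0 <= flat n x.
Proof.
rewrite /flat; case: ifPn => // x0.
by rewrite mulr_ge0 ?expR_ge0// exprn_ge0// invr_ge0 ltW.
Qed.

Lemma flat_quadratic n : exists2 C : R, 0 < C & forall x, `|flat n x| <= C * x ^+ 2.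
Proof.
exists (n.+2`!%:R) => [|x]; first by rewrite ltr0n fact_gt0.
rewrite ger0_norm ?flat_ge0// /flat; case: ifPn => x0; last first.
  by rewrite mulr_ge0 ?sqr_ge0.
have xV0 : 0 < x^-1 by rewrite invr_gt0.
have f0 : 0 < n.+2`!%:R :> R by rewrite ltr0n fact_gt0.
have h : x^-1 ^+ n.+2 / n.+2`!%:R <= expR x^-1.
  by rewrite (le_trans _ (expR_ge1Dxn n.+1 (ltW xV0)))// lerDr.
rewrite ler_pdivrMr// in h.
rewrite expRN ler_pdivrMr ?expR_gt0//.
have -> : x^-1 ^+ n = x ^+ 2 * x^-1 ^+ n.+2.
  by rewrite -(addn2 n) exprD mulrCA -exprMn divff ?gt_eqF// expr1n mulr1.
rewrite (_ : _ * x ^+ 2 * _ = x ^+ 2 * (expR x^-1 * n.+2`!%:R)); last by ring.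
by rewrite ler_pM2l ?exprn_gt0.
Qed.

Lemma is_derive_flat n (x : R) :
  is_derive x 1 (flat n) (flat n.+2 x - n%:R * flat n.+1 x).
Proof.
have [x0|x0|x0] := ltgtP x 0.
- rewrite /flat !ifF ?mulr0 ?subrr; try by rewrite lt_gtF.
  apply: (@near_eq_is_derive _ _ _ (cst 0)).
  by near=> y; rewrite ifF// lt_gtF//; near: y; exact: lt_nbhsl.
- rewrite /flat !ifT//.
  apply: (@near_eq_is_derive _ _ _ (fun x : R => x^-1 ^+ n * expR (- x^-1))).
    by near=> y; rewrite ifT//; near: y; exact: lt_nbhsr.
  have di : is_derive x 1 (fun y : R => y^-1) (- x^-1 ^+ 2).
    apply: is_derive_eq; first by apply: is_deriveV; rewrite gt_eqF.
    by rewrite /GRing.scale/= mulr1 exprVn.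
  have dm : is_derive x 1 (fun y : R => - y^-1) (x^-1 ^+ 2).
    by rewrite -[x^-1 ^+ 2]opprK; exact: is_deriveN.
  have de : is_derive x 1 (expR \o (fun y : R => - y^-1)) (expR (- x^-1) * x^-1 ^+ 2).
    exact: is_derive1_comp.
  have dn : is_derive x 1 (fun y : R => y^-1 ^+ n) (- (n%:R * x^-1 ^+ n.+1)).
    have := @is_deriveX _ _ (fun y : R => y^-1) n _ _ _ di.
    rewrite (_ : (fun y : R => y^-1) ^+ n = (fun y : R => y^-1 ^+ n)); last first.
      by apply/funext => y; rewrite exprfctE.
    move/is_derive_eq; apply; rewrite /GRing.scale/= mulrN -mulrA -exprD.
    by case: (n) => [|k]; rewrite ?mul0r//= addn2.
  have := is_deriveM dn de; move/is_derive_eq; apply.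
  rewrite /GRing.scale/= [in LHS](_ : x^-1 ^+ 2 = x^-1 * x^-1) ?expr2// !exprS.
  by ring.
- rewrite x0 /flat ltxx mulr0 subrr -/(flat n).
  have [C C0 HC] := flat_quadratic n.
  have f0 : flat n 0 = 0 by rewrite /flat ltxx.
  have cv : h^-1 *: (flat n (h + 0) - flat n 0) @[h --> 0^'] --> (0 : R).
    apply/cvgrPdist_le => e e0; near=> h.
    rewrite addr0 f0 subr0 sub0r normrN normrM normfV.
    have hn0 : 0 < `|h| by rewrite normr_gt0; near: h; exact: nbhs_dnbhs_neq.
    rewrite mulrC ler_pdivrMr// (le_trans (HC h))// -real_normK ?num_real// expr2 mulrA.
    rewrite ler_pM2r// mulrC -ler_pdivlMr//.
    near: h; apply: dnbhs0_le; exact: divr_gt0.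
  apply: DeriveDef.
    apply/cvg_ex; exists 0; rewrite (_ : (fun h => _) =
      (fun h : R => h^-1 *: (flat n (h + 0) - flat n 0)))//.
    by apply/funext => h; rewrite /GRing.scale/= mulr1.
  apply/cvg_lim => //; rewrite (_ : (fun h => _) =
      (fun h : R => h^-1 *: (flat n (h + 0) - flat n 0)))//.
  by apply/funext => h; rewrite /GRing.scale/= mulr1.
Unshelve. all: by end_near. Qed.

Inductive bump_class (a b : R) : (R -> R) -> Prop :=
| bump_prod n m : bump_class a b (fun x => flat n (x - a) * flat m (b - x))
| bump_lin c f g : bump_class a b f -> bump_class a b g ->
    bump_class a b (f + c *: g).

Lemma smooth_bump_class a b f : bump_class a b f -> smooth f.
Proof.
apply: (@smooth_closed_class (bump_class a b)) => {}f.
elim=> [n m|c g h _ [dg Sg] _ [dh Sh]]; last first.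
  have dch x : derivable (c *: h) x 1 by exact: derivableZ.
  split=> [x|]; first exact: derivableD.
  rewrite (_ : (g + c *: h)^`()%classic = g^`()%classic + c *: h^`()%classic).
    exact: bump_lin.
  apply/funext => x; rewrite !derive1E deriveD//= deriveZ//.
  by rewrite -!derive1E.
pose P n m (x : R) := flat n (x - a) * flat m (b - x).
have dP (x : R) : is_derive x 1 (P n m)
    ((P n.+2 m + (- n%:R) *: P n.+1 m + m%:R *: P n m.+1 + (-1) *: P n m.+2) x).
  have d1 : is_derive x 1 (flat n \o (fun x => x - a))
      (flat n.+2 (x - a) - n%:R * flat n.+1 (x - a)).
    rewrite -[X in is_derive _ _ _ X]mulr1.
    have sh : is_derive x 1 (fun x : R => x - a) 1 := is_derive_shift x 1 (- a).
    by apply: is_derive1_comp; exact: is_derive_flat.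
  have d2 : is_derive x 1 (flat m \o (fun x => b - x))
      (- (flat m.+2 (b - x) - m%:R * flat m.+1 (b - x))).
    rewrite -[X in is_derive _ _ _ X]mulrN1.
    have sh : is_derive x 1 (fun x : R => b - x) (-1).
      have := is_deriveB (is_derive_cst b x 1) (is_derive_id x 1).
      by move/is_derive_eq; apply; rewrite sub0r.
    by apply: is_derive1_comp; exact: is_derive_flat.
  have := is_deriveM d1 d2; move/is_derive_eq; apply.
  by rewrite /P !fctE /GRing.scale/=; ring.
split=> [x|]; first by have [] := dP x.
rewrite (_ : (P n m)^`()%classic =
  P n.+2 m + (- n%:R) *: P n.+1 m + m%:R *: P n m.+1 + (-1) *: P n m.+2).
  by do 3! (apply: bump_lin; last exact: bump_prod); exact: bump_prod.
by apply/funext => x; rewrite derive1E; have [_ ->] := dP x.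
Qed.

(** Nontrivial test functions exist. *)
Lemma C0infty_bump (T : R) : 0 < T -> exists e : R -> R, exists2 c : R, 0 < c &
  C0infty T e /\ forall t, 3 * T <= 8 * t <= 5 * T -> c <= e t.
Proof.
move=> T0; pose a := T / 4; pose b := 3 * T / 4.
pose e (x : R) := flat 0 (x - a) * flat 0 (b - x).
exists e, (flat 0 (T / 8) * flat 0 (T / 8)).
  by rewrite /flat divr_gt0// !mulr_gt0 ?expr0 ?expR_gt0.
split; last first.
  have mono x y : 0 < x -> x <= y -> flat 0 x <= flat 0 y.
    move=> x0 xy; have y0 := lt_le_trans x0 xy.
    by rewrite /flat x0 y0 !expr0 !mul1r ler_expR lerN2 lef_pV2.
  move=> t /andP[t1 t2].
  have T8 : 0 < T / 8 by rewrite divr_gt0.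
  rewrite /e ler_pM ?flat_ge0// mono// /a /b; lra.
have sub : closure [set t | e t != 0] `<=` `[a, b].
  rewrite closureE; apply: smallest_sub; first exact: interval_closed.
  move=> t /=; rewrite in_itv/= /e /flat mulf_eq0 negb_or => /andP[].
  case: ifPn => [+ _|_]; last by rewrite eqxx.
  case: ifPn => [+ + _|_]; last by rewrite eqxx.
  by rewrite !subr_gt0 => /ltW -> /ltW ->.
split.
- exact: smooth_bump_class (bump_prod a b 0 0).
- apply: (subclosed_compact _ (@segment_compact _ a b) sub).
  exact: closed_closure.
- move=> t /sub; rewrite /= !in_itv/= /a /b => /andP[? ?]; apply/andP; split; lra.
Qed.

End bump.

Section borel_representative.
Context {R : realType}.
Local Notation mu := (@lebesgue_measure R).

Lemma null_bigcup (N : nat -> set (measurableTypeR R)) :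
  (forall n, measurable (N n)) -> (forall n, mu (N n) = 0%E) ->
  measurable (\bigcup_n N n) /\ mu (\bigcup_n N n) = 0%E.
Proof.
move=> mN N0; have mU : measurable (\bigcup_n N n) by exact: bigcupT_measurable.
split=> //; apply/eqP; rewrite -measure_le0.
rewrite (le_trans (measure_sigma_subadditive mu mN mU (@subset_refl _ _)))//.
by rewrite eseries0// => n _ _; exact: N0.
Qed.

Lemma lebesgue_measurable_borel (A : set R) :
  ((wlength (@idfun R))^*%mu).-cara.-measurable A ->
  exists2 N : set (measurableTypeR R), measurable N /\ mu N = 0%E &
    exists2 B : set (measurableTypeR R), measurable B & A `\` N = B `\` N.
Proof.
rewrite -completed_caratheodory_measurable g_sigma_completed_algebra_genE.
move=> HA; case: HA => B mB [M negM <-]; case: negM => N [mN N0 MN].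
exists N => //; exists B => //.
apply/seteqP; split => x [+ Nx]; last by split => //; left.
by move=> [Bx|/MN]; first by split.
Qed.

Lemma ratr_dense_lt (x y : R) : x < y -> exists q : rat, x < ratr q < y.
Proof.
move=> xy; have [q] := rat_in_itvoo xy.
by rewrite in_itv/= => ?; exists q.
Qed.

Definition nth_rat (n : nat) : rat := odflt 0 (unpickle n).

Lemma nth_ratP (q : rat) : exists n, nth_rat n = q.
Proof. by exists (pickle q); rewrite /nth_rat pickleK. Qed.

(** A Lebesgue measurable function is Borel off a Borel null set, the preimages of
    countably many rays sufficing to see it. *)
Lemma lebesgue_measurable_fun_borel (T : R) (h : R -> R) :
  lebesgue_measurable_fun `[0, T] h ->
  exists2 N : set (measurableTypeR R), measurable N /\ mu N = 0%E &
    measurable_fun (`[0, T] `\` N) h.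
Proof.
move=> mh.
have mT : ((wlength (@idfun R))^*%mu).-cara.-measurable (`[0, T]%classic : set R).
  by apply: sub_caratheodory; exact: measurable_itv.
have mray (y : R) : ((wlength (@idfun R))^*%mu).-cara.-measurable
    (`[0, T] `&` h @^-1` `]y, +oo[).
  by apply: mh => //; exact: measurable_itv.
pose y n : R := ratr (nth_rat n).
have repr n : exists N : set (measurableTypeR R), (measurable N /\ mu N = 0%E) /\
    exists2 B : set (measurableTypeR R), measurable B &
      (`[0, T] `&` h @^-1` `]y n, +oo[) `\` N = B `\` N.
  by have [N N0 HN] := lebesgue_measurable_borel (mray (y n)); exists N.
have [N HN] := choice repr.
have mN n : measurable (N n) by have [[]] := HN n.
have N0 n : mu (N n) = 0%E by have [[]] := HN n.
have [mU U0] := null_bigcup mN N0.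
exists (\bigcup_n N n) => //.
have mE n : measurable ((`[0, T] `&` h @^-1` `]y n, +oo[) `\` \bigcup_n N n
    : set (measurableTypeR R)).
  have [_ [B mB EB]] := HN n.
  have -> : (`[0, T] `&` h @^-1` `]y n, +oo[) `\` \bigcup_n N n =
      B `\` \bigcup_n N n.
    apply/seteqP; split => x [Ax Ux]; split => //.
      have : (B `\` N n) x by rewrite -EB; split => // Nx; apply: Ux; exists n.
      by case.
    have : ((`[0, T] `&` h @^-1` `]y n, +oo[) `\` N n) x.
      by rewrite EB; split => // Nx; apply: Ux; exists n.
    by case.
  exact: measurableD.
move=> mD; apply: (measurability _ (RGenOInfty.measurableE R)) => //.
move=> _ [_ [z ->] <-].
have -> : (`[0, T] `\` \bigcup_n N n) `&` h @^-1` `]z, +oo[ =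
    \bigcup_(n in [set n | z < y n])
      ((`[0, T] `&` h @^-1` `]y n, +oo[) `\` \bigcup_n N n).
  apply/seteqP; split => [x [[Tx Ux]]|x [n /= zn [[Tx xn] Ux]]].
    rewrite /= in_itv/= andbT => zx; have [q /andP[zq qx]] := ratr_dense_lt zx.
    have [n nq] := nth_ratP q; exists n; first by rewrite /= /y nq.
    by split=> //; split=> //; rewrite /= in_itv/= andbT /y nq.
  split=> //; move: xn; rewrite /= !in_itv/= !andbT.
  exact: lt_trans.
apply: bigcup_measurable => n _; exact: mE.
Qed.

(* Rounding of the second variable down to a multiple of [1 / n.+1]. *)
Definition grid_round (n : nat) (x : R) : R := (Num.floor (x * n.+1%:R))%:~R / n.+1%:R.

Lemma grid_round_cvg (x : R) : grid_round n x @[n --> \oo] --> x.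
Proof.
apply/cvgrPdist_le => e e0; near=> n.
have n0 : 0 < n.+1%:R :> R by rewrite ltr0n.
have /andP[h1 h2] := floor_itv (x * n.+1%:R).
rewrite /grid_round -[X in X - _](mulfK (lt0r_neq0 n0)) -mulrBl normrM normfV.
rewrite (gtr0_norm n0) ger0_norm ?subr_ge0//.
rewrite (@le_trans _ _ (1 / n.+1%:R))//.
  rewrite ler_pM2r ?invr_gt0// lerBlDl ltW//.
  by move: h2; rewrite intrD.
rewrite div1r; near: n.
have /cvgrPdist_le/(_ _ e0) := @cvg_harmonic R.
by apply: filterS => n; rewrite sub0r normrN ger0_norm ?harmonic_ge0.
Unshelve. all: by end_near. Qed.

(** A Caratheodory function composed with measurable maps is measurable. *)
Lemma caratheodory_comp d (S : measurableType d) (g : R -> R -> R) (a b : S -> R) :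
  (forall x, measurable_fun setT (g ^~ x)) -> (forall t, continuous (g t)) ->
  measurable_fun setT a -> measurable_fun setT b ->
  measurable_fun setT (fun z => g (a z) (b z)).
Proof.
move=> mg cg ma mb.
apply: (@measurable_fun_cvg _ _ _ _ (fun n z => g (a z) (grid_round n (b z)))); last first.
  move=> z _; apply: (@cvg_comp _ _ _ (fun n => grid_round n (b z)) (g (a z)) _ (nbhs (b z : R))); [exact: grid_round_cvg|exact: cg].
move=> n.
pose m (k : nat) : int := odflt 0 (unpickle k).
pose E (k : nat) : set S := [set z | Num.floor (b z * n.+1%:R) = m k].
have mE k : measurable (E k).
  have mb1 : measurable_fun setT (fun z => b z * n.+1%:R) by exact: measurable_funM.
  have -> : E k = (fun z => b z * n.+1%:R) @^-1` `[(m k)%:~R, (m k + 1)%:~R[.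
    apply/seteqP; split => z; rewrite /E /= in_itv/= => zm.
      by rewrite -zm floor_itv.
    exact: floor_def.
  rewrite -[X in measurable X]setTI; apply: mb1 => //; exact: measurable_itv.
have -> : [set: S] = \bigcup_k E k.
  apply/seteqP; split=> // z _; exists (pickle (Num.floor (b z * n.+1%:R))) => //.
  by rewrite /E /m /= pickleK.
apply/measurable_fun_bigcup => // k.
apply: (@eq_measurable_fun _ _ _ _ _
  (fun z => g (a z) ((m k)%:~R / n.+1%:R))).
  by move=> z; rewrite inE /E /= => zk; rewrite /grid_round zk.
apply: measurable_funTS.
exact: (measurableT_comp (mg _) ma).
Qed.
End borel_representative.

Section primitive.
Context {R : realType}.
Local Notation mu := (@lebesgue_measure R).

Lemma continuous_integrable (h : R -> R) (a b : R) : continuous h ->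
  mu.-integrable `[a, b] (EFin \o h).
Proof.
move=> ch; apply: continuous_compact_integrable; first exact: segment_compact.
exact: continuous_subspaceT.
Qed.

Lemma is_derive_primitive0 (h : R -> R) (x : R) : continuous h ->
  is_derive x 1 (primitive0 h) (h x).
Proof.
move=> ch; pose A := `|x| + 1.
have Ax : - A < x < A.
  by rewrite -ltr_norml ltrDl.
pose P (y : R) := \int[mu]_(s in `[- A, y]) h s.
have split_int (y z : R) : - A <= y -> y <= z ->
    \int[mu]_(s in `[y, z]) h s = P z - P y.
  move=> Ay yz; rewrite /P.
  have iz : mu.-integrable [set` Interval (BLeft (- A)) (BRight z)] (EFin \o h).
    exact: continuous_integrable.
  have := @Rintegral_itvB R h (BLeft (- A)) (BRight z) y iz.
  rewrite !bnd_simp => /(_ Ay yz) ->; rewrite Rintegral_itv_obnd_cbnd//.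
  apply: integrableS (continuous_integrable y z ch) => //.
  by move=> s; rewrite /= !in_itv/= => /andP[/ltW -> ->].
have dP y : - A < y < A -> derivable P y 1 /\ P^`()%classic y = h y.
  move=> /andP[Ay yA].
  apply: (continuous_FTC1_closed yA) => //; last exact: ch.
  exact: continuous_integrable.
have near_eq : \forall y \near x, P y - P 0 = primitive0 h y.
  have : x \in `]- A, A[ by rewrite in_itv.
  move/near_in_itvoo; apply: filterS => y; rewrite in_itv/= => /andP[Ay yA].
  rewrite /primitive0; have A0 : - A <= 0 by lra.
  case: leP => y0; first by rewrite split_int.
  by rewrite split_int ?(ltW Ay) ?(ltW y0)// opprB.
apply: (near_eq_is_derive near_eq).
have [dPx <-] := dP x Ax.
have dPx' : is_derive x 1 P (P^`()%classic x) by rewrite derive1E; exact: DeriveDef.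
have := is_deriveB dPx' (is_derive_cst (P 0) x 1).
by move/is_derive_eq; apply; rewrite subr0.
Qed.

Lemma primitive0_0 (h : R -> R) : primitive0 h 0 = 0.
Proof. by rewrite /primitive0 lexx set_itv1 Rintegral_set1. Qed.

Lemma primitive0_continuous (h : R -> R) : continuous h -> continuous (primitive0 h).
Proof.
move=> ch; apply: derivable_continuous => x.
by have [] := is_derive_primitive0 x ch.
Qed.

(** Mean value theorem for the primitive. *)
Lemma primitive0_mean (h : R -> R) (a b : R) : continuous h ->
  exists c, [/\ `|c - a| <= `|b - a|, Num.min a b <= c <= Num.max a b &
    primitive0 h b - primitive0 h a = h c * (b - a)].
Proof.
move=> ch.
have aux (x y : R) : x < y -> exists2 c, x < c < y &
    primitive0 h y - primitive0 h x = h c * (y - x).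
  move=> xy.
  have [||c cxy cE] := @MVT R (primitive0 h) h x y xy.
  - by move=> z _; exact: is_derive_primitive0.
  - exact/continuous_subspaceT/primitive0_continuous.
  by exists c => //; rewrite in_itv in cxy.
have [ab|ba|->] := ltgtP a b.
- have [c /andP[ac cb] cE] := aux _ _ ab; exists c; split => //.
    by rewrite !ger0_norm ?subr_ge0 ?(ltW ac) ?(ltW ab)// lerD2r ltW.
  by rewrite !ltW.
- have [c /andP[bc ca] cE] := aux _ _ ba; exists c; split => //.
  + by rewrite !ler0_norm ?subr_le0 ?(ltW ca) ?(ltW ba)// lerN2 lerD2r ltW.
  + by rewrite !ltW.
  + by rewrite -opprB cE -mulrN opprB.
- by exists b; split; rewrite ?subrr ?normr0 ?lexx// mulr0.
Qed.

(* The primitive in the second variable of a Caratheodory function is measurable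
   in the first one. *)
Lemma measurable_primitive0 (g : R -> R -> R) (x : R) :
  (forall y, measurable_fun setT (g ^~ y)) -> (forall t, continuous (g t)) ->
  measurable_fun setT (fun t => primitive0 (g t) x).
Proof.
move=> mg cg.
have mint (a b : R) : measurable_fun setT (fun t => \int[mu]_(s in `[a, b]) g t s).
  pose G (z : measurableTypeR R * measurableTypeR R) : \bar R :=
    (g z.1 z.2 * \1_(`[a, b]) z.2)%:E.
  have mG : measurable_fun setT G.
    apply/measurable_EFinP/measurable_funM; first exact: caratheodory_comp.
    by apply: measurableT_comp => //; exact: measurable_indic.
  have -> : (fun t => \int[mu]_(s in `[a, b]) g t s) =
      (fun t => fine (\int[mu]_s G^\+ (t, s) - \int[mu]_s G^\- (t, s))%E).
    apply/funext => t; rewrite /Rintegral integral_mkcond integralE.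
    congr (fine (_ - _)%E); apply: eq_integral => s _.
      rewrite !funeposE /G /= patchE indicE.
      by case: ifP => _; rewrite ?mulr1 ?mulr0.
    rewrite !funenegE /G /= patchE indicE.
    by case: ifP => _; rewrite ?mulr1 ?mulr0.
  apply: measurableT_comp => //; apply: emeasurable_funB.
  - apply: (measurable_fun_fubini_tonelli_F (m2 := mu) (fun z => G^\+ z)%E) => //.
    exact: measurable_funepos.
  - apply: (measurable_fun_fubini_tonelli_F (m2 := mu) (fun z => G^\- z)%E) => //.
    exact: measurable_funeneg.
rewrite /primitive0; case: (0 <= x); first exact: mint.
by apply: measurableT_comp => //; exact: mint.
Qed.

Import HBNNSimple.

(** The integral of a possibly non-measurable function ignores null sets. *)
Lemma integral_off_null (D N : set (measurableTypeR R)) (h1 h2 : R -> R) :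
  measurable D -> measurable N -> mu N = 0%E ->
  (forall t, D t -> ~ N t -> h1 t = h2 t) ->
  \int[mu]_(t in D) h1 t = \int[mu]_(t in D) h2 t.
Proof.
move=> mD mN N0 h12.
have nn (F1 F2 : measurableTypeR R -> \bar R) : (forall t, 0 <= F1 t)%E ->
    (forall t, 0 <= F2 t)%E -> (forall t, ~ N t -> F1 t = F2 t) ->
    (\int[mu]_t F1 t <= \int[mu]_t F2 t)%E.
  move=> F10 F20 F12; rewrite (ge0_integralTE mu F10) (ge0_integralTE mu F20).
  apply: ge_ereal_sup => _ [k kF1 <-].
  have mCN : measurable (~` N) by exact: measurableC.
  apply: ereal_sup_ubound; exists (proj_nnsfun k mCN) => /= [t|].
    rewrite mindicE; case: (boolP (t \in ~` N)) => [|_]; last by rewrite mulr0.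
    by rewrite inE => /F12 <-; rewrite mulr1; exact: kF1.
  rewrite -!integralT_nnsfun; apply: ge0_ae_eq_integral => //.
  - by apply/measurable_EFinP; exact: measurable_funP.
  - by apply/measurable_EFinP; exact: measurable_funP.
  - by move=> x _; rewrite lee_fin fun_ge0.
  - by move=> x _; rewrite lee_fin fun_ge0.
  exists N; split => // t /= kt; apply: contrapT => Nt; apply: kt => _ /=.
  by rewrite mindicE mem_set ?mulr1.
rewrite /Rintegral; congr fine; rewrite integralE [RHS]integralE.
have pn (F1 F2 : measurableTypeR R -> \bar R) : (forall t, 0 <= F1 t)%E ->
    (forall t, 0 <= F2 t)%E -> (forall t, D t -> ~ N t -> F1 t = F2 t) ->
    (\int[mu]_(t in D) F1 t = \int[mu]_(t in D) F2 t)%E.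
  move=> F10 F20 F12; rewrite integral_mkcond [RHS]integral_mkcond.
  have H t : ~ N t -> (F1 \_ D) t = (F2 \_ D) t.
    by move=> Nt; rewrite !patchE; case: ifPn => //; rewrite inE => Dt; exact: F12.
  by apply/eqP; rewrite eq_le !nn// => t; rewrite ?erestrict_ge0// => /H.
congr (_ - _)%E; apply: pn => // t Dt Nt.
- by rewrite !funeposE h12.
- by rewrite !funenegE h12.
Qed.
End primitive.

Lemma le_of_cvg {R : realType} {I : Type} {F : set_system I} {FF : ProperFilter F}
  (h : I -> R) (l c : R) : h @ F --> l -> (\forall i \near F, h i <= c) -> l <= c.
Proof.
move=> hl hc; rewrite -(cvg_lim _ hl)//; apply: limr_le => //.
by apply: cvgP hl.
Qed.

Section regularization.
Context {R : realType}.
Local Notation mu := (@lebesgue_measure R).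

(** Changing a Caratheodory nonlinearity on a null set of times makes it Borel in
    time, and makes its bounds hold everywhere: all the null sets involved, one for
    each point of a countable dense set of values, are merged into one. *)
Lemma regularization (T p C q m r eps delta : R) (f : R -> R -> R) :
  0 < C -> 0 <= q - 1 -> 0 < m -> 0 < eps -> caratheodory_function T f ->
  {ae mu, forall t, t \in `[0, T] ->
    forall xi, `|f t xi| <= C * (1 + `|xi| `^ (q - 1))} ->
  {ae mu, forall t, t \in `[0, T] -> forall xi, r <= `|xi| ->
    0 < m * primitive0 (f t) xi <= xi * f t xi} ->
  {ae mu, forall t, t \in `[0, T] -> forall xi, 0 < `|xi| < delta ->
    `|f t xi / `|xi| `^ (p - 1)| < eps} ->
  exists g : R -> R -> R, exists2 N : set (measurableTypeR R),
    measurable N /\ mu N = 0%E &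
    [/\ forall t, 0 <= t <= T -> ~ N t -> g t = f t,
        (forall x, measurable_fun setT (g ^~ x)) /\ (forall t, continuous (g t)),
        forall t x, `|g t x| <= C * (1 + `|x| `^ (q - 1)),
        forall t x, 0 < `|x| < delta -> `|g t x| <= eps * `|x| `^ (p - 1) &
        (forall t x, r <= `|x| -> 0 <= m * primitive0 (g t) x <= x * g t x) /\
        (forall t x, 0 <= t <= T -> ~ N t -> r <= `|x| -> 0 < primitive0 (g t) x)].
Proof.
move=> C0 q0 m0 e0 [mf [N1 [mN1 N10 cf]]] [N2 [mN2 N20 gf]] [N3 [mN3 N30 af]]
  [N4 [mN4 N40 sf]].
pose pt (k : nat) : R := let i : int * nat := odflt (0, 0%N) (unpickle k) in
  i.1%:~R / i.2.+1%:R.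
have repr k : exists N : set (measurableTypeR R), (measurable N /\ mu N = 0%E) /\
    measurable_fun (`[0, T] `\` N) (f ^~ (pt k)).
  by have [N ? ?] := lebesgue_measurable_fun_borel (mf (pt k)); exists N.
have [M HM] := choice repr.
have [mU U0] := @null_bigcup R M (fun n => (HM n).1.1) (fun n => (HM n).1.2).
pose N : set (measurableTypeR R) := (\bigcup_n M n) `|` (N1 `|` N2 `|` (N3 `|` N4)).
have mN : measurable N by apply: measurableU => //; do 2 apply: measurableU => //.
have N0 : mu N = 0%E.
  have null2 (A B : set (measurableTypeR R)) : measurable A -> measurable B ->
      mu A = 0%E -> mu B = 0%E -> mu (A `|` B) = 0%E.
    move=> mA mB A0 B0; apply/eqP; rewrite -measure_le0.
    have <- : (mu A + mu B = 0)%E by rewrite A0 B0 adde0.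
    exact: measureU2.
  by rewrite !null2//; do ? apply: measurableU.
pose A : set (measurableTypeR R) := `[0, T] `\` N.
have mA : measurable A by apply: measurableD => //; exact: measurable_itv.
pose g t x := if t \in A then f t x else 0.
have gA t x : A t -> g t x = f t x by move=> At; rewrite /g mem_set.
have gnA t x : ~ A t -> g t x = 0 by move=> At; rewrite /g memNset.
have AP t : A t -> [/\ continuous (f t),
    forall xi, `|f t xi| <= C * (1 + `|xi| `^ (q - 1)),
    forall xi, r <= `|xi| -> 0 < m * primitive0 (f t) xi <= xi * f t xi &
    forall xi, 0 < `|xi| < delta -> `|f t xi / `|xi| `^ (p - 1)| < eps].
  move=> [tT Nt]; split.
  - apply: contrapT => H; apply: Nt; right; left; left; apply: cf => /= K.
    by apply: H; exact: K.
  - apply: contrapT => H; apply: Nt; right; left; right; apply: gf => /= K.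
    by apply: H; exact: K.
  - apply: contrapT => H; apply: Nt; right; right; left; apply: af => /= K.
    by apply: H; exact: K.
  - apply: contrapT => H; apply: Nt; right; right; right; apply: sf => /= K.
    by apply: H; exact: K.
have cg t : continuous (g t).
  have [At|At] := pselect (A t).
    have -> : g t = f t by apply/funext => x; exact: gA.
    by case: (AP t At).
  have -> : g t = cst 0 by apply/funext => x; exact: gnA.
  exact: cst_continuous.
have g0 t : ~ A t -> forall x, primitive0 (g t) x = 0.
  move=> At x; have gt y : g t y = 0 by exact: gnA.
  have i0 (B : set R) : \int[mu]_(s in B) g t s = 0.
    by rewrite (@eq_Rintegral _ _ _ mu B (fun=> 0))// /Rintegral integral0.
  by rewrite /primitive0 !i0 oppr0; case: ifP.
exists g, N => //; split.
- move=> t tT Nt; apply/funext => x; by apply: gA; split.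
- split=> // x.
  have mgpt k : measurable_fun setT (g ^~ (pt k)).
    rewrite (_ : g ^~ (pt k) = (f ^~ (pt k)) \_ A).
      apply: (iffLR (measurable_restrictT _ mA)).
      apply: (measurable_funS _ _ (HM k).2).
        by apply: measurableD; [exact: measurable_itv|exact: (HM k).1.1].
      by move=> t [tT Nt]; split => // Mt; apply: Nt; left; exists k.
    by apply/funext => t; rewrite patchE.
  apply: (@measurable_fun_cvg _ _ _ _ (fun n t => g t (grid_round n x))).
    move=> n; have := mgpt (pickle (Num.floor (x * n.+1%:R), n)).
    by rewrite /pt pickleK.
  move=> t _; apply: (@cvg_comp _ _ _ (fun n => grid_round n x) (g t) _ (nbhs x)).
    exact: grid_round_cvg.
  exact: cg.
- move=> t x; have [At|At] := pselect (A t).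
    by rewrite gA//; case: (AP t At).
  by rewrite gnA// normr0 mulr_ge0 ?(ltW C0)// addr_ge0// powR_ge0.
- move=> t x xd; have [At|At] := pselect (A t); last first.
    by rewrite gnA// normr0 mulr_ge0 ?(ltW e0)// powR_ge0.
  rewrite gA//; have [_ _ _ /(_ x xd)] := AP t At.
  case/andP: xd => x0 _; rewrite normrM normfV (ger0_norm (powR_ge0 _ _)).
  by rewrite ltr_pdivrMr ?powR_gt0// => /ltW.
- split=> t x.
    move=> rx; have [At|At] := pselect (A t); last first.
      by rewrite g0// gnA// !mulr0 lexx.
    have -> : g t = f t by apply/funext => y; exact: gA.
    by have [_ _ /(_ x rx)/andP[/ltW -> ->] _] := AP t At.
  move=> tT Nt rx; have At : A t by split.
  have -> : g t = f t by apply/funext => y; exact: gA.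
  have [_ _ /(_ x rx)/andP[+ _] _] := AP t At.
  by rewrite pmulr_rgt0.
Qed.

Lemma continuous_segment_uniform (h : R -> R) (A eps : R) : continuous h -> 0 < eps ->
  exists n : nat, forall x y, `|x| <= A -> `|x - y| < n.+1%:R^-1 ->
    `|h x - h y| <= eps.
Proof.
move=> ch e0; have cK : compact (`[- A, A]%classic : set R) by exact: segment_compact.
have e20 : 0 < eps / 2 by rewrite divr_gt0.
have [|n _ Hn] := (compact_near_coveringP _).1 cK nat \oo (fun n x => forall y,
    `|x - y| < n.+1%:R^-1 -> `|h x - h y| <= eps) _.
  move=> x _; have /cvgrPdist_le/(_ _ e20)[r /= r0 hr] := ch x.
  have r20 : 0 < r / 2 by rewrite divr_gt0.
  have nr : \forall n \near \oo, n.+1%:R^-1 <= r / 2.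
    have /cvgrPdist_le/(_ _ r20) := @cvg_harmonic R.
    by apply: filterS => n; rewrite sub0r normrN ger0_norm ?harmonic_ge0.
  exists (ball x (r / 2), [set n | n.+1%:R^-1 <= r / 2]).
    by split => //; exact: nbhsx_ballx.
  move=> [x' n] [/= xx' nr2] y yx'.
  have h1 : `|h x - h x'| <= eps / 2.
    by apply: hr => /=; rewrite (lt_le_trans xx')//; lra.
  have h2 : `|h x - h y| <= eps / 2.
    apply: hr => /=; rewrite -(subrKA x') (le_lt_trans (ler_normD _ _))//.
    rewrite [ltRHS](splitr r) ltrD//; exact: lt_le_trans nr2.
  rewrite distrC in h1; rewrite -(subrKA (h x)) (le_trans (ler_normD _ _))//.
  by rewrite [leRHS](splitr eps) lerD.
exists n => x y xA; apply: (Hn n _ x) => //=.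
by rewrite in_itv/= -ler_norml.
Qed.

(** Uniform continuity in the value, uniformly in time off a set of small measure:
    the sets of good times for a given modulus are Borel and exhaust the interval. *)
Lemma caratheodory_modulus (T M K eps : R) (g : R -> R -> R) :
  0 <= T -> 0 <= K -> 0 < eps ->
  (forall x, measurable_fun setT (g ^~ x)) -> (forall t, continuous (g t)) ->
  (forall t x, `|x| <= M -> `|g t x| <= K) ->
  exists2 d, 0 < d & exists2 om : R -> R,
    bounded_mfun T om /\ \int[mu]_(t in `[0, T]) om t <= eps &
    forall t x y, 0 <= t <= T -> `|x| <= M -> `|y| <= M -> `|x - y| <= d ->
      `|g t x - g t y| <= om t.
Proof.
move=> T0 K0 e0 mg cg gK.
pose e1 := eps / 2 / (T + 1).
have T1 : 0 < T + 1 by rewrite ltr_wpDl.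
have e10 : 0 < e1 by rewrite !divr_gt0.
pose pt (k : nat) : R := let i : int * nat := odflt (0, 0%N) (unpickle k) in
  i.1%:~R / i.2.+1%:R.
have ptE n x : grid_round n x = pt (pickle (Num.floor (x * n.+1%:R), n)).
  by rewrite /pt pickleK.
pose cond (n : nat) (x y : R) :=
  [&& `|x| < M + 1, `|y| < M + 1 & `|x - y| < n.+1%:R^-1].
pose B n i j : set (measurableTypeR R) :=
  [set t | cond n (pt i) (pt j) -> `|g t (pt i) - g t (pt j)| <= e1].
have mB n i j : measurable (B n i j).
  rewrite /B; case: (cond n _ _); last first.
    by rewrite (_ : [set _ | _] = setT)//; apply/seteqP; split.
  have mgg : measurable_fun setT (fun t => `|g t (pt i) - g t (pt j)|).
    by apply: measurableT_comp => //; exact: measurable_funB.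
  rewrite (_ : [set _ | _] =
    setT `&` (fun t => `|g t (pt i) - g t (pt j)|) @^-1` `]-oo, e1]); last first.
    by apply/seteqP; split => t /=; rewrite in_itv/= => H; [split => //; exact: H|case: H].
  by apply: mgg => //; exact: measurable_itv.
pose bad n : set (measurableTypeR R) := `[0, T] `\` \bigcap_i \bigcap_j B n i j.
have mbad n : measurable (bad n).
  apply: measurableD; first exact: measurable_itv.
  by do 2 (apply: bigcapT_measurable => ?); exact: mB.
have muT : (mu (`[0%R, T]%classic : set (measurableTypeR R)) < +oo)%E.
  by rewrite /= lebesgue_measure_itv/=; case: ifPn => // _; rewrite -EFinD ltry.
have bad0 : \bigcap_n bad n = set0.
  apply/seteqP; split => // t Ht.
  have [n Hn] := continuous_segment_uniform (M + 1) (cg t) e10.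
  have [_ []] := Ht n I; move=> i _ j _ /and3P[/ltW xM _ xy]; exact: Hn.
have bad_dec : nonincreasing_seq bad.
  apply/nonincreasing_seqP => n; rewrite subsetEset => t [tT Ht]; split => //.
  apply: contra_not Ht => Ht i _ j _ /and3P[xM yM xy]; apply: (Ht i I j I).
  apply/and3P; split => //; rewrite (lt_le_trans xy)// lef_pV2 ?posrE ?ltr0n//.
  by rewrite ler_nat.
have bad_fin : (mu (bad 0%N) < +oo)%E.
  by apply: le_lt_trans muT; apply: le_measure; rewrite ?inE//; exact: subDsetl.
have mcap : measurable (\bigcap_n bad n) by rewrite bad0; exact: measurable0.
have := nonincreasing_cvg_mu bad_fin mbad mcap bad_dec.
rewrite bad0 measure0 => cvbad.
pose e2 := eps / 2 / (2 * K + 1).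
have K1 : 0 < 2 * K + 1 by rewrite ltr_wpDl// mulr_ge0.
have e20 : 0 < e2 by rewrite !divr_gt0.
have [n badn] : exists n, (mu (bad n) < e2%:E)%E.
  have /(_ _)[|n _ Hn] := cvbad [set x | (x < e2%:E)%E].
    by apply: open_ereal_lt_ereal => //; rewrite lte_fin.
  by exists n; apply: (Hn n) => /=.
have badfin : mu (bad n) \is a fin_num.
  by rewrite ge0_fin_numE// (lt_trans badn)// ltry.
exists (2 * n.+1%:R)^-1; first by rewrite invr_gt0 mulr_gt0// ltr0n.
have mind : measurable_fun `[0, T] (\1_(bad n) : R -> R) 
  by apply: measurable_indic; exact: mbad.
have bind : bounded_mfun T (fun t => 2 * K * \1_(bad n) t).
  apply: bounded_mfunM; first exact: bounded_mfun_cst.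
  by split => //; exists 1 => t _; rewrite indicE; case: (_ \in _); rewrite ?normr1 ?normr0.
exists (fun t => e1 + 2 * K * \1_(bad n) t); first split.
- exact: bounded_mfunD (bounded_mfun_cst _ _) bind.
- rewrite integral_itvD; last 2 first.
  + exact/bounded_mfun_integrable/bounded_mfun_cst.
  + exact: bounded_mfun_integrable.
  rewrite integral_itv_cst// integral_itvZ; last first.
    apply: bounded_mfun_integrable; split=> //.
    by exists 1 => t _; rewrite indicE; case: (_ \in _); rewrite ?normr1 ?normr0.
  have -> : \int[mu]_(t in `[0, T]) \1_(bad n) t = fine (mu (bad n)).
    rewrite /Rintegral integral_indic; [|exact: measurable_itv|exact: mbad].
    by congr (fine (mu _)); apply/setIidl; exact: subDsetl.
  have h1 : e1 * T <= eps / 2.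
    rewrite /e1 mulrAC ler_pdivrMr// ler_pM2l ?divr_gt0//; lra.
  have h2 : 2 * K * fine (mu (bad n)) <= eps / 2.
    have fb : fine (mu (bad n)) <= e2 by rewrite -lee_fin fineK// ltW.
    rewrite (le_trans (ler_wpM2l _ fb)) ?mulr_ge0// /e2 mulrCA.
    rewrite mulrA -mulrA ger_pMr ?divr_gt0// ler_pdivrMr// mul1r; lra.
  lra.
move=> t x y /andP[t0 tT] xM yM xy.
have [tbad|tgood] := pselect (bad n t).
  rewrite indicE mem_set// mulr1 (le_trans (ler_normB _ _))//.
  have := gK t x xM; have := gK t y yM; have := ltW e10; lra.
rewrite indicE memNset// mulr0 addr0.
have Bt i j : B n i j t.
  apply: contrapT => Bt; apply: tgood; split; first by rewrite /= in_itv/= t0.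
  by move=> H; apply: Bt; exact: H.
have cg2 : `|g t (grid_round k x) - g t (grid_round k y)| @[k --> \oo] --> `|g t x - g t y|.
  apply: cvg_norm; apply: cvgB.
    by apply: (@cvg_comp _ _ _ (fun n => grid_round n x) (g t) _ (nbhs x));
      [exact: grid_round_cvg|exact: cg].
  by apply: (@cvg_comp _ _ _ (fun n => grid_round n y) (g t) _ (nbhs y));
    [exact: grid_round_cvg|exact: cg].
have grid_norm z : `|z| <= M -> \forall k \near \oo, `|grid_round k z| < M + 1.
  move=> zM; have zz : `|grid_round k z| @[k --> \oo] --> `|z|.
    exact: cvg_norm (@grid_round_cvg R z).
  have zM1 : `|z| < M + 1 by lra.
  exact: (cvgr_lt _ zz _ zM1).
apply: (le_of_cvg cg2).
have grid_dist : \forall k \near \oo, `|grid_round k x - grid_round k y| < n.+1%:R^-1.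
  have zz : `|grid_round k x - grid_round k y| @[k --> \oo] --> `|x - y|.
    exact: cvg_norm (cvgB (@grid_round_cvg R x) (@grid_round_cvg R y)).
  apply: (cvgr_lt _ zz); rewrite (le_lt_trans xy)// ltf_pV2 ?posrE ?mulr_gt0 ?ltr0n//.
  by rewrite ltr_pMl ?ltr0n// ltr1n.
near=> k; rewrite !ptE; apply: Bt; rewrite -!ptE; apply/and3P; split.
- by near: k; exact: grid_norm.
- by near: k; exact: grid_norm.
- by near: k.
Unshelve. all: by end_near. Qed.

End regularization.

Section nonlinearity.
Context {R : realType}.
Local Notation mu := (@lebesgue_measure R).
Variables (T : R) (g : R -> R -> R).
Hypothesis T0 : 0 < T.
Hypothesis mg : forall x, measurable_fun setT (g ^~ x).
Hypothesis cg : forall t, continuous (g t).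

Local Notation F t := (primitive0 (g t)).

Lemma bounded_mfun_comp (w : R -> R) (M K : R) : measurable_fun setT w ->
  (forall t, 0 <= t <= T -> `|w t| <= M) ->
  (forall t x, `|x| <= M -> `|g t x| <= K) -> bounded_mfun T (fun t => g t (w t)).
Proof.
move=> mw wM gK; split; last by exists K => t tT; apply: gK; exact: wM.
apply: measurable_funS (@measurableT _ _) _ _ => //.
exact: (@caratheodory_comp R _ _ g id w).
Qed.

Lemma primitive0_le (M K : R) : (forall t x, `|x| <= M -> `|g t x| <= K) ->
  forall t x, `|x| <= M -> `|F t x| <= K * `|x|.
Proof.
move=> gK t x xM; have [c [cx _]] := primitive0_mean 0 x (@cg t).
rewrite primitive0_0 !subr0 in cx * => ->; rewrite normrM ler_wpM2r//.
by apply: gK; exact: le_trans xM.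
Qed.

Lemma bounded_mfun_primitive (w : R -> R) (M K : R) : measurable_fun setT w ->
  (forall t, 0 <= t <= T -> `|w t| <= M) ->
  (forall t x, `|x| <= M -> `|g t x| <= K) ->
  bounded_mfun T (fun t => F t (w t)).
Proof.
move=> mw wM gK; split.
  apply: measurable_funS (@measurableT _ _) _ _ => //.
  apply: (@caratheodory_comp R _ _ (fun t => F t) id w) => //.
    by move=> x; exact: measurable_primitive0.
  by move=> t; exact: primitive0_continuous.
exists (K * M) => t tT; rewrite (le_trans (primitive0_le gK t (wM t tT)))//.
by rewrite ler_wpM2l ?wM// (le_trans _ (gK t (w t) (wM t tT))).
Qed.

(** Integrating the superlinearity inequality along rays: [s^-m F(s x)] is
nondecreasing in [s >= 1]. *)
Lemma primitive0_superhomogeneous (m r : R) :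
  (forall t x, r <= `|x| -> m * F t x <= x * g t x) ->
  forall t x s, r <= `|x| -> 1 <= s -> s `^ m * F t x <= F t (s * x).
Proof.
move=> ar t x s xr s1; pose k (y : R) := expR (- m * y) * F t (expR y * x).
have s0 : 0 < s by rewrite (lt_le_trans ltr01).
pose dk (y : R) := expR (- m * y) * (expR y * x * g t (expR y * x) - m * F t (expR y * x)).
have kd (y : R) : is_derive y (1:R) k (dk y).
  have h1 := @is_derive_primitive0 R (g t) (expR y * x) (@cg t).
  have h2 : is_derive y (1:R) (fun y : R => expR y * x) (expR y * x).
    apply: (is_derive_eq (is_deriveM (is_derive_expR y) (is_derive_cst x y (1:R)))).
    by rewrite scaler0 add0r /GRing.scale/= mulrC.
  have h3 : is_derive y (1:R) (fun y : R => expR (- m * y)) (- m * expR (- m * y)).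
    have h4 : is_derive y (1:R) (fun y : R => - m * y) (- m).
      apply: (is_derive_eq (is_deriveM (is_derive_cst (- m) y (1:R)) (is_derive_id y (1:R)))).
      by rewrite scaler0 addr0 /GRing.scale/= mulr1.
    apply: (is_derive_eq (is_derive1_comp (is_derive_expR _) h4)).
    by rewrite mulrC.
  have h5 := @is_derive1_comp _ (primitive0 (g t)) (fun y : R => expR y * x) y _ _ h1 h2.
  apply: (is_derive_eq (is_deriveM h3 h5)).
  by rewrite /dk /GRing.scale/=; ring.
have lns : 0 <= ln s by rewrite ln_ge0.
have K : k 0 <= k (ln s).
  have ck : {within `[0, ln s], continuous k}.
    apply: continuous_subspaceT => y; apply: differentiable_continuous.
    by apply/derivable1_diffP; exact: (@ex_derive _ _ _ _ _ _ _ (kd y)).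
  have [c] := @MVT_segment _ k dk 0 (ln s) lns (fun y _ => kd y) ck.
  rewrite in_itv/= => /andP[c0 _] kc; rewrite -subr_ge0 kc mulr_ge0 ?subr0//.
  rewrite mulr_ge0 ?expR_ge0// subr_ge0 ar//.
  rewrite normrM (le_trans xr)// ler_peMl// ger0_norm ?expR_ge0//.
  by rewrite -expR0 ler_expR.
move: K; rewrite /k mulr0 !expR0 !mul1r lnK ?posrE// => K.
rewrite /powR gt_eqF// (le_trans (ler_wpM2l (expR_ge0 _) K))//.
by rewrite mulrA -expRD mulNr subrr expR0 mul1r.
Qed.

End nonlinearity.

(** Locked, to keep unification from comparing the derivatives of two functions. *)
HB.lock Definition frac_derive {R : realType} (alpha : R) (w : R -> R) : R -> R :=
  left_RL_derivative alpha w.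

HB.lock Definition energy_norm {R : realType} (alpha T p : R) (w : R -> R) : R :=
  energy alpha T p w `^ p^-1.

Section energy_norm.
Context {R : realType}.
Local Notation mu := (@lebesgue_measure R).
Variables (alpha T p : R).
Hypothesis p1 : 1 < p.
Hypothesis ap : p^-1 < alpha.
Hypothesis a1 : alpha < 1.
Hypothesis T0 : 0 < T.

Local Notation D := (frac_derive alpha).
Local Notation C0 := (C0infty T).
Local Notation E := (energy alpha T p).

Let p0 : 0 < p. Proof. exact: lt_trans p1. Qed.

Let alpha01 : 0 < alpha < 1.
Proof. by rewrite a1 andbT (lt_trans _ ap)// invr_gt0. Qed.

Local Notation N := (energy_norm alpha T p).

Lemma energy_norm_ge0 w : 0 <= N w.
Proof. by rewrite energy_norm.unlock powR_ge0. Qed.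

Lemma energy_normX w : N w `^ p = E w.
Proof. by rewrite energy_norm.unlock -powRrM mulVf ?gt_eqF// powRr1// energy_ge0. Qed.

Lemma energy_norm_leE w (a : R) : 0 <= a -> (N w <= a) = (E w <= a `^ p).
Proof.
move=> a0; rewrite -energy_normX; apply/idP/idP => [Na|].
  by rewrite ge0_ler_powR ?nnegrE ?(ltW p0)// energy_norm_ge0.
rewrite leNgt => Na; rewrite leNgt; apply: contra Na => aN.
by rewrite gt0_ltr_powR ?nnegrE// energy_norm_ge0.
Qed.

Lemma C0inftyZ (a : R) w : C0 w -> C0 (a *: w).
Proof. by move=> Cw; rewrite -[_ *: _]add0r; apply: C0infty_lin => //; exact: C0infty0. Qed.

Lemma C0inftyB u w : C0 u -> C0 w -> C0 (u - w).
Proof. by move=> Cu Cw; rewrite -scaleN1r; exact: C0infty_lin. Qed.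

Lemma energy_normZ (a : R) w : C0 w -> N (a *: w) = `|a| * N w.
Proof.
move=> Cw; rewrite !energy_norm.unlock energyZ// powRM ?powR_ge0 ?energy_ge0//.
by rewrite -powRrM divff ?gt_eqF// powRr1.
Qed.

Lemma energy_norm0 : N 0 = 0.
Proof.
by have := energy_normZ 0 (C0infty0 (R := R) T); rewrite scale0r normr0 mul0r.
Qed.

Lemma energyE w : E w = \int[mu]_(t in `[0, T]) `|D w t| `^ p.
Proof. by rewrite energy.unlock frac_derive.unlock. Qed.

Lemma bounded_mfun_derive w : C0 w -> bounded_mfun T (D w).
Proof. by rewrite frac_derive.unlock; exact: (RLd_bounded_mfun p1 ap a1 T0). Qed.

Lemma integrable_derive_powR w : C0 w -> integrable_itv T (fun t => `|D w t| `^ p).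
Proof. by rewrite frac_derive.unlock; exact: (integrable_energy p1 ap a1 T0). Qed.

Lemma frac_derive_lin (a : R) u w t : C0 u -> C0 w -> 0 <= t <= T ->
  D (u + a *: w) t = D u t + a * D w t.
Proof. by rewrite frac_derive.unlock; exact: (RLd_lin alpha01 T0). Qed.

Lemma frac_deriveB u w t : C0 u -> C0 w -> 0 <= t <= T -> D (u - w) t = D u t - D w t.
Proof. by move=> Cu Cw tT; rewrite -scaleN1r frac_derive_lin// mulN1r. Qed.

Lemma frac_deriveZ (a : R) w t : C0 w -> 0 <= t <= T -> D (a *: w) t = a * D w t.
Proof.
move=> Cw tT; rewrite -[_ *: _]add0r frac_derive_lin//; last exact: C0infty0.
by rewrite frac_derive.unlock (RLd0 alpha01 T0 tT) add0r.
Qed.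

Lemma powR_norm_convex (a b u v : R) : 0 < a -> 0 < b ->
  `|u + v| `^ p <= a / (a + b) * `|(a + b) / a * u| `^ p +
                   b / (a + b) * `|(a + b) / b * v| `^ p.
Proof.
move=> a0 b0; have ab0 : 0 < a + b by rewrite addr_gt0.
have H (c z : R) := powR_convex_tangent p1 z c.
have := H (u + v) ((a + b) / a * u); have := H (u + v) ((a + b) / b * v).
set d := dualmap p (u + v); set X := `|_| `^ p; set Y := `|_| `^ p; set Z := `|_| `^ p.
move=> hv hu.
have la : 0 < a / (a + b) by rewrite divr_gt0.
have lb : 0 < b / (a + b) by rewrite divr_gt0.
have l1 : a / (a + b) + b / (a + b) = 1 by rewrite -mulrDl divff ?gt_eqF.
have hu' := ler_wpM2l (ltW la) hu; have hv' := ler_wpM2l (ltW lb) hv.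
have e0 : a / (a + b) * (p * (d * (u + v - (a + b) / a * u))) +
   b / (a + b) * (p * (d * (u + v - (a + b) / b * v))) = 0.
  by field; rewrite !gt_eqF.
have := lerD hu' hv'; rewrite e0 !mulrBr addrACA -mulrDl l1 mul1r; lra.
Qed.

Lemma energy_normD u w : C0 u -> C0 w -> N (u + w) <= N u + N w.
Proof.
move=> Cu Cw; have CD : C0 (u + w) by rewrite -[w]scale1r; exact: C0infty_lin.
apply/ler_addgt0Pr => e e0.
have [Nu Nw] := (energy_norm_ge0 u, energy_norm_ge0 w).
have [a aE] : exists a, a = N u + e / 2 by eexists.
have [b bE] : exists b, b = N w + e / 2 by eexists.
have e20 : 0 < e / 2 by rewrite divr_gt0.
have a0 : 0 < a by rewrite aE; exact: (ltr_wpDl Nu e20).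
have b0 : 0 < b by rewrite bE; exact: (ltr_wpDl Nw e20).
have -> : N u + N w + e = a + b by rewrite aE bE {1}(splitr e) addrACA.
have ab0 : 0 < a + b by rewrite addr_gt0.
rewrite energy_norm_leE ?(ltW ab0)//.
have Eu : E u <= a `^ p by rewrite -energy_norm_leE ?(ltW a0)// aE; move: (N u) => nu; lra.
have Ew : E w <= b `^ p by rewrite -energy_norm_leE ?(ltW b0)// bE; move: (N w) => nu; lra.
have iu := integrable_derive_powR Cu.
have iw := integrable_derive_powR Cw.
pose ca := a / (a + b) * ((a + b) / a) `^ p.
pose cb := b / (a + b) * ((a + b) / b) `^ p.
have H : E (u + w) <= ca * E u + cb * E w.
  rewrite !energyE -!integral_itvZ// -integral_itvD; last 2 first.
  - exact: integrable_itvZ.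
  - exact: integrable_itvZ.
  apply: integral_itv_le; first exact: integrable_derive_powR.
    by apply: integrable_itvD; exact: integrable_itvZ.
  move=> t tT; have -> : D (u + w) t = D u t + D w t.
    by have := frac_derive_lin 1 Cu Cw tT; rewrite scale1r mul1r.
  have sc c z : 0 < c -> `|(a + b) / c * z| `^ p = ((a + b) / c) `^ p * `|z| `^ p.
    move=> c0; have d0 := ltW (divr_gt0 ab0 c0).
    by rewrite normrM (ger0_norm d0) (powRM _ d0 (normr_ge0 _)).
  by rewrite (le_trans (powR_norm_convex _ _ a0 b0))// !sc// !mulrA.
have cE c : 0 < c -> c / (a + b) * ((a + b) / c) `^ p * c `^ p = c / (a + b) * (a + b) `^ p.
  move=> c0; rewrite -mulrA -powRM ?divr_ge0 ?(ltW ab0) ?(ltW c0)//.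
  by rewrite divfK ?gt_eqF.
rewrite (le_trans H)// (@le_trans _ _ (ca * a `^ p + cb * b `^ p))//.
  by rewrite lerD// ler_wpM2l// mulr_ge0 ?powR_ge0// divr_ge0 ?ltW.
by rewrite !cE// -mulrDl -mulrDl divff ?gt_eqF// mul1r.
Qed.

Lemma energy_normB u w : C0 u -> C0 w -> N (u - w) <= N u + N w.
Proof.
move=> Cu Cw; rewrite -scaleN1r (le_trans (energy_normD _ _))//.
  exact: C0inftyZ.
by rewrite energy_normZ// normrN1 mul1r.
Qed.

End energy_norm.

Section functional.
Context {R : realType}.
Local Notation mu := (@lebesgue_measure R).
Variables (alpha T p C q c0 : R) (g : R -> R -> R).
Hypothesis p1 : 1 < p.
Hypothesis ap : p^-1 < alpha.
Hypothesis a1 : alpha < 1.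
Hypothesis T0 : 0 < T.
Hypothesis C0 : 0 < C.
Hypothesis q1 : 1 <= q.
Hypothesis c00 : 0 < c0.

Local Notation D := (frac_derive alpha).
Local Notation S := (C0infty T).
Local Notation E := (energy alpha T p).
Local Notation N := (energy_norm alpha T p).
Local Notation F t := (primitive0 (g t)).

Hypothesis sup_le : forall w t, S w -> 0 <= t <= T -> `|w t| <= c0 * N w.
Hypothesis mg : forall x, measurable_fun setT (g ^~ x).
Hypothesis cg : forall t, continuous (g t).
Hypothesis g_growth : forall t x, `|g t x| <= C * (1 + `|x| `^ (q - 1)).

Let p0 : 0 < p. Proof. exact: lt_trans p1. Qed.
Let alpha01 : 0 < alpha < 1.
Proof. by rewrite a1 andbT (lt_trans _ ap)// invr_gt0. Qed.
Let T0' : 0 <= T. Proof. exact: ltW. Qed.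

Definition action (w : R -> R) : R :=
  E w / p - \int[mu]_(t in `[0, T]) F t (w t).

Definition daction (x e : R -> R) : R :=
  \int[mu]_(t in `[0, T]) (dualmap p (D x t) * D e t) -
  \int[mu]_(t in `[0, T]) (g t (x t) * e t).

Lemma growth_bounded (M : R) :
  exists2 K, 0 <= K & forall t x, `|x| <= M -> `|g t x| <= K.
Proof.
exists (C * (1 + `|M| `^ (q - 1))).
  by rewrite mulr_ge0 ?(ltW C0)// addr_ge0// powR_ge0.
move=> t x xM; rewrite (le_trans (g_growth t x))// ler_wpM2l ?(ltW C0)// lerD2l.
by rewrite ge0_ler_powR ?nnegrE ?subr_ge0// (le_trans xM)// ler_norm.
Qed.

Lemma C0infty_measurable w : S w -> measurable_fun setT w.
Proof. by move=> Sw; apply: continuous_measurable_fun; exact: C0infty_continuous Sw. Qed.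

Lemma bounded_mfun_nonlinearity w : S w -> bounded_mfun T (fun t => g t (w t)).
Proof.
move=> Sw; have [K _ gK] := growth_bounded (c0 * N w).
apply: (@bounded_mfun_comp _ T g mg cg w (c0 * N w) K) => //.
  exact: C0infty_measurable.
by move=> t tT; exact: sup_le.
Qed.

Lemma bounded_mfun_potential w : S w -> bounded_mfun T (fun t => F t (w t)).
Proof.
move=> Sw; have [K _ gK] := growth_bounded (c0 * N w).
apply: (@bounded_mfun_primitive _ T g mg cg w (c0 * N w) K) => //.
  exact: C0infty_measurable.
by move=> t tT; exact: sup_le.
Qed.

Let bD w : S w -> bounded_mfun T (D w).
Proof. exact: (bounded_mfun_derive p1 ap a1 T0). Qed.

Let bdD w : S w -> bounded_mfun T (fun t => dualmap p (D w t)).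
Proof. by move=> Sw; apply: bounded_mfun_dualmap => //; exact: bD. Qed.

Lemma integrable_dual_pair x e : S x -> S e ->
  integrable_itv T (fun t => dualmap p (D x t) * D e t).
Proof.
move=> Sx Se; apply: bounded_mfun_integrable.
by apply: bounded_mfunM; [exact: bdD|exact: bD].
Qed.

Lemma integrable_nonlinear_pair x e : S x -> S e ->
  integrable_itv T (fun t => g t (x t) * e t).
Proof.
move=> Sx Se; apply: bounded_mfun_integrable; apply: bounded_mfunM.
  exact: bounded_mfun_nonlinearity.
exact: C0infty_bounded_mfun.
Qed.

Lemma dactionZ (a : R) x e : S x -> S e -> daction x (a *: e) = a * daction x e.
Proof.
move=> Sx Se; rewrite /daction mulrBr -!integral_itvZ//; last 2 first.
- exact: integrable_nonlinear_pair.
- exact: integrable_dual_pair.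
congr (_ - _); apply: integral_itv_eq => t tT.
  by rewrite (frac_deriveZ p1 ap a1 T0)//; ring.
by rewrite mulrCA.
Qed.

Lemma energy_tangent x y : S x -> S y ->
  E y - E x <= p * \int[mu]_(t in `[0, T]) (dualmap p (D y t) * D (y - x) t).
Proof.
move=> Sx Sy; have Syx := C0inftyB Sy Sx.
have [ix iy] := (integrable_derive_powR p1 ap a1 T0 Sx, integrable_derive_powR p1 ap a1 T0 Sy).
rewrite !energyE -integral_itvB// -integral_itvZ; last exact: integrable_dual_pair.
apply: integral_itv_le.
- exact: integrable_itvB.
- by apply: integrable_itvZ; exact: integrable_dual_pair.
- move=> t tT; rewrite (frac_deriveB p1 ap a1 T0)//; exact: powR_convex_tangent.
Qed.

Lemma dual_pair_continuity (M eps : R) : 0 < M -> 0 < eps ->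
  exists2 r, 0 < r & forall x y e, S x -> S y -> S e ->
    N x <= M -> N (y - x) <= r -> N e <= 1 ->
    \int[mu]_(t in `[0, T]) `|(dualmap p (D y t) - dualmap p (D x t)) * D e t| <= eps.
Proof.
move=> M0 e0; pose A := 2 * (M + 1) `^ p + 1.
have A0 : 0 < A by rewrite ltr_wpDl// mulr_ge0// powR_ge0.
have [K K0 HK] := @dualmap_continuityM _ _ p1 (eps / 2 / A) (divr_gt0 (divr_gt0 e0 (ltr0Sn _ 1)) A0).
pose r := Num.min 1 ((eps / 2 / K) `^ p^-1).
have r0 : 0 < r by rewrite lt_min ltr01 powR_gt0// !divr_gt0.
exists r => // x y e Sx Sy Se xM yx e1.
have Syx := C0inftyB Sy Sx.
have ix w Sw := @integrable_derive_powR _ _ _ _ p1 ap a1 T0 w Sw.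
have M1 : 0 <= M + 1 by rewrite addr_ge0// ltW.
have Ex : E x <= (M + 1) `^ p by rewrite -energy_norm_leE// (le_trans xM)// lerDl.
have Ey : E y <= (M + 1) `^ p.
  rewrite -energy_norm_leE// -[y](subrK x) addrC.
  rewrite (le_trans (energy_normD p1 ap a1 T0 _ _))// lerD// (le_trans yx)//.
  by rewrite ge_min lexx.
have Ee : E e <= 1 by move: e1; rewrite energy_norm_leE// powR1.
have Eyx : K * E (y - x) <= eps / 2.
  rewrite mulrC -ler_pdivlMr//.
  have : E (y - x) <= ((eps / 2 / K) `^ p^-1) `^ p.
    by rewrite -energy_norm_leE ?powR_ge0// (le_trans yx)// ge_min lexx orbT.
  by rewrite -powRrM mulVf ?gt_eqF// powRr1// ltW// !divr_gt0.
apply: (@le_trans _ _ (eps / 2 / A * (E y + E x + E e) + K * E (y - x))).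
  have i1 : integrable_itv T (fun t => `|D y t| `^ p + `|D x t| `^ p).
    by apply: integrable_itvD; exact: ix.
  have i2 : integrable_itv T (fun t => `|D y t| `^ p + `|D x t| `^ p + `|D e t| `^ p).
    by apply: integrable_itvD => //; exact: ix.
  have i3 := integrable_itvZ (eps / 2 / A) i2.
  have i4 := integrable_itvZ K (ix _ Syx).
  rewrite !energyE -(integral_itvD (ix _ Sy) (ix _ Sx)) -(integral_itvD i1 (ix _ Se)).
  rewrite -(integral_itvZ _ i2) -(integral_itvZ K (ix _ Syx)) -(integral_itvD i3 i4).
  apply: integral_itv_le.
  - apply: integrable_itv_norm; apply: bounded_mfun_integrable.
    apply: bounded_mfunM; last exact: bD.
    by apply: bounded_mfunB; exact: bdD.
  - exact: integrable_itvD.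
  - by move=> t tT; rewrite normrM (frac_deriveB p1 ap a1 T0)//; exact: HK.
rewrite [leRHS](splitr eps) lerD// -[leRHS](divfK (lt0r_neq0 A0)).
by rewrite ler_wpM2l ?divr_ge0 ?(ltW e0) ?(ltW A0)// /A; lra.
Qed.

Lemma potential_continuity (M eps : R) : 0 < M -> 0 < eps ->
  exists2 r, 0 < r & forall x z e h, S x -> S z -> S e ->
    N x <= M -> N (z - x) <= r -> N e <= 1 -> 0 <= h <= r ->
    \int[mu]_(t in `[0, T]) F t (z t) - \int[mu]_(t in `[0, T]) F t ((z + h *: e) t) <=
    h * (eps - \int[mu]_(t in `[0, T]) (g t (x t) * e t)).
Proof.
move=> M0 e0; pose M' := c0 * (M + 2).
have [K K0 gK] := growth_bounded M'.
have [d d0 [om [bom om_eps] gom]] :=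
  caratheodory_modulus T0' K0 (divr_gt0 e0 c00) mg cg gK.
pose r := Num.min 1 (d / (2 * c0)).
have r0 : 0 < r by rewrite lt_min ltr01 divr_gt0// mulr_gt0.
have r1 : r <= 1 by rewrite ge_min lexx.
have rd : 2 * c0 * r <= d.
  by rewrite mulrC -ler_pdivlMr ?mulr_gt0// ge_min lexx orbT.
have ar1 (c x z : R) : `|c - z| <= c0 * r -> `|z - x| <= c0 * r -> `|c - x| <= 2 * c0 * r.
  move=> h1 h2; rewrite (_ : c - x = (c - z) + (z - x)); last by ring.
  by rewrite (le_trans (ler_normD _ _))//; move: (lerD h1 h2); lra.
have ar2 (c x : R) : `|x| <= c0 * M -> `|c - x| <= 2 * c0 * r -> `|c| <= M'.
  move=> h1 h2; rewrite -[c](subrK x) (le_trans (ler_normD _ _))//.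
  rewrite (le_trans (lerD h2 h1))// /M'.
  have : c0 * r <= c0 * 1 by rewrite ler_pM2l.
  by lra.
have ar3 (g1 g2 e o : R) : `|g1 - g2| <= o -> `|e| <= c0 -> 0 <= o ->
    - (g1 * e) <= c0 * o - g2 * e.
  move=> h1 h2 o0; have : `|(g2 - g1) * e| <= o * c0 by rewrite normrM ler_pM// distrC.
  by rewrite ler_norml => /andP[_]; lra.
have ar4 : c0 * M <= M' by rewrite ler_pM2l//; lra.
exists r => // x z e h Sx Sz Se xM zx e1 /andP[h0 hr].
have Szx := C0inftyB Sz Sx; have Szh := C0infty_lin h Sz Se.
have iz := bounded_mfun_integrable (bounded_mfun_potential Sz).
have izh := bounded_mfun_integrable (bounded_mfun_potential Szh).
have ige := integrable_nonlinear_pair Sx Se.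
have iom := bounded_mfun_integrable bom.
have i1 := integrable_itvB (integrable_itvZ c0 iom) ige.
rewrite -integral_itvB//.
apply: (@le_trans _ _ (\int[mu]_(t in `[0, T]) (h * (c0 * om t - g t (x t) * e t)))).
  apply: integral_itv_le.
  - exact: integrable_itvB.
  - exact: integrable_itvZ.
  move=> t tT.
  have [c [cz _ cE]] := primitive0_mean (z t) ((z + h *: e) t) (@cg t).
  have zhE : (z + h *: e) t = z t + h * e t by [].
  rewrite zhE addrAC subrr add0r in cz cE; rewrite zhE.
  have et : `|e t| <= c0.
    by rewrite (le_trans (sup_le Se tT))// ger_pMr.
  have xt : `|x t| <= c0 * M by rewrite (le_trans (sup_le Sx tT))// ler_pM2l.
  have zxt : `|z t - x t| <= c0 * r.
    by rewrite (le_trans (sup_le Szx tT))// ler_pM2l.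
  have het : `|h * e t| <= c0 * r.
    by rewrite normrM mulrC (ger0_norm h0) ler_pM.
  have cxt : `|c - x t| <= 2 * c0 * r.
    exact: ar1 (le_trans cz het) zxt.
  have xM' : `|x t| <= M' by exact: le_trans ar4.
  have cM' : `|c| <= M' by exact: ar2 xt cxt.
  rewrite -[leLHS]opprB cE.
  have go := gom t c (x t) tT cM' xM' (le_trans cxt rd).
  have om0 : 0 <= om t.
    by rewrite (le_trans _ (gom t (x t) (x t) tT xM' xM' _))// subrr normr0 ltW.
  have key := ar3 _ _ _ _ go et om0.
  by rewrite mulrCA -mulrN ler_wpM2l.
rewrite integral_itvZ// ler_wpM2l// integral_itvB//; last exact: integrable_itvZ.
rewrite lerB// integral_itvZ// mulrC -ler_pdivlMr//.
Qed.

(** The functional is Gateaux differentiable with derivative [daction],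
uniformly in a neighbourhood of the base point and on bounded sets. *)
Lemma action_strict_derivative (M eps : R) : 0 < M -> 0 < eps ->
  exists2 r, 0 < r & forall x z e h, S x -> S z -> S e ->
    N x <= M -> N (z - x) <= r -> N e <= 1 -> 0 <= h <= r ->
    action (z + h *: e) <= action z + h * (daction x e + eps).
Proof.
move=> M0 e0; have e20 : 0 < eps / 2 by rewrite divr_gt0.
have [r1 r10 H1] := dual_pair_continuity M0 e20.
have [r2 r20 H2] := potential_continuity M0 e20.
pose r := Num.min (r1 / 2) r2.
have r0 : 0 < r by rewrite lt_min r20 divr_gt0.
have rr1 : r <= r1 / 2 by rewrite ge_min lexx.
have rr2 : r <= r2 by rewrite ge_min lexx orbT.
have ar1 h : h <= r -> r + h * 1 <= r1 by lra.
have ar2 (E1 E2 Q1 Q2 Q3 Q4 h : R) : E1 - E2 <= h * (Q3 + eps / 2) ->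
    Q1 - Q2 <= h * (eps / 2 - Q4) -> E1 - Q2 <= E2 - Q1 + h * (Q3 - Q4 + eps) by lra.
exists r => // x z e h Sx Sz Se xM zx e1 /andP[h0 hr].
have Szh := C0infty_lin h Sz Se.
have {H2} h2 : \int[mu]_(t in `[0, T]) F t (z t) -
    \int[mu]_(t in `[0, T]) F t ((z + h *: e) t) <=
    h * (eps / 2 - \int[mu]_(t in `[0, T]) (g t (x t) * e t)).
  by apply: H2 => //; [exact: le_trans zx rr2|rewrite h0 (le_trans hr)].
have Nzh : N (z + h *: e - x) <= r1.
  rewrite addrAC (le_trans (energy_normD p1 ap a1 T0 _ _))//.
  - exact: C0inftyB.
  - exact: C0inftyZ.
  rewrite (energy_normZ p1 ap a1 T0)// (ger0_norm h0).
  have hNe : h * N e <= h * 1 by rewrite ler_wpM2l.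
  by rewrite (le_trans (lerD zx hNe))// ar1.
have {}H1 := H1 x (z + h *: e) e Sx Szh Se xM Nzh e1.
have tg := energy_tangent Sz Szh.
rewrite (_ : z + h *: e - z = h *: e) in tg; last by rewrite addrAC subrr add0r.
have h1 : \int[mu]_(t in `[0, T]) (dualmap p (D (z + h *: e) t) * D (h *: e) t) <=
    h * (\int[mu]_(t in `[0, T]) (dualmap p (D x t) * D e t) + eps / 2).
  have -> : \int[mu]_(t in `[0, T]) (dualmap p (D (z + h *: e) t) * D (h *: e) t) =
      h * \int[mu]_(t in `[0, T]) (dualmap p (D (z + h *: e) t) * D e t).
    rewrite -integral_itvZ; last exact: integrable_dual_pair.
    by apply: integral_itv_eq => t tT; rewrite (frac_deriveZ p1 ap a1 T0)// mulrCA.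
  rewrite ler_wpM2l// -lerBlDl -integral_itvB; last 2 first.
  - exact: integrable_dual_pair.
  - exact: integrable_dual_pair.
  apply: le_trans H1; have i := integrable_itvB (integrable_dual_pair Szh Se)
    (integrable_dual_pair Sx Se).
  apply: le_trans (ler_norm _) _; apply: le_trans (integral_itv_norm i) _.
  apply: integral_itv_le; rewrite ?(integrable_itv_norm i)//.
    exact: integrable_itv_norm.
  - apply: integrable_itv_norm; apply: bounded_mfun_integrable.
    apply: bounded_mfunM; last exact: bD.
    by apply: bounded_mfunB; exact: bdD.
  - by move=> t _; rewrite mulrBl.
have {tg h1} h1 : (E (z + h *: e) - E z) / p <=
    h * (\int[mu]_(t in `[0, T]) (dualmap p (D x t) * D e t) + eps / 2).
  by rewrite ler_pdivrMr// mulrC (le_trans tg)// ler_pM2l.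
by rewrite /action /daction; apply: ar2 h2; rewrite -mulrBl.
Qed.

Lemma action_uniform_continuity (M eps : R) : 0 < M -> 0 < eps ->
  exists2 r, 0 < r & forall x z, S x -> S z ->
    N x <= M -> N (z - x) <= r -> action z - action x <= eps.
Proof.
move=> M0 e0; pose A := (M + 1) `^ p + 1.
have A0 : 0 < A by rewrite ltr_wpDl// powR_ge0.
have M1 : 0 <= M + 1 by rewrite addr_ge0// ltW.
have e30 : 0 < eps / 3 by rewrite divr_gt0.
have [B B0 HB] := young_weightl p1 (divr_gt0 e30 A0).
have [K K0 gK] := growth_bounded (c0 * (M + 1)).
have KT : 0 < (K + 1) * c0 * (T + 1) by rewrite !mulr_gt0// ltr_wpDl.
pose r := Num.min 1 (Num.min ((eps / 3 / B) `^ p^-1) (eps / 3 / ((K + 1) * c0 * (T + 1)))).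
have r0 : 0 < r by rewrite !lt_min ltr01 powR_gt0 ?divr_gt0.
have r1 : r <= 1 by rewrite ge_min lexx.
have r2 : r <= (eps / 3 / B) `^ p^-1 by rewrite !ge_min lexx orbT.
have r3 : r * ((K + 1) * c0 * (T + 1)) <= eps / 3.
  by rewrite -ler_pdivlMr// !ge_min lexx !orbT.
have ar1 : c0 * M <= c0 * (M + 1) by rewrite ler_pM2l//; lra.
have ar2 (a b c m : R) : `|a| <= m -> `|b| <= m -> Num.min a b <= c <= Num.max a b ->
    `|c| <= m.
  rewrite !ler_norml ge_min le_max.
  by move=> /andP[h3 h4] /andP[h5 h6] /andP[/orP[h1|h1] /orP[h2|h2]]; apply/andP; split; lra.
have ar3 : T * (K * (c0 * r)) <= r * ((K + 1) * c0 * (T + 1)).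
  have h1 : T <= T + 1 by lra.
  have h2 : K <= K + 1 by lra.
  have h3 : T * (K * c0) <= (T + 1) * ((K + 1) * c0).
    by rewrite ler_pM// ?mulr_ge0 ?ler_pM2r// ltW.
  by have := ler_wpM2l (ltW r0) h3; lra.
have ar4 (E1 E2 Q1 Q2 : R) : E1 - E2 <= eps / 3 + eps / 3 -> Q1 - Q2 <= eps / 3 ->
    E1 - Q2 - (E2 - Q1) <= eps by lra.
exists r => // x z Sx Sz xM zx; have Szx := C0inftyB Sz Sx.
have ix w Sw := @integrable_derive_powR _ _ _ _ p1 ap a1 T0 w Sw.
have Nz : N z <= M + 1.
  rewrite -[z](subrK x) addrC (le_trans (energy_normD p1 ap a1 T0 _ _))// lerD//.
  exact: le_trans r1.
have Ez : E z <= (M + 1) `^ p by rewrite -energy_norm_leE.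
have Ezx : B * E (z - x) <= eps / 3.
  rewrite mulrC -ler_pdivlMr//.
  have : E (z - x) <= ((eps / 3 / B) `^ p^-1) `^ p.
    by rewrite -energy_norm_leE ?powR_ge0// (le_trans zx).
  by rewrite -powRrM mulVf ?gt_eqF// powRr1// ltW// divr_gt0.
have i4 := integrable_itvZ B (ix _ Szx).
have i3 := integrable_itvZ (eps / 3 / A) (ix _ Sz).
have hE : (E z - E x) / p <= eps / 3 + eps / 3.
  rewrite ler_pdivrMr// mulrC (le_trans (energy_tangent Sx Sz))// ler_pM2l//.
  apply: (@le_trans _ _ (eps / 3 / A * E z + B * E (z - x))).
    rewrite !energyE -(integral_itvZ _ (ix _ Sz)) -(integral_itvZ _ (ix _ Szx)).
    rewrite -(integral_itvD i3 i4); apply: integral_itv_le.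
    - exact: integrable_dual_pair.
    - exact: integrable_itvD.
    move=> t tT; rewrite (le_trans (ler_norm _))// normrM normr_dualmap//.
    exact: HB.
  rewrite lerD// -[leRHS](divfK (lt0r_neq0 A0)) ler_wpM2l ?(ltW (divr_gt0 e30 A0))//.
  by rewrite (le_trans Ez)// /A lerDl.
have iz := bounded_mfun_integrable (bounded_mfun_potential Sz).
have ixx := bounded_mfun_integrable (bounded_mfun_potential Sx).
have hF : \int[mu]_(t in `[0, T]) F t (x t) - \int[mu]_(t in `[0, T]) F t (z t) <= eps / 3.
  rewrite -integral_itvB//; apply: le_trans r3.
  apply: (@le_trans _ _ (\int[mu]_(t in `[0, T]) (K * (c0 * r)))).
    apply: integral_itv_le.
    - exact: integrable_itvB.
    - exact/bounded_mfun_integrable/bounded_mfun_cst.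
    move=> t tT; have [c [_ cxz cE]] := primitive0_mean (z t) (x t) (@cg t).
    rewrite cE (le_trans (ler_norm _))// normrM.
    have xt : `|x t| <= c0 * (M + 1).
      rewrite (le_trans (sup_le Sx tT))// (le_trans _ ar1)// ler_pM2l//.
    have zt : `|z t| <= c0 * (M + 1) by rewrite (le_trans (sup_le Sz tT))// ler_pM2l.
    rewrite ler_pM//; first by apply: gK; exact: (ar2 _ _ _ _ zt xt).
    by rewrite distrC (le_trans (sup_le Szx tT))// ler_pM2l.
  by rewrite integral_itv_cst// mulrC.
by rewrite /action; apply: ar4 hF; rewrite -mulrBl.
Qed.

End functional.

Lemma powRVK {R : realType} (x a : R) : 0 <= x -> a != 0 -> (x `^ a^-1) `^ a = x.
Proof. by move=> x0 a0; rewrite -powRrM mulVf// powRr1. Qed.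

Lemma integral_itv_eq0 {R : realType} (T : R) (h : R -> R) : integrable_itv T h ->
  (forall t, 0 <= t <= T -> 0 <= h t) ->
  \int[@lebesgue_measure R]_(t in `[0, T]) h t = 0 ->
  exists2 N : set (measurableTypeR R), measurable N /\ @lebesgue_measure R N = 0%E &
    forall t, 0 <= t <= T -> ~ N t -> h t = 0.
Proof.
move=> ih h0 hi.
have mI : measurable (`[0, T]%classic : set (measurableTypeR R)) by exact: measurable_itv.
have mh : measurable_fun (`[0, T]%classic : set (measurableTypeR R)) (EFin \o h).
  by case/integrableP: ih.
have := integrable_itv_fin (integrable_itv_norm ih).
rewrite (@integral_itv_eq _ _ (fun t => `|h t|) h) ?hi; last first.
  by move=> t /h0 ht; rewrite ger0_norm.
move=> /(ae_eq_integral_abs (@lebesgue_measure R) mI mh) [N [mN N0 HN]].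
exists N => // t tT Nt; apply: contrapT => ht; apply: Nt; apply: HN => /= H.
by apply: ht; have := H; rewrite in_itv/= => /(_ tT) [].
Qed.

Section geometry.
Context {R : realType}.
Local Notation mu := (@lebesgue_measure R).
Variables (alpha T p C q c0 : R) (g : R -> R -> R).
Hypothesis p1 : 1 < p.
Hypothesis ap : p^-1 < alpha.
Hypothesis a1 : alpha < 1.
Hypothesis T0 : 0 < T.
Hypothesis C0 : 0 < C.
Hypothesis q1 : 1 <= q.
Hypothesis c00 : 0 < c0.

Local Notation D := (frac_derive alpha).
Local Notation S := (C0infty T).
Local Notation E := (energy alpha T p).
Local Notation N := (energy_norm alpha T p).
Local Notation F t := (primitive0 (g t)).
Local Notation Phi := (action alpha T p g).
Local Notation dPhi := (daction alpha T p g).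

Hypothesis sup_le : forall w t, S w -> 0 <= t <= T -> `|w t| <= c0 * N w.
Hypothesis mg : forall x, measurable_fun setT (g ^~ x).
Hypothesis cg : forall t, continuous (g t).
Hypothesis g_growth : forall t x, `|g t x| <= C * (1 + `|x| `^ (q - 1)).

Variables (m r eps delta : R) (Nul : set (measurableTypeR R)).
Hypothesis pm : p < m.
Hypothesis r0 : 0 < r.
Hypothesis e0 : 0 < eps.
Hypothesis delta0 : 0 < delta.
Hypothesis eps_small : eps * c0 `^ p * T * (2 * p) <= 1.
Hypothesis g_small : forall t x, 0 < `|x| < delta -> `|g t x| <= eps * `|x| `^ (p - 1).
Hypothesis g_AR : forall t x, r <= `|x| -> 0 <= m * F t x <= x * g t x.
Hypothesis mNul : measurable Nul.
Hypothesis Nul0 : mu Nul = 0%E.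
Hypothesis F_pos : forall t x, 0 <= t <= T -> ~ Nul t -> r <= `|x| -> 0 < F t x.

Let p0 : 0 < p. Proof. exact: lt_trans p1. Qed.
Let m0 : 0 < m. Proof. exact: lt_trans pm. Qed.
Let T0' : 0 <= T. Proof. exact: ltW. Qed.

Lemma nonlinearity_vanishes t : g t 0 = 0.
Proof.
apply/eqP; rewrite -normr_eq0 eq_le normr_ge0 andbT; apply/ler_addgt0Pr => k k0.
rewrite add0r; have k20 : 0 < k / 2 by rewrite divr_gt0.
have /cvgrPdist_le/(_ _ k20) := @cg t 0.
move=> [d /= d0 Hd].
have e10 : 0 < eps + 1 by rewrite addr_gt0.
have kp0 : 0 < k / 2 / (eps + 1) by rewrite divr_gt0.
pose y := Num.min (d / 2) (Num.min (delta / 2) ((k / 2 / (eps + 1)) `^ (p - 1)^-1)).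
have y0 : 0 < y by rewrite !lt_min !divr_gt0// powR_gt0.
have y1 : y <= d / 2 by rewrite ge_min lexx.
have y2 : y <= delta / 2 by rewrite !ge_min lexx orbT.
have y3 : y <= (k / 2 / (eps + 1)) `^ (p - 1)^-1 by rewrite !ge_min lexx !orbT.
have pm1 : 0 < p - 1 by rewrite subr_gt0.
have h1 : `|g t 0 - g t y| <= k / 2.
  by apply: Hd; rewrite /= sub0r normrN gtr0_norm//; lra.
have h2 : `|g t y| <= k / 2.
  have gy : `|g t y| <= eps * `|y| `^ (p - 1).
    by apply: g_small; rewrite gtr0_norm// y0/=; lra.
  rewrite (le_trans gy)// gtr0_norm//.
  have yp : y `^ (p - 1) <= k / 2 / (eps + 1).
    rewrite -(powRVK (ltW kp0) (lt0r_neq0 pm1)).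
    by rewrite ge0_ler_powR ?nnegrE ?powR_ge0 ?(ltW pm1) ?(ltW y0).
  rewrite (le_trans (ler_wpM2l (ltW e0) yp))// mulrCA ger_pMr//.
  by rewrite ler_pdivrMr// mul1r lerDl.
rewrite -[g t 0](subrK (g t y)) (le_trans (ler_normD _ _))//; lra.
Qed.

Lemma potential_small t x : `|x| < delta -> `|F t x| <= eps * `|x| `^ p.
Proof.
move=> xd.
have [c [cx _]] := primitive0_mean 0 x (@cg t).
rewrite primitive0_0 !subr0 in cx * => ->.
rewrite normrM -(powR_subr1M p1 (normr_ge0 x)) mulrA ler_wpM2r//.
have [->|c_neq0] := eqVneq c 0.
  by rewrite nonlinearity_vanishes normr0 mulr_ge0 ?powR_ge0 ?(ltW e0).
rewrite (le_trans (g_small t _))//.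
  by rewrite normr_gt0 c_neq0 (le_lt_trans cx).
by rewrite ler_wpM2l ?(ltW e0)// ge0_ler_powR ?nnegrE// subr_ge0 ltW.
Qed.

Lemma action_ring : exists2 rho, 0 < rho & exists2 kappa, 0 < kappa &
  forall x, S x -> rho <= 2 * N x <= 2 * rho -> kappa <= Phi x.
Proof.
pose rho := delta / (2 * c0).
have rho0 : 0 < rho by rewrite divr_gt0// mulr_gt0.
exists rho => //; exists ((rho / 2) `^ p / (2 * p)).
  by rewrite divr_gt0 ?powR_gt0 ?divr_gt0// mulr_gt0.
have ar1 (n : R) : 2 * n <= 2 * rho -> c0 * n < delta.
  move=> h; have : n <= rho by lra.
  rewrite -(ler_pM2l c00) => /le_lt_trans; apply.
  have -> : c0 * rho = delta / 2 by rewrite /rho; field; rewrite gt_eqF.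
  by rewrite ltr_pdivrMr// ltr_pMr// ltr1n.
have ar2 (n : R) : rho <= 2 * n -> rho / 2 <= n by lra.
have ar3 (e Q : R) : 0 <= e -> Q <= eps * c0 `^ p * e * T -> e / (2 * p) <= e / p - Q.
  move=> ee QQ; have h : eps * c0 `^ p * T <= (2 * p)^-1.
    by rewrite -[leRHS]mul1r ler_pdivlMr// mulr_gt0.
  have h' := ler_wpM2l ee h.
  have -> : e / (2 * p) = e / p - e * (2 * p)^-1.
    by field; rewrite gt_eqF.
  by rewrite lerB// (le_trans QQ)// (le_trans _ h')// -!mulrA (mulrCA e) (mulrCA e).
move=> x Sx /andP[Nx1 Nx2].
have N1 : rho / 2 <= N x by exact: ar2.
have NE := energy_normX alpha T p1 x.
have N0' := energy_norm_ge0 alpha T p x.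
apply: (@le_trans _ _ (E x / (2 * p))).
  rewrite ler_pM2r ?invr_gt0 ?mulr_gt0// -NE ge0_ler_powR ?nnegrE ?(ltW p0)//.
  by rewrite divr_ge0// ltW.
apply: ar3; first exact: energy_ge0.
have bF := bounded_mfun_potential C0 q1 sup_le mg cg g_growth Sx.
rewrite -integral_itv_cst//; apply: integral_itv_le.
- exact: bounded_mfun_integrable.
- exact/bounded_mfun_integrable/bounded_mfun_cst.
move=> t tT; have xt := sup_le Sx tT.
rewrite (le_trans (ler_norm _))// (le_trans (potential_small _ _))//.
  by rewrite (le_lt_trans xt)// ar1.
rewrite -mulrA ler_wpM2l ?(ltW e0)// -NE -powRM ?(ltW c00)//.
by rewrite ge0_ler_powR ?nnegrE ?(ltW p0)// mulr_ge0// ltW.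
Qed.

(** Ambrosetti-Rabinowitz inequality and lower bound of the potential, without
restriction on the argument but up to a constant. *)
Lemma superlinear_bounds : exists2 K, 0 <= K & forall t x,
  - K <= F t x /\ m * F t x - K <= x * g t x.
Proof.
have [K0 K00 gK] := growth_bounded C0 q1 g_growth r.
pose K := (m + 1) * (K0 * r).
have K0r : 0 <= K0 * r by rewrite mulr_ge0// ltW.
have K_ge0 : 0 <= K by rewrite mulr_ge0// addr_ge0// ltW.
exists K => // t x; have [xr|rx] := leP `|x| r; last first.
  have /andP[h1 h2] := g_AR t (ltW rx).
  by split; [rewrite pmulr_rge0// in h1; lra|lra].
have h1 : `|F t x| <= K0 * r.
  by rewrite (le_trans (primitive0_le cg gK t xr))// ler_wpM2l.
have h2 : `|x * g t x| <= K0 * r by rewrite normrM mulrC ler_pM// gK.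
move: h1 h2; rewrite /K !ler_norml => /andP[h1 h2] /andP[h3 h4].
have h5 := ler_wpM2l (ltW m0) h2; have h6 : 0 <= m * (K0 * r) by rewrite mulr_ge0// ltW.
by split; lra.
Qed.

Lemma action_ray : exists2 e, S e /\ 0 < N e & exists cbar,
  forall s, 0 <= s -> Phi (s *: e) <= cbar.
Proof.
have [b [c c_gt0 [Sb bc]]] := C0infty_bump T0.
pose e := (r / c) *: b; have Se : S e by exact: C0inftyZ.
have er t : 3 * T <= 8 * t <= 5 * T -> r <= `|e t|.
  move=> tA; rewrite (_ : e t = r / c * b t)// normrM gtr0_norm ?divr_gt0//.
  by rewrite -mulrA ler_peMr ?(ltW r0)// mulrC ler_pdivlMr// mul1r (le_trans (bc t tA))// ler_norm.
pose A : set (measurableTypeR R) := `[3 * T / 8, 5 * T / 8]%classic.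
have mA : measurable A by exact: measurable_itv.
have AT t : A t -> 0 <= t <= T.
  by rewrite /A/= in_itv/= => /andP[h1 h2]; apply/andP; split; move: T0'; lra.
have Ae t : A t -> r <= `|e t|.
  by rewrite /A/= in_itv/= => /andP[h1 h2]; apply: er; apply/andP; split; lra.
have Ne : 0 < N e.
  have At : A (T / 2) by rewrite /A/= in_itv/=; apply/andP; split; move: T0; lra.
  by rewrite -(pmulr_rgt0 _ c00) (lt_le_trans _ (sup_le Se (AT _ At)))// (lt_le_trans r0)// Ae.
exists e => //.
have [K K0 HK] := superlinear_bounds.
have bF w : S w -> bounded_mfun T (fun t => F t (w t)).
  exact: (bounded_mfun_potential C0 q1 sup_le mg cg g_growth).
pose G (t : R) := \1_A t * F t (e t).
have mind : measurable_fun `[0, T] (\1_A : R -> R).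
  by apply: measurable_indic; exact: mA.
have bind : bounded_mfun T (\1_A : R -> R).
  by split => //; exists 1 => t _; rewrite indicE; case: (_ \in _); rewrite ?normr1 ?normr0.
have bG : bounded_mfun T G by apply: bounded_mfunM => //; exact: bF.
pose B := \int[mu]_(t in `[0, T]) G t.
have G0 t : 0 <= G t.
  rewrite /G indicE; have [At|At] := pselect (A t); last by rewrite memNset// mul0r.
  by rewrite mem_set// mul1r; have /andP[h _] := g_AR t (Ae _ At); rewrite pmulr_rge0 in h.
have B0 : 0 < B.
  rewrite lt_neqAle integral_itv_ge0// andbT eq_sym; apply/eqP => B0.
  have [N1 [mN1 N10] HN1] :=
    integral_itv_eq0 (bounded_mfun_integrable bG) (fun t _ => G0 t) B0.
  have sub : A `<=` N1 `|` Nul.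
    move=> t At; apply: contrapT => /not_orP[nN1 nNul].
    have := HN1 t (AT _ At) nN1; rewrite /G indicE mem_set// mul1r => Ft0.
    by have := F_pos (AT _ At) nNul (Ae _ At); rewrite Ft0 ltxx.
  have : (mu A <= mu N1 + mu Nul)%E.
    apply: (@le_trans _ _ (mu (N1 `|` Nul))); last exact: measureU2.
    by apply: le_measure; rewrite ?inE//; exact: measurableU.
  rewrite N10 Nul0 adde0 /A lebesgue_measure_itv/= lte_fin; case: ifPn => [_|/negP].
    by rewrite -EFinD lee_fin; move: T0; lra.
  by move=> H _; apply: H; move: T0; lra.
pose s0 := Num.max 1 ((E e / p / B) `^ (m - p)^-1).
have s01 : 1 <= s0 by rewrite le_max lexx.
have Ep : 0 <= E e / p by rewrite divr_ge0 ?energy_ge0// ltW.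
pose cbar := s0 `^ p * (E e / p) + K * T.
exists cbar => s s_ge0.
have Ss : S (s *: e) by exact: C0inftyZ.
have Es : E (s *: e) / p = s `^ p * (E e / p).
  by rewrite energyZ// ger0_norm// mulrA.
have iF := bounded_mfun_integrable (bF _ Ss).
have iK : integrable_itv T (fun=> - K) by exact/bounded_mfun_integrable/bounded_mfun_cst.
have [ss0|s0s] := leP s s0.
  rewrite /action Es /cbar lerD//.
    by rewrite ler_wpM2r// ge0_ler_powR ?nnegrE ?(ltW p0)// (le_trans _ s01).
  rewrite lerNl -mulNr -integral_itv_cst//; apply: integral_itv_le => // t tT.
  by have [] := HK t ((s *: e) t).
have s1 : 1 <= s by rewrite (le_trans s01)// ltW.
have hF : s `^ m * B - K * T <= \int[mu]_(t in `[0, T]) F t ((s *: e) t).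
  have iG := bounded_mfun_integrable bG.
  have iGs := integrable_itvZ (s `^ m) iG.
  have EG : s `^ m * B = \int[mu]_(t in `[0, T]) (s `^ m * G t) by rewrite integral_itvZ.
  rewrite -mulNr -(integral_itv_cst (- K) T0') EG -integral_itvD//.
  apply: integral_itv_le => //; first exact: integrable_itvD.
  move=> t tT; rewrite /G indicE; have [At|At] := pselect (A t).
    rewrite mem_set// mul1r ler_wnDr ?oppr_le0//.
    apply: (primitive0_superhomogeneous cg _ _ (Ae _ At) s1) => t' x xr.
    by have /andP[] := g_AR t' xr.
  by rewrite memNset// mul0r mulr0 add0r; have [] := HK t ((s *: e) t).
have hs : s `^ p * (E e / p) <= s `^ m * B.
  have -> : m = p + (m - p) by ring.
  have sp : 0 < s by rewrite (lt_le_trans _ s1).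
  rewrite powRD ?(gt_eqF sp) ?implybT// -mulrA ler_wpM2l ?powR_ge0//.
  have mp0 : 0 < m - p by rewrite subr_gt0.
  have EB : 0 <= E e / p / B := divr_ge0 Ep (ltW B0).
  rewrite -ler_pdivrMr// -(powRVK EB (lt0r_neq0 mp0)).
  rewrite ge0_ler_powR ?nnegrE ?powR_ge0 ?(ltW mp0) ?(ltW sp)//.
  by rewrite (le_trans _ (ltW s0s))// le_max lexx orbT.
have ar (u1 u2 u3 u4 : R) : u3 - u4 <= u2 -> u1 <= u3 -> 0 <= cbar - u4 ->
  u1 - u2 <= cbar by lra.
rewrite /action Es; apply: (ar _ _ _ _ hF hs).
by rewrite /cbar addrK mulr_ge0// powR_ge0.
Qed.

(** Where the Ambrosetti-Rabinowitz condition acts: on large spheres a low value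
of the functional forces it to decrease radially. *)
Lemma action_outward (rho cbar : R) : exists2 rad, rho <= rad /\ 1 <= rad &
  forall x, S x -> rad <= N x <= rad + 1 -> Phi x <= cbar ->
    dPhi x ((N x)^-1 *: x) <= - (rad + 1)^-1.
Proof.
have [K K0 HK] := superlinear_bounds.
pose k := m / p - 1; have k0 : 0 < k by rewrite subr_gt0 ltr_pdivlMr// mul1r.
pose A := m * `|cbar| + K * T + 1.
have A0 : 0 < A by rewrite ltr_wpDl// addr_ge0// mulr_ge0// ltW.
pose rad := 1 + `|rho| + A / k.
have Ak : 0 < A / k by rewrite divr_gt0.
have rad1 : 1 <= rad by rewrite /rad -addrA lerDl addr_ge0// ltW.
have radA : A <= k * rad.
  rewrite mulrC -ler_pdivrMr// /rad lerDr addr_ge0//.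
exists rad.
  split=> //; rewrite /rad (le_trans (ler_norm rho))//.
  by have := ltW Ak; have := normr_ge0 rho; lra.
have ar (n e phi d : R) : rad <= n <= rad + 1 -> n <= e -> phi <= cbar ->
    d <= e - (m * (e / p - phi) - K * T) -> n^-1 * d <= - (rad + 1)^-1.
  move=> /andP[n1 n2] ne pc hd.
  have n0 : 0 < n by rewrite (lt_le_trans _ n1)// (lt_le_trans _ rad1).
  have h1 : k * rad <= k * e by rewrite ler_pM2l// (le_trans n1).
  have h2 : m * phi <= m * `|cbar|.
    by rewrite ler_pM2l// (le_trans pc)// ler_norm.
  have h3 : e - (m * (e / p - phi) - K * T) = - (k * e) + m * phi + K * T.
    by rewrite /k; ring.
  have d1 : d <= -1 by rewrite h3 /A in hd radA; lra.
  apply: (@le_trans _ _ (n^-1 * -1)); first by rewrite ler_pM2l// invr_gt0.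
  by rewrite mulrN1 lerN2 lef_pV2 ?posrE// (lt_le_trans n0).
move=> x Sx Nx Px; have NE := energy_normX alpha T p1 x.
rewrite (dactionZ p1 ap a1 T0 C0 q1 sup_le mg cg g_growth)//.
apply: (ar _ (E x) (Phi x)) => //.
  rewrite -NE -[leLHS]powRr1 ?energy_norm_ge0// ler_powR ?(ltW p1)//.
  by case/andP: Nx => h _; exact: le_trans h.
rewrite /daction.
have -> : \int[mu]_(t in `[0, T]) (dualmap p (D x t) * D x t) = E x.
  by rewrite energyE; apply: integral_itv_eq => t _; rewrite dualmapM.
rewrite lerD2l lerN2.
have -> : E x / p - Phi x = \int[mu]_(t in `[0, T]) F t (x t).
  by rewrite /action opprB addrCA subrr addr0.
have iF := bounded_mfun_integrable
  (bounded_mfun_potential C0 q1 sup_le mg cg g_growth Sx).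
have iK : integrable_itv T (fun=> K) by exact/bounded_mfun_integrable/bounded_mfun_cst.
have imF := integrable_itvZ m iF.
rewrite -(integral_itv_cst K T0') -(integral_itvZ m iF) -(integral_itvB imF iK).
apply: integral_itv_le.
- exact: integrable_itvB.
- exact: (integrable_nonlinear_pair T0 C0 q1 sup_le mg cg g_growth).
- by move=> t _; rewrite [leRHS]mulrC; have [] := HK t (x t).
Qed.

(** Bounded almost critical points at a positive level. *)
Lemma almost_critical_points : exists M, exists2 kappa, 0 < kappa &
  forall k, 0 < k -> exists x, [/\ S x, N x <= M, kappa <= Phi x &
    forall e, S e -> `|dPhi x e| <= k * (N e + 1)].
Proof.
have [rho rho0 [kappa kappa0 ring]] := action_ring.
have [e [Se Ne] [cbar ray]] := action_ray.
have [rad [rhorad rad1] outward] := action_outward rho (cbar + 2).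
exists (rad + 1), (kappa / 2); first by rewrite divr_gt0.
move=> k k0.
have SD a x y : S x -> S y -> S (x + a *: y) by exact: C0infty_lin.
have rad0 : 0 < rad + 1 by lra.
have Phi0 : Phi 0 = 0.
  rewrite /action.
  have -> : E 0 = 0.
    by rewrite -(energy_normX alpha T p1) (energy_norm0 p1 ap a1 T0) powR0 ?gt_eqF.
  rewrite mul0r sub0r (@integral_itv_eq _ _ _ (fun=> 0)); last first.
    by move=> t _; exact: primitive0_0.
  by rewrite integral_itv_cst// mul0r oppr0.
have [x [Sx Nx kx HX]] := mountain_pass (C0infty0 (R := R) T) SD
  (energy_norm0 p1 ap a1 T0) (fun a x Sx => energy_normZ p1 ap a1 T0 a Sx)
  (fun x y Sx Sy => energy_normD p1 ap a1 T0 Sx Sy)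
  rho0 rhorad kappa0 (eta := (rad + 1)^-1) (ltac:(by rewrite invr_gt0)) Se Ne Phi0 ring
  ray outward
  (action_strict_derivative p1 ap a1 T0 C0 q1 c00 sup_le mg cg g_growth)
  (action_uniform_continuity p1 ap a1 T0 C0 q1 c00 sup_le mg cg g_growth) k0.
exists x; split => //.
  by rewrite ler_pdivrMr// mulrC.
have H (e' : R -> R) : S e' -> - (k * (N e' + 1)) <= dPhi x e'.
  move=> Se'; have n0 : 0 < N e' + 1 by rewrite ltr_wpDl// energy_norm_ge0.
  have Sz : S ((N e' + 1)^-1 *: e') by exact: C0inftyZ.
  have := HX _ Sz.
  rewrite (energy_normZ p1 ap a1 T0)// gtr0_norm ?invr_gt0//.
  rewrite (dactionZ p1 ap a1 T0 C0 q1 sup_le mg cg g_growth)//.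
  rewrite [(N e' + 1)^-1 * _]mulrC ler_pdivrMr// mul1r lerDl => /(_ ler01).
  by rewrite ler_pdivlMl// mulrN mulrC.
move=> e' Se'; rewrite ler_norml H//=.
have Sn : S (-1 *: e') by exact: C0inftyZ.
have := H _ Sn; rewrite (energy_normZ p1 ap a1 T0)// normrN1 mul1r.
by rewrite (dactionZ p1 ap a1 T0 C0 q1 sup_le mg cg g_growth)// mulN1r lerN2.
Qed.

End geometry.

Section dyadic.
Context {R : realType}.

Definition dyadic (k : nat) : R := 1 / (2 ^ k.+1)%:R.

Lemma dyadic_gt0 k : 0 < dyadic k.
Proof. by rewrite divr_gt0// ltr0n expn_gt0. Qed.

Lemma dyadic_le k j : (k <= j)%N -> dyadic j <= dyadic k.
Proof.
move=> kj; rewrite ler_pM2l// lef_pV2 ?posrE ?ltr0n ?expn_gt0//.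
by rewrite ler_nat leq_exp2l.
Qed.

Lemma dyadic_le1 k : dyadic k <= 1.
Proof. by rewrite /dyadic div1r invf_le1 ?ltr0n ?expn_gt0// ler1n expn_gt0. Qed.

Lemma near_dyadic_le (e : R) : 0 < e -> \forall k \near \oo, dyadic k <= e.
Proof.
move=> e0; have := near_infty_natSinv_lt (PosNum e0) => H.
near=> k; have /= ke : k.+1%:R^-1 < e by near: k; exact: H.
rewrite (le_trans _ (ltW ke))// /dyadic div1r lef_pV2 ?posrE ?ltr0n ?expn_gt0//.
by rewrite ler_nat ltnW// ltn_expl.
Unshelve. all: by end_near. Qed.

Lemma dyadic_cvg_le (h : nat -> R) (B : R) : 0 <= B ->
  (forall k, 0 <= h k <= B * dyadic k) -> h @ \oo --> 0.
Proof.
move=> B0 hB; apply/cvgrPdist_le => e e0.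
have B1 : 0 < B + 1 by rewrite ltr_wpDl.
have := near_dyadic_le (divr_gt0 e0 B1); apply: filterS => k.
rewrite ler_pdivlMr// => ke; rewrite sub0r normrN.
have /andP[h0 hk] := hB k; rewrite ger0_norm// (le_trans hk)// (le_trans _ ke)//.
by rewrite mulrC ler_wpM2l ?lerDl// ltW// dyadic_gt0.
Qed.

End dyadic.

Section Lp.
Context {R : realType}.
Local Notation mu := (@lebesgue_measure R).
Variables (T p : R).
Hypothesis p1 : 1 < p.
Hypothesis T0 : 0 <= T.

Let p0 : 0 < p. Proof. exact: lt_trans p1. Qed.
Let mT : measurable (`[0, T]%classic : set (measurableTypeR R)).
Proof. exact: measurable_itv. Qed.

Lemma cvg_norm_powR (a : nat -> R) (l : R) : a @ \oo --> l ->
  `|a j| `^ p @[j --> \oo] --> `|l| `^ p.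
Proof.
move=> al; apply/cvgrPdist_le => e e0.
pose B := p * (`|l| + 1) `^ (p - 1).
have B0 : 0 < B by rewrite mulr_gt0// powR_gt0// ltr_wpDl.
have lip (x y : R) : `|x| <= `|l| + 1 -> `|x| `^ p - `|y| `^ p <= B * `|x - y|.
  move=> xl; rewrite (le_trans (powR_convex_tangent p1 _ _))// /B -mulrA ler_pM2l//.
  rewrite (le_trans (ler_norm _))// normrM normr_dualmap// ler_wpM2r//.
  by rewrite ge0_ler_powR ?nnegrE ?subr_ge0 ?addr_ge0// ltW.
have /cvgrPdist_le/(_ _ (divr_gt0 e0 B0)) H1 := al.
have /cvgrPdist_le/(_ _ ltr01) H2 := al.
apply: filterS2 H1 H2 => j; rewrite ler_pdivlMr// mulrC => h1 h2.
have aj : `|a j| <= `|l| + 1.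
  rewrite -[a j](subrK l) addrC (le_trans (ler_normD _ _))// lerD2l.
  by rewrite distrC.
have ll : `|l| <= `|l| + 1 by rewrite lerDl.
rewrite ler_norml; apply/andP; split.
  by rewrite lerNl opprB (le_trans (lip _ _ aj))// distrC.
exact: le_trans (lip _ _ ll) h1.
Qed.

Definition Lp_fun (h : R -> R) : Prop :=
  measurable_fun `[0, T] h /\ integrable_itv T (fun t => `|h t| `^ p).

Definition Lp_mass (h : R -> R) : R := \int[mu]_(t in `[0, T]) `|h t| `^ p.

Lemma Lp_mass_ge0 h : 0 <= Lp_mass h.
Proof. by apply: integral_itv_ge0 => t _; exact: powR_ge0. Qed.

Lemma Lp_fun_bounded h : bounded_mfun T h -> Lp_fun h.
Proof.
move=> bh; split; first by case: bh.
by apply: bounded_mfun_integrable; apply: bounded_mfun_powR => //; exact: ltW.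
Qed.

Lemma Lp_funD h k : Lp_fun h -> Lp_fun k -> Lp_fun (fun t => h t + k t).
Proof.
move=> [mh ih] [mk ik]; have mhk : measurable_fun `[0, T] (fun t => h t + k t).
  exact: measurable_funD.
split=> //; apply: (@integrable_itv_le _ _ _
  (fun t => 2 `^ p * (`|h t| `^ p + `|k t| `^ p))).
- exact: measurable_norm_powR.
- by move=> t tT; rewrite ger0_norm ?powR_ge0//; exact: powR_normD.
- by apply: integrable_itvZ; exact: integrable_itvD.
Qed.

Lemma Lp_funN h : Lp_fun h -> Lp_fun (fun t => - h t).
Proof.
move=> [mh ih]; split; first exact: measurableT_comp.
by rewrite (_ : (fun t => _) = (fun t => `|h t| `^ p))//; apply/funext => t; rewrite normrN.
Qed.

Lemma Lp_funB h k : Lp_fun h -> Lp_fun k -> Lp_fun (fun t => h t - k t).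
Proof. by move=> Lh Lk; apply: Lp_funD => //; exact: Lp_funN. Qed.

Lemma Lp_massD h k : Lp_fun h -> Lp_fun k ->
  Lp_mass (fun t => h t + k t) <= 2 `^ p * (Lp_mass h + Lp_mass k).
Proof.
move=> Lh Lk; have [_ ihk] := Lp_funD Lh Lk.
have [[_ ih] [_ ik]] := (Lh, Lk).
have i := integrable_itvD ih ik.
rewrite /Lp_mass -(integral_itvD ih ik) -(integral_itvZ _ i).
apply: integral_itv_le => //; first exact: integrable_itvZ.
by move=> t _; exact: powR_normD.
Qed.

(** L^p dominates L^1 on a bounded interval, with constants from Young's
inequality. *)
Lemma Lp_mass_integral (e : R) : 0 < e -> exists2 B, 0 < B & forall h, Lp_fun h ->
  integrable_itv T h /\ \int[mu]_(t in `[0, T]) `|h t| <= e * T + B * Lp_mass h.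
Proof.
move=> e0; have [B B0 HB] := young_weightl p1 e0; exists B => // h [mh ih].
have i1 : integrable_itv T (fun=> e) by exact/bounded_mfun_integrable/bounded_mfun_cst.
have i2 := integrable_itvZ B ih; have i12 := integrable_itvD i1 i2.
have hle t : `|h t| <= e + B * `|h t| `^ p.
  by have := HB 1 _ ler01 (normr_ge0 (h t)); rewrite !powR1 mul1r mulr1.
have ih1 : integrable_itv T h by apply: integrable_itv_le i12.
split=> //; rewrite /Lp_mass -(integral_itv_cst e T0) -(integral_itvZ B ih).
rewrite -(integral_itvD i1 i2); apply: integral_itv_le => //.
exact: integrable_itv_norm.
Qed.

(** Fatou's lemma for sequences on [0, T] converging off a null set. *)
Lemma Lp_mass_fatou (h : nat -> R -> R) (k : R -> R) (B : R) :
  (forall j, measurable_fun `[0, T] (h j)) -> measurable_fun `[0, T] k ->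
  (forall t, 0 <= t <= T -> h ^~ t @ \oo --> k t) ->
  (\forall j \near \oo, integrable_itv T (fun t => `|h j t| `^ p) /\ Lp_mass (h j) <= B) ->
  Lp_fun k /\ Lp_mass k <= B.
Proof.
move=> mh mk hk [j0 _ HB].
have mhp j : measurable_fun (`[0, T]%classic : set (measurableTypeR R))
    (fun t => (`|h j t| `^ p)%:E).
  by apply/measurable_EFinP; exact: measurable_norm_powR.
have mkp : measurable_fun (`[0, T]%classic : set (measurableTypeR R))
    (fun t => (`|k t| `^ p)%:E).
  by apply/measurable_EFinP; exact: measurable_norm_powR.
have := @fatou _ _ R mu _ mT (fun j t => (`|h j t| `^ p)%:E) mhp
  (fun j t _ => powR_ge0 _ _).
have -> : (\int[mu]_(x in `[0%R, T]) limn_einf (fun j => (`|h j x| `^ p)%:E) =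
    \int[mu]_(x in `[0%R, T]) (`|k x| `^ p)%:E)%E.
  apply: eq_integral => t; rewrite inE/= in_itv/= => tT.
  have [-> _//] : ((limn_einf (fun j => (`|h j t| `^ p)%:E) = (`|k t| `^ p)%:E) *
    (limn_esup (fun j => (`|h j t| `^ p)%:E) = (`|k t| `^ p)%:E))%type.
  apply: cvg_limn_einf_sup; apply/fine_cvgP; split; first by near=> j.
  exact: cvg_norm_powR (hk _ tT).
move=> fat.
have kB : (\int[mu]_(x in `[0%R, T]) (`|k x| `^ p)%:E <= B%:E)%E.
  apply: (le_trans fat); rewrite limn_einf_lim; apply: lime_le.
    exact: is_cvg_einfs.
  near=> n; apply: (@le_trans _ _ (\int[mu]_(x in `[0%R, T]) (`|h (maxn n j0) x| `^ p)%:E)%E).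
    by apply: ereal_inf_lbound; exists (maxn n j0) => //=; exact: leq_maxl.
  have [ih hB] := HB (maxn n j0) (leq_maxr _ _).
  by rewrite (integrable_itv_fin ih) lee_fin.
have ik : integrable_itv T (fun t => `|k t| `^ p).
  apply/integrableP; split => //.
  under eq_integral do rewrite /= ger0_norm ?powR_ge0//.
  by rewrite (le_lt_trans kB)// ltry.
split=> //; by rewrite -lee_fin /Lp_mass -(integrable_itv_fin ik).
Unshelve. all: by end_near. Qed.

End Lp.

Section riesz_fischer.
Context {R : realType}.
Local Notation mu := (@lebesgue_measure R).
Variables (T p : R).
Hypothesis p1 : 1 < p.
Hypothesis T0 : 0 <= T.

Let p0 : 0 < p. Proof. exact: lt_trans p1. Qed.
Let mT : measurable (`[0, T]%classic : set (measurableTypeR R)).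
Proof. exact: measurable_itv. Qed.

Lemma Lp_mass_off_null (N : set (measurableTypeR R)) (h k : R -> R) :
  measurable N -> mu N = 0%E -> (forall t, 0 <= t <= T -> ~ N t -> h t = k t) ->
  Lp_mass T p h = Lp_mass T p k.
Proof.
move=> mN N0 hk; apply: (integral_off_null mT mN N0) => t.
by rewrite /= in_itv/= => tT Nt; rewrite hk.
Qed.

(** A sequence with summable increments in L^p, hence in L^1, converges almost
everywhere; Fatou's lemma identifies the limit in L^p. *)
Lemma riesz_fischer (z : nat -> R -> R) : (forall k, Lp_fun T p (z k)) ->
  (forall k j, (k <= j)%N -> Lp_mass T p (fun t => z j t - z k t) <= dyadic k `^ p) ->
  exists v, Lp_fun T p v /\ forall k, Lp_mass T p (fun t => z k t - v t) <= dyadic k `^ p.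
Proof.
move=> Lz cz; pose d k (t : R) := `|z k.+1 t - z k t|.
have Ld k : Lp_fun T p (fun t => z k.+1 t - z k t) by exact: Lp_funB.
have [B _ HB] := @Lp_mass_integral _ T p p1 T0 1 ltr01.
have id1 k : integrable_itv T (d k) by apply: integrable_itv_norm; case: (HB _ (Ld k)).
have Id k : \int[mu]_(t in `[0, T]) d k t <= (T + 1) * dyadic k.
  have k0 := @dyadic_gt0 R k.
  have kp : 0 < dyadic k `^ (p - 1) :> R by rewrite powR_gt0.
  rewrite -(ler_pM2l kp) -(integral_itvZ _ (id1 k)).
  have ic : integrable_itv T (fun=> dyadic k `^ p : R).
    exact/bounded_mfun_integrable/bounded_mfun_cst.
  have [_ idp] := Ld k.
  apply: (@le_trans _ _ (dyadic k `^ p * T + Lp_mass T p (fun t => z k.+1 t - z k t))).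
    rewrite -(integral_itv_cst (dyadic k `^ p) T0) -(integral_itvD ic idp).
    apply: integral_itv_le; [exact: integrable_itvZ|exact: integrable_itvD|].
    by move=> t _; exact: (young_simple p1 (ltW k0) (normr_ge0 _)).
  rewrite (le_trans (lerD (lexx _) (cz k k.+1 (leqnSn k))))//.
  have <- := powR_subr1M p1 (ltW k0).
  by rewrite [leRHS]mulrCA mulrDl mul1r [X in _ <= X + _]mulrC.
pose h (t : R) := (\sum_(0 <= k <oo) (d k t)%:E)%E.
have md k : measurable_fun (`[0, T]%classic : set (measurableTypeR R)) (fun t => (d k t)%:E).
  by apply/measurable_EFinP; apply: measurableT_comp => //; case: (Ld k).
have hI : (\int[mu]_(t in `[0%R, T]) h t <= (T + 1)%:E)%E.
  rewrite /h (integral_nneseries mu mT md); last first.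
    by move=> k t _; rewrite lee_fin /d.
  apply: (@le_trans _ _ (\sum_(0 <= k <oo) ((T + 1) / (2 ^ k.+1)%:R)%:E)%E).
    apply: lee_nneseries => [k _ _|k _].
      by apply: integral_ge0 => t _; rewrite lee_fin /d.
    by rewrite (integrable_itv_fin (id1 k)) lee_fin (le_trans (Id k))// /dyadic mulrA mulr1.
  by apply: epsilon_trick0; rewrite addr_ge0.
have h0 t : (0 <= h t)%E by apply: nneseries_ge0 => k _ _; rewrite lee_fin /d.
have ih : mu.-integrable (`[0, T]%classic : set (measurableTypeR R)) h.
  apply/integrableP; split.
    have := @ge0_emeasurable_sum _ _ R (`[0, T]%classic : set (measurableTypeR R))
      (fun k t => (d k t)%:E) predT
      (fun k t _ _ => (normr_ge0 _ : (0 <= (d k t)%:E)%E)) (fun k _ => md k).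
    by [].
  under eq_integral do rewrite gee0_abs//.
  by rewrite (le_lt_trans hI)// ltry.
have [N [mN N0 HN]] := integrable_ae mT ih.
have cvz t : 0 <= t <= T -> ~ N t -> cvgn (z ^~ t).
  move=> tT Nt; have hfin : h t \is a fin_num.
    apply: contrapT => H; apply: Nt; apply: HN => /= H'; apply: H; apply: H'.
    by rewrite /= in_itv.
  have cs : cvgn [normed series (fun k => z k.+1 t - z k t)].
    apply: nondecreasing_is_cvgn.
      by apply: nondecreasing_series => k _ _; exact: normr_ge0.
    exists (fine (h t)) => _ [n _ <-] /=; rewrite -lee_fin fineK// /series/=.
    rewrite -sumEFin; apply: nneseries_lim_ge => k _ _; rewrite lee_fin.
    exact: normr_ge0.
  have /cvg_ex[/= l sl] := normed_cvg cs.
  apply/cvg_ex; exists (z 0%N t + l).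
  have -> : z ^~ t = (fun n => z 0%N t + series (fun k => z k.+1 t - z k t) n).
    by apply/funext => n; rewrite /series/= telescope_sumr// addrC subrK.
  by apply: cvgD => //; exact: cvg_cst.
pose zz k (t : R) := z k t * \1_(~` N) t.
have mNc : measurable_fun (`[0, T]%classic : set (measurableTypeR R)) (\1_(~` N) : R -> R).
  by apply: measurable_indic; exact: measurableC.
have zzE k t : ~ N t -> zz k t = z k t.
  by move=> Nt; rewrite /zz indicE mem_set// mulr1.
have zz0 k t : N t -> zz k t = 0.
  by move=> Nt; rewrite /zz indicE memNset ?mulr0// => H; exact: H.
have Lzz k : Lp_fun T p (zz k).
  have [mz iz] := Lz k.
  have mzz : measurable_fun `[0, T] (zz k) by exact: measurable_funM.
  split=> //; apply: integrable_itv_le iz; first exact: measurable_norm_powR.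
  move=> t _; rewrite ger0_norm ?powR_ge0//.
  have [Nt|Nt] := pselect (N t); last by rewrite zzE.
  by rewrite zz0// normr0 powR0 ?gt_eqF// powR_ge0.
pose v t := limn (zz ^~ t).
have zzv t : 0 <= t <= T -> zz ^~ t @ \oo --> v t.
  move=> tT; have [Nt|Nt] := pselect (N t).
    have -> : zz ^~ t = cst 0 by apply/funext => k; rewrite zz0.
    by rewrite /v (_ : zz ^~ t = cst 0) ?lim_cst//; [exact: cvg_cst|apply/funext => k; rewrite zz0].
  have E : zz ^~ t = z ^~ t by apply/funext => k; rewrite zzE.
  by rewrite /v E; exact: cvz.
have mv : measurable_fun `[0, T] v.
  apply: (@measurable_fun_cvg _ _ _ _ zz) => [k|t]; first by case: (Lzz k).
  by rewrite /= in_itv/=; exact: zzv.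
have key k : Lp_fun T p (fun t => v t - zz k t) /\
    Lp_mass T p (fun t => v t - zz k t) <= dyadic k `^ p.
  apply: (@Lp_mass_fatou _ T p p1 (fun j t => zz j t - zz k t)).
  - by move=> j; case: (Lp_funB p1 (Lzz j) (Lzz k)).
  - by apply: measurable_funB => //; case: (Lzz k).
  - by move=> t tT; apply: cvgB; [exact: zzv|exact: cvg_cst].
  exists k => // j kj; split; first by case: (Lp_funB p1 (Lzz j) (Lzz k)).
  rewrite (@Lp_mass_off_null N _ (fun t => z j t - z k t))//; first exact: cz.
  by move=> t _ Nt; rewrite !zzE.
exists v; split.
  have := Lp_funD p1 (key 0%N).1 (Lzz 0%N).
  by rewrite (_ : (fun t => _) = v)//; apply/funext => t; rewrite subrK.
move=> k; rewrite (@Lp_mass_off_null N _ (fun t => zz k t - v t))//.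
  rewrite (_ : Lp_mass T p _ = Lp_mass T p (fun t => v t - zz k t)).
    exact: (key k).2.
  by apply: integral_itv_eq => t _; rewrite distrC.
by move=> t _ Nt; rewrite zzE.
Qed.

End riesz_fischer.

Lemma ultra_bounded_cvg {R : realType} (U : set_system nat) (a : nat -> R) (A : R) :
  UltraFilter U -> (forall n, `|a n| <= A) -> exists l : R, a @ U --> l.
Proof.
move=> UU aA.
have FU : ProperFilter (a @ U) by exact: fmap_proper_filter.
have UK : (a @ U) `[- A, A]%classic.
  by apply: (@filterS _ U _ setT); [move=> n _; rewrite /= in_itv/= -ler_norml|exact: filterT].
have [l [_ cl]] := @segment_compact R (- A) A (a @ U) FU UK.
exists l => B Bl; have [//|UnB] := @in_ultra_setVsetC _ U (a @^-1` B) UU.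
have aUnB : (a @ U) (a @` (~` (a @^-1` B))).
  by apply: (@filterS _ U _ _ _ _ UnB) => n Hn; exists n.
by have [_ [[n nB <-] Ban]] := cl _ _ aUnB Bl.
Qed.

Section compactness.
Context {R : realType}.
Local Notation mu := (@lebesgue_measure R).
Variables (alpha T p C q c0 M : R) (g : R -> R -> R).
Hypothesis p1 : 1 < p.
Hypothesis ap : p^-1 < alpha.
Hypothesis a1 : alpha < 1.
Hypothesis T0 : 0 < T.
Hypothesis C0 : 0 < C.
Hypothesis q1 : 1 <= q.
Hypothesis c00 : 0 < c0.
Hypothesis M0 : 0 <= M.

Local Notation D := (frac_derive alpha).
Local Notation S := (C0infty T).
Local Notation E := (energy alpha T p).
Local Notation N := (energy_norm alpha T p).
Local Notation dPhi := (daction alpha T p g).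

Hypothesis sup_le : forall w t, S w -> 0 <= t <= T -> `|w t| <= c0 * N w.
Hypothesis mg : forall x, measurable_fun setT (g ^~ x).
Hypothesis cg : forall t, continuous (g t).
Hypothesis g_growth : forall t x, `|g t x| <= C * (1 + `|x| `^ (q - 1)).

Let p0 : 0 < p. Proof. exact: lt_trans p1. Qed.
Let T0' : 0 <= T. Proof. exact: ltW. Qed.

Definition almost_critical (s : R) (x : R -> R) : Prop :=
  [/\ S x, N x <= M & forall e, S e -> `|dPhi x e| <= s * (N e + 1)].

Lemma almost_critical_le s s' x : s <= s' -> almost_critical s x -> almost_critical s' x.
Proof.
move=> ss [Sx Nx Hx]; split=> // e Se; rewrite (le_trans (Hx e Se))//.
by rewrite ler_wpM2r// addr_ge0// energy_norm_ge0.
Qed.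

Lemma C0infty_bounded_everywhere x t : S x -> N x <= M -> `|x t| <= c0 * M.
Proof.
move=> Sx Nx; have [tT|tT] := boolP (t \in `]0, T[).
  rewrite in_itv/= in tT; have /andP[t0 tT'] := tT.
  by rewrite (le_trans (sup_le Sx _)) ?ler_pM2l// !ltW.
by rewrite (C0infty_support Sx tT) normr0 mulr_ge0// ltW.
Qed.

(** The p-Laplacian type operator is of type (S+): uniformly close almost
critical points are close in energy. *)
Lemma almost_critical_cauchy (eps : R) : 0 < eps -> exists2 s, 0 < s &
  forall x y, almost_critical s x -> almost_critical s y ->
    (forall t, 0 <= t <= T -> `|x t - y t| <= s) -> E (x - y) <= eps.
Proof.
move=> e0; pose A := 2 * (M `^ p + 1).
have A0 : 0 < A by rewrite mulr_gt0// ltr_wpDl// powR_ge0.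
have [B B0 HB] := dualmap_unif_monotone p1 (divr_gt0 (divr_gt0 e0 (ltr0Sn _ 1)) A0).
have [K K0 gK] := growth_bounded C0 q1 g_growth (c0 * M).
pose L := B * (2 * (2 * M + 1) + 2 * K * T + 1).
have L0 : 0 < L.
  rewrite mulr_gt0// ltr_wpDl// addr_ge0 ?mulr_ge0// addr_ge0// mulr_ge0//.
exists (eps / 2 / L); first by rewrite !divr_gt0.
set s := eps / 2 / L; have s0 : 0 < s by rewrite !divr_gt0.
have ar (Ex Ey : R) : Ex <= M `^ p -> Ey <= M `^ p -> eps / 2 / A * (Ex + Ey) <= eps / 2.
  move=> h1 h2; rewrite -[leRHS](divfK (lt0r_neq0 A0)) ler_pM2l ?divr_gt0//.
  by rewrite /A; lra.
have ar2 (n I1 I2 d1 d2 g1 g2 : R) : n <= 2 * M -> `|d1| <= s * (n + 1) ->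
    `|d2| <= s * (n + 1) -> d1 = I1 - g1 -> d2 = I2 - g2 ->
    `|g1| <= K * s * T -> `|g2| <= K * s * T -> B * (I1 - I2) <= eps / 2.
  move=> nM h1 h2 E1 E2 h3 h4.
  have -> : eps / 2 = B * (s * (2 * (2 * M + 1) + 2 * K * T + 1)).
    by rewrite mulrCA /s -/L divfK ?gt_eqF.
  rewrite ler_pM2l//; have hn : s * (n + 1) <= s * (2 * M + 1) by rewrite ler_pM2l// lerD2r.
  move: h1 h2 h3 h4; rewrite E1 E2 !ler_norml.
  move=> /andP[u1 u2] /andP[u3 u4] /andP[u5 u6] /andP[u7 u8].
  by lra.
move=> x y [Sx Nx Hx] [Sy Ny Hy] xy.
have Sxy := C0inftyB Sx Sy.
have Nxy : N (x - y) <= 2 * M.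
  rewrite (le_trans (energy_normB p1 ap a1 T0 Sx Sy))//.
  by rewrite mulrDl mul1r lerD.
have Ex : E x <= M `^ p by rewrite -energy_norm_leE.
have Ey : E y <= M `^ p by rewrite -energy_norm_leE.
have ix w Sw := @integrable_derive_powR _ _ _ _ p1 ap a1 T0 w Sw.
have ixy := integrable_dual_pair p1 ap a1 T0 Sx Sxy.
have iyx := integrable_dual_pair p1 ap a1 T0 Sy Sxy.
have i1 := integrable_itvB ixy iyx.
have i2 := integrable_itvD (ix _ Sx) (ix _ Sy).
have i3 := integrable_itvZ (eps / 2 / A) i2.
have i4 := integrable_itvZ B i1.
apply: (@le_trans _ _ (eps / 2 / A * (E x + E y) +
    B * (\int[mu]_(t in `[0, T]) (dualmap p (D x t) * D (x - y) t) -
         \int[mu]_(t in `[0, T]) (dualmap p (D y t) * D (x - y) t)))).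
  rewrite !energyE -(integral_itvD (ix _ Sx) (ix _ Sy)) -(integral_itvB ixy iyx).
  rewrite -(integral_itvZ _ i2) -(integral_itvZ _ i1) -(integral_itvD i3 i4).
  apply: integral_itv_le => //.
  - exact: ix.
  - exact: integrable_itvD.
  move=> t tT; rewrite -mulrBl (frac_deriveB p1 ap a1 T0)//; exact: HB.
have gle z : S z -> N z <= M ->
    `|\int[mu]_(t in `[0, T]) (g t (z t) * (x - y) t)| <= K * s * T.
  move=> Sz Nz; have ig := integrable_nonlinear_pair T0 C0 q1 sup_le mg cg g_growth Sz Sxy.
  rewrite (le_trans (integral_itv_norm ig))// -(integral_itv_cst (K * s) T0').
  apply: integral_itv_le.
  - exact: integrable_itv_norm.
  - exact/bounded_mfun_integrable/bounded_mfun_cst.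
  move=> t tT; rewrite normrM ler_pM//; last exact: xy.
  by apply: gK; exact: C0infty_bounded_everywhere.
rewrite [leRHS](splitr eps) lerD//; first exact: ar.
by apply: (ar2 _ _ _ _ _ _ _ Nxy (Hx _ Sxy) (Hy _ Sxy) _ _ (gle x Sx Nx) (gle y Sy Ny)).
Qed.

(** Ascoli's theorem along an ultrafilter. *)
Lemma ultra_uniform_limit (U : set_system nat) (w : nat -> R -> R) :
  UltraFilter U -> (forall n, S (w n)) -> (forall n, N (w n) <= M) ->
  exists u : R -> R, forall eps, 0 < eps -> \forall n \near U, forall t, `|w n t - u t| <= eps.
Proof.
move=> UU Sw Nw.
have /choice[u Hu] : forall t, exists l : R, w ^~ t @ U --> l.
  move=> t; apply: (@ultra_bounded_cvg _ U _ (c0 * M)) => n.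
  exact: C0infty_bounded_everywhere.
exists u => eps e0.
have Mp : 0 < M `^ p + 1 by rewrite ltr_wpDl// powR_ge0.
have e40 : 0 < eps / 4 by rewrite divr_gt0.
have [d d0 Hd] := energy_equicontinuous p1 ap a1 T0 Mp e40.
have Ew n : E (w n) <= M `^ p + 1.
  have : E (w n) <= M `^ p by rewrite -energy_norm_leE.
  by move=> h; rewrite (le_trans h)// lerDl.
have Hu' t t' : 0 <= t <= T -> 0 <= t' <= T -> `|t - t'| <= d -> `|u t - u t'| <= eps / 4.
  move=> tT t'T td; have h : `|w n t - w n t'| @[n --> U] --> `|u t - u t'|.
    by apply: cvg_norm; apply: cvgB; exact: Hu.
  by apply: (le_of_cvg h); apply: nearW => n; exact: Hd.
have [K HK] : exists K : nat, T / K.+1%:R <= d.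
  exists (Num.truncn (T / d)).
  rewrite ler_pdivrMr ?ltr0n// mulrC -ler_pdivrMr// ltW//.
  by have /andP[] := truncn_itv (divr_ge0 T0' (ltW d0)).
pose pt (i : nat) : R := i%:R * (T / K.+1%:R).
have Kh : 0 < T / K.+1%:R by rewrite divr_gt0// ltr0n.
have near_pt (m : nat) : \forall n \near U, forall i, (i <= m)%N -> `|w n (pt i) - u (pt i)| <= eps / 4.
  elim: m => [|m IH].
    have /cvgrPdist_le/(_ _ e40) := Hu (pt 0%N); apply: filterS => n h i.
    by rewrite leqn0 => /eqP ->; rewrite distrC.
  have /cvgrPdist_le/(_ _ e40) := Hu (pt m.+1); apply: filterS2 IH => n IH h i.
  by rewrite leq_eqVlt ltnS => /orP[/eqP ->|/IH//]; rewrite distrC.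
have ar (a b c' d' : R) : `|a - b| <= eps / 4 -> `|b - c'| <= eps / 4 ->
    `|c' - d'| <= eps / 4 -> `|a - d'| <= eps.
  rewrite !ler_norml => /andP[h1 h2] /andP[h3 h4] /andP[h5 h6].
  by apply/andP; split; lra.
have := near_pt K.+1; apply: filterS => n Hn t.
have [tT|tT] := boolP (t \in `]0, T[); last first.
  rewrite (C0infty_support (Sw n) tT).
  have -> : u t = 0.
    have h := Hu t; have -> : u t = lim (w ^~ t @ U) by rewrite (cvg_lim _ h).
    rewrite (_ : w ^~ t = cst 0) ?lim_cst//.
    by apply/funext => k; rewrite (C0infty_support (Sw k) tT).
  by rewrite subrr normr0 ltW.
rewrite in_itv/= in tT; have /andP[t0 tT'] := tT.
have tT2 : 0 <= t <= T by rewrite !ltW.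
pose i := Num.truncn (t / (T / K.+1%:R)).
have /andP[i1 i2] : i%:R <= t / (T / K.+1%:R) < i.+1%:R.
  by apply: truncn_itv; rewrite divr_ge0// ltW.
have pti : pt i <= t by rewrite /pt -ler_pdivlMr.
have pti2 : t - pt i <= T / K.+1%:R.
  rewrite lerBlDl; move: i2; rewrite ltr_pdivrMr// => /ltW.
  by rewrite -addn1 natrD mulrDl mul1r.
have iK : (i <= K.+1)%N.
  have KT : K.+1%:R * (T / K.+1%:R) = T by rewrite mulrC divfK ?pnatr_eq0.
  by rewrite -(@ler_nat R) (le_trans i1)// ler_pdivrMr// KT ltW.
have ptT : 0 <= pt i <= T.
  by rewrite (le_trans pti (ltW tT')) andbT mulr_ge0// ltW.
have td : `|t - pt i| <= d by rewrite ger0_norm ?subr_ge0// (le_trans pti2).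
apply: (ar _ (w n (pt i)) (u (pt i))).
- exact: Hd.
- exact: Hn.
- by apply: Hu' => //; rewrite distrC.
Qed.

End compactness.

Section Lp_pairing.
Context {R : realType}.
Local Notation mu := (@lebesgue_measure R).
Variables (T p : R).
Hypothesis p1 : 1 < p.
Hypothesis T0 : 0 <= T.

Lemma integrable_Lp_pair v h : Lp_fun T p v -> Lp_fun T p h ->
  integrable_itv T (fun t => dualmap p (v t) * h t).
Proof.
move=> [mv iv] [mh ih]; apply: integrable_itv_le (integrable_itvD iv ih).
  by apply: measurable_funM => //; exact: measurable_dualmap.
by move=> t _; rewrite normrM normr_dualmap//; exact: young_simple.
Qed.

Lemma Lp_pair_le (eps : R) : 0 < eps -> exists2 B, 0 < B & forall v h,
  Lp_fun T p v -> Lp_fun T p h ->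
  `|\int[mu]_(t in `[0, T]) (dualmap p (v t) * h t)| <=
  eps * Lp_mass T p v + B * Lp_mass T p h.
Proof.
move=> e0; have [B B0 HB] := young_weightl p1 e0; exists B => // v h Lv Lh.
have i := integrable_Lp_pair Lv Lh; have [[_ iv] [_ ih]] := (Lv, Lh).
have i1 := integrable_itvZ eps iv; have i2 := integrable_itvZ B ih.
rewrite /Lp_mass -(integral_itvZ _ iv) -(integral_itvZ _ ih) -(integral_itvD i1 i2).
rewrite (le_trans (integral_itv_norm i))//; apply: integral_itv_le.
- exact: integrable_itv_norm.
- exact: integrable_itvD.
- by move=> t _; rewrite normrM normr_dualmap//; exact: HB.
Qed.

Lemma Lp_pair_continuous (eps : R) : 0 < eps -> exists2 B, 0 < B & forall v w h,
  Lp_fun T p v -> Lp_fun T p w -> Lp_fun T p h ->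
  `|\int[mu]_(t in `[0, T]) (dualmap p (v t) * h t) -
    \int[mu]_(t in `[0, T]) (dualmap p (w t) * h t)| <=
  eps * (Lp_mass T p v + Lp_mass T p w + Lp_mass T p h) +
  B * Lp_mass T p (fun t => v t - w t).
Proof.
move=> e0; have [B B0 HB] := dualmap_continuityM p1 e0; exists B => // v w h Lv Lw Lh.
have iv := integrable_Lp_pair Lv Lh; have iw := integrable_Lp_pair Lw Lh.
have i := integrable_itvB iv iw; have [_ d] := Lp_funB p1 Lv Lw.
have [[_ jv] [_ jw] [_ jh]] := And3 Lv Lw Lh.
have i1 := integrable_itvD jv jw; have i2 := integrable_itvD i1 jh.
have i3 := integrable_itvZ eps i2; have i4 := integrable_itvZ B d.
rewrite /Lp_mass -(integral_itvB iv iw) -(integral_itvD jv jw) -(integral_itvD i1 jh).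
rewrite -(integral_itvZ _ i2) -(integral_itvZ _ d) -(integral_itvD i3 i4).
rewrite (le_trans (integral_itv_norm i))//; apply: integral_itv_le.
- exact: integrable_itv_norm.
- exact: integrable_itvD.
- by move=> t _; rewrite -mulrBl normrM; exact: HB.
Qed.

End Lp_pairing.

Section limit.
Context {R : realType}.
Local Notation mu := (@lebesgue_measure R).
Variables (alpha T p C q c0 M : R) (g : R -> R -> R).
Hypothesis p1 : 1 < p.
Hypothesis ap : p^-1 < alpha.
Hypothesis a1 : alpha < 1.
Hypothesis T0 : 0 < T.
Hypothesis C0 : 0 < C.
Hypothesis q1 : 1 <= q.
Hypothesis c00 : 0 < c0.
Hypothesis M0 : 0 <= M.

Local Notation D := (frac_derive alpha).
Local Notation S := (C0infty T).
Local Notation E := (energy alpha T p).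
Local Notation N := (energy_norm alpha T p).
Local Notation F t := (primitive0 (g t)).
Local Notation Phi := (action alpha T p g).
Local Notation dPhi := (daction alpha T p g).
Local Notation critical := (almost_critical alpha T p M g).

Hypothesis sup_le : forall w t, S w -> 0 <= t <= T -> `|w t| <= c0 * N w.
Hypothesis mg : forall x, measurable_fun setT (g ^~ x).
Hypothesis cg : forall t, continuous (g t).
Hypothesis g_growth : forall t x, `|g t x| <= C * (1 + `|x| `^ (q - 1)).

Let p0 : 0 < p. Proof. exact: lt_trans p1. Qed.
Let T0' : 0 <= T. Proof. exact: ltW. Qed.

Lemma Lp_fun_derive w : S w -> Lp_fun T p (D w).
Proof. by move=> Sw; apply: Lp_fun_bounded => //; exact: (bounded_mfun_derive p1 ap a1 T0). Qed.

Lemma Lp_mass_derive w : Lp_mass T p (D w) = E w.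
Proof. by rewrite energyE. Qed.

Lemma Lp_mass_deriveB x y : S x -> S y -> Lp_mass T p (fun t => D x t - D y t) = E (x - y).
Proof.
move=> Sx Sy; rewrite energyE; apply: integral_itv_eq => t tT.
by rewrite (frac_deriveB p1 ap a1 T0).
Qed.

(** The Palais-Smale condition. *)
Lemma almost_critical_limit (w : nat -> R -> R) :
  (forall n, critical (dyadic n) (w n)) ->
  exists (f : nat -> nat) (u v : R -> R), [/\ forall k, (k <= f k)%N,
    measurable_fun setT u, forall k t, `|w (f k) t - u t| <= dyadic k,
    Lp_fun T p v &
    forall k, Lp_mass T p (fun t => D (w (f k)) t - v t) <= dyadic k `^ p].
Proof.
move=> Hw.
have [U [UU FU]] := @ultraFilterLemma nat \oo _.
have Sw n : S (w n) by case: (Hw n).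
have [u Hu] := @ultra_uniform_limit R alpha T p c0 M p1 ap a1 T0 c00 M0 sup_le U w UU Sw
  (fun n => let: And3 _ h _ := Hw n in h).
have /choice[s Hs] : forall k : nat, exists s : R, 0 < s /\ forall x y, critical s x -> critical s y ->
    (forall t, 0 <= t <= T -> `|x t - y t| <= s) -> E (x - y) <= dyadic k `^ p.
  move=> k; have dk : 0 < dyadic k `^ p :> R by rewrite powR_gt0// dyadic_gt0.
  have [s s0 Hs] := @almost_critical_cauchy R alpha T p C q c0 M g p1 ap a1 T0 C0 q1 c00 M0 sup_le mg cg
    g_growth _ dk.
  by exists s.
pose smin k := nat_rect (fun=> R) (s 0%N) (fun k r => Num.min r (s k.+1)) k.
have smin0 k : 0 < smin k.
  by elim: k => [|k IH] /=; [exact: (Hs 0%N).1|rewrite lt_min IH (Hs k.+1).1].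
have smin_dec k j : (k <= j)%N -> smin j <= smin k.
  elim: j => [|j IH]; first by rewrite leqn0 => /eqP ->.
  by rewrite leq_eqVlt ltnS => /orP[/eqP -> //|/IH h]; rewrite /= ge_min h.
have smins k : smin k <= s k by case: k => [|k] //=; rewrite ge_min lexx orbT.
have /choice[f Hf] : forall k : nat, exists n, [/\ (k <= n)%N, dyadic n <= smin k,
    forall t, `|w n t - u t| <= smin k / 2 & forall t, `|w n t - u t| <= dyadic k].
  move=> k; apply: (@filter_ex _ U).
  have H1 : \forall n \near U, (k <= n)%N by apply: FU; exact: nbhs_infty_ge.
  have H2 : \forall n \near U, dyadic n <= smin k by apply: FU; exact: near_dyadic_le.
  have H3 := Hu _ (divr_gt0 (smin0 k) (ltr0Sn _ 1)).
  have H4 := Hu _ (@dyadic_gt0 R k).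
  by near=> n; split; near: n.
have fu k t : `|w (f k) t - u t| <= dyadic k by case: (Hf k).
have mu' : measurable_fun setT u.
  apply: (@measurable_fun_cvg _ _ _ setT (fun k => w (f k))).
    by move=> k; exact: C0infty_measurable.
  move=> t _; apply/cvgrPdist_le => e e0; have := @near_dyadic_le R e e0.
  by apply: filterS => k; apply: le_trans; rewrite distrC.
have cauchy k j : (k <= j)%N ->
    Lp_mass T p (fun t => D (w (f j)) t - D (w (f k)) t) <= dyadic k `^ p.
  move=> kj; rewrite Lp_mass_deriveB//; have [_ Hk] := Hs k.
  have [_ dj uj _] := Hf j; have [_ dk uk _] := Hf k.
  have sj : smin j <= s k by rewrite (le_trans (smin_dec _ _ kj)).
  apply: Hk.
  - by apply: almost_critical_le (Hw _); exact: le_trans sj.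
  - by apply: almost_critical_le (Hw _); exact: le_trans (smins k).
  move=> t tT; rewrite -(subrK (u t) (w (f j) t)) -addrA.
  rewrite (le_trans (ler_normD _ _))// (splitr (s k)) lerD//.
    by rewrite (le_trans (uj t))// ler_pM2r.
  by rewrite distrC (le_trans (uk t))// ler_pM2r.
have [v [Lv vE]] := @riesz_fischer R T p p1 T0' (fun k => D (w (f k)))
  (fun k => Lp_fun_derive (Sw _)) cauchy.
by exists f, u, v; split => // k; case: (Hf k).
Unshelve. all: by end_near. Qed.

Section equation.
Variables (x : nat -> R -> R) (u v : R -> R).
Hypothesis xc : forall k, critical (dyadic k) (x k).
Hypothesis mu_ : measurable_fun setT u.
Hypothesis xu : forall k t, `|x k t - u t| <= dyadic k.
Hypothesis Lv : Lp_fun T p v.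
Hypothesis xv : forall k, Lp_mass T p (fun t => D (x k) t - v t) <= dyadic k `^ p.

Let Sx k : S (x k). Proof. by case: (xc k). Qed.
Let Mu := c0 * M + 1.

Lemma limit_bounded t : `|u t| <= Mu.
Proof.
rewrite -(subrK (x 0%N t) (u t)) (le_trans (ler_normD _ _))// addrC lerD//.
  by apply: (C0infty_bounded_everywhere c00 M0 sup_le) => //; case: (xc 0%N).
by rewrite distrC (le_trans (xu _ _))// dyadic_le1.
Qed.

Lemma limit_nonlinearity_bounded : bounded_mfun T (fun t => g t (u t)).
Proof.
have [K _ gK] := growth_bounded C0 q1 g_growth Mu.
by apply: (@bounded_mfun_comp _ T g mg cg u Mu K) => // t _; exact: limit_bounded.
Qed.

(* limits of the derivatives in L^p *)
Lemma mass_cvg (eps : R) : 0 < eps ->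
  \forall k \near \oo, Lp_mass T p (fun t => D (x k) t - v t) <= eps.
Proof.
move=> e0; have ep : 0 < eps `^ p^-1 by rewrite powR_gt0.
have := near_dyadic_le ep; apply: filterS => k ke.
rewrite (le_trans (xv k))// -(powRVK (ltW e0) (lt0r_neq0 p0)).
by rewrite ge0_ler_powR ?nnegrE ?powR_ge0 ?(ltW p0)// ltW// dyadic_gt0.
Qed.

Lemma nonlinear_pair_cvg (e : R -> R) (L : R) : bounded_mfun T e ->
  (forall t, 0 <= t <= T -> `|e t| <= L) -> forall eps, 0 < eps ->
  \forall k \near \oo, `|\int[mu]_(t in `[0, T]) (g t (x k t) * e t) -
    \int[mu]_(t in `[0, T]) (g t (u t) * e t)| <= eps.
Proof.
move=> be eL eps eps0.
have L0 : 0 <= L by apply: le_trans (eL 0 _) => //; rewrite lexx.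
have L1 : 0 < L + 1 by rewrite ltr_wpDl.
have [K K0 gK] := growth_bounded C0 q1 g_growth Mu.
have [d d0 [om [bom om_eps] gom]] :=
  caratheodory_modulus T0' K0 (divr_gt0 eps0 L1) mg cg gK.
have := near_dyadic_le d0; apply: filterS => k kd.
have xM t : `|x k t| <= Mu.
  rewrite (le_trans (C0infty_bounded_everywhere c00 M0 sup_le t (Sx k) _)) ?lerDl//.
  by case: (xc k).
have i1 : integrable_itv T (fun t => g t (x k t) * e t).
  apply: bounded_mfun_integrable; apply: bounded_mfunM => //.
  exact: (bounded_mfun_nonlinearity C0 q1 sup_le mg cg g_growth).
have i2 : integrable_itv T (fun t => g t (u t) * e t).
  apply: bounded_mfun_integrable; apply: bounded_mfunM => //.
  exact: limit_nonlinearity_bounded.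
have i3 := integrable_itvZ (L + 1) (bounded_mfun_integrable bom).
rewrite -(integral_itvB i1 i2) (le_trans (integral_itv_norm (integrable_itvB i1 i2)))//.
apply: (@le_trans _ _ (\int[mu]_(t in `[0, T]) ((L + 1) * om t))); last first.
  rewrite integral_itvZ; last exact: bounded_mfun_integrable.
  by rewrite mulrC -ler_pdivlMr.
apply: integral_itv_le => //; first by apply: integrable_itv_norm; exact: integrable_itvB.
move=> t tT; rewrite -mulrBl normrM mulrC ler_pM//.
  by rewrite (le_trans (eL t tT))// lerDl.
by apply: gom => //; [exact: limit_bounded|exact: le_trans kd].
Qed.

Lemma limit_equation e : S e -> \int[mu]_(t in `[0, T]) (dualmap p (v t) * D e t) =
  \int[mu]_(t in `[0, T]) (g t (u t) * e t).
Proof.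
move=> Se; apply/eqP; rewrite -subr_eq0 -normr_le0; apply/ler_addgt0Pr => k k0.
rewrite add0r.
have Mp0 := powR_ge0 M p; have v0 := @Lp_mass_ge0 _ T p v; have Ee0 := energy_ge0 alpha T p e.
pose A := M `^ p + Lp_mass T p v + E e + 1.
have A0 : 0 < A by rewrite ltr_wpDl// !addr_ge0.
have k30 : 0 < k / 4 by rewrite divr_gt0.
have [B B0 HB] := @Lp_pair_continuous R T p p1 _ (divr_gt0 k30 A0).
have Nle : 0 < N e + 1 by rewrite ltr_wpDl// energy_norm_ge0.
have H1 := mass_cvg (divr_gt0 k30 B0).
have H2 := nonlinear_pair_cvg (C0infty_bounded_mfun T0 Se) (fun t => sup_le Se) k30.
have H3 := near_dyadic_le (divr_gt0 k30 Nle).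
have ar (I1 I2 J1 J2 : R) : `|I1 - I2| <= k / 4 + k / 4 -> `|J1 - J2| <= k / 4 ->
    `|I1 - J1| <= k / 4 -> `|I2 - J2| <= k.
  rewrite !ler_norml => /andP[h1 h2] /andP[h3 h4] /andP[h5 h6].
  by apply/andP; split; lra.
near \oo => n.
have K1 : Lp_mass T p (fun t => D (x n) t - v t) <= k / 4 / B by near: n.
have K2 : `|\int[mu]_(t in `[0, T]) (g t (x n t) * e t) -
    \int[mu]_(t in `[0, T]) (g t (u t) * e t)| <= k / 4 by near: n.
have K3 : dyadic n <= k / 4 / (N e + 1) by near: n.
have [_ Nx Hx] := xc n.
apply: (ar (\int[mu]_(t in `[0, T]) (dualmap p (D (x n) t) * D e t)) _
  (\int[mu]_(t in `[0, T]) (g t (x n t) * e t))) => //.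
  rewrite (le_trans (HB _ _ _ (Lp_fun_derive (Sx n)) Lv (Lp_fun_derive Se)))//.
  rewrite lerD//; last by rewrite mulrC -ler_pdivlMr.
  rewrite !Lp_mass_derive -[leRHS](divfK (lt0r_neq0 A0)) ler_pM2l ?divr_gt0//.
  have : E (x n) <= M `^ p by rewrite -energy_norm_leE.
  by rewrite /A; move: (E _) (E _) (Lp_mass _ _ _) => u1 u2 u3 h; lra.
by rewrite (le_trans (Hx e Se))// -ler_pdivlMr.
Unshelve. all: by end_near. Qed.

End equation.

End limit.

Lemma cvg_EFin0 {R : realType} (h : nat -> \bar R) (z : nat -> R) :
  (forall k, h k = (z k)%:E) -> z @ \oo --> 0 -> h @ \oo --> 0%E.
Proof.
move=> hz z0; have -> : h = EFin \o z by apply/funext => k; rewrite /= hz.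
by apply: cvg_EFin => //; exact: nearW.
Qed.

Section closure.
Context {R : realType}.
Local Notation mu := (@lebesgue_measure R).
Variables (alpha T p : R).
Hypothesis p1 : 1 < p.
Hypothesis ap : p^-1 < alpha.
Hypothesis a1 : alpha < 1.
Hypothesis T0 : 0 < T.

Local Notation D := (frac_derive alpha).
Local Notation S := (C0infty T).
Local Notation E := (energy alpha T p).
Local Notation N := (energy_norm alpha T p).

Let p0 : 0 < p. Proof. exact: lt_trans p1. Qed.
Let T0' : 0 <= T. Proof. exact: ltW. Qed.
Let alpha01 : 0 < alpha < 1.
Proof. by rewrite a1 andbT (lt_trans _ ap)// invr_gt0. Qed.
Let mT : measurable (`[0, T]%classic : set (measurableTypeR R)).
Proof. exact: measurable_itv. Qed.

Lemma in_LpP h : in_Lp p T h <-> Lp_fun T p h.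
Proof.
split=> [[mh hoo]|[mh ih]]; split => //.
  apply/integrableP; split.
    by apply/measurable_EFinP; exact: measurable_norm_powR.
  by under eq_integral do rewrite /= ger0_norm ?powR_ge0//.
by rewrite (integrable_itv_fin ih) ltry.
Qed.

Lemma Lp_fun_C0infty w : S w -> Lp_fun T p w.
Proof. by move=> Sw; apply: Lp_fun_bounded => //; exact: C0infty_bounded_mfun. Qed.

Lemma E0_normE u v : Lp_fun T p u -> Lp_fun T p v ->
  E0_norm p T u v = ((Lp_mass T p u + Lp_mass T p v) `^ p^-1)%:E.
Proof.
move=> [mu_ iu] [mv iv].
by rewrite /E0_norm (integrable_itv_fin iu) (integrable_itv_fin iv) -EFinD poweR_EFin.
Qed.

Lemma E0_limit_approx u v : Lp_fun T p u -> Lp_fun T p v -> E0_limit alpha p T u v ->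
  exists2 w : nat -> R -> R, forall k, S (w k) & forall eps, 0 < eps ->
    \forall k \near \oo, Lp_mass T p (fun t => w k t - u t) <= eps /\
                         Lp_mass T p (fun t => D (w k) t - v t) <= eps.
Proof.
move=> Lu Lv [w Sw wu]; exists w => // eps e0.
have Lwu k : Lp_fun T p (fun t => w k t - u t).
  by apply: Lp_funB => //; exact: Lp_fun_C0infty.
have Lwv k : Lp_fun T p (fun t => D (w k) t - v t).
  by apply: Lp_funB => //; exact: (Lp_fun_derive p1 ap a1 T0).
pose z k := (Lp_mass T p (fun t => w k t - u t) +
             Lp_mass T p (fun t => D (w k) t - v t)) `^ p^-1.
have zE : (fun k => E0_norm p T (w k \- u) (left_RL_derivative alpha (w k) \- v)) = EFin \o z.
  apply/funext => k; rewrite /= /z -(E0_normE (Lwu k) (Lwv k)).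
  by rewrite frac_derive.unlock.
rewrite zE in wu; have {}wu : z @ \oo --> 0 by exact: fine_cvg wu.
have ep : 0 < eps `^ p^-1 by rewrite powR_gt0.
have zlt : \forall k \near \oo, z k < eps `^ p^-1 by exact: (cvgr_lt _ wu _ ep).
apply: filterS zlt => k zk.
have m1 := @Lp_mass_ge0 _ T p (fun t => w k t - u t).
have m2 := @Lp_mass_ge0 _ T p (fun t => D (w k) t - v t).
have : Lp_mass T p (fun t => w k t - u t) + Lp_mass T p (fun t => D (w k) t - v t) <= eps.
  rewrite -(powRVK (addr_ge0 m1 m2) (lt0r_neq0 p0)) -(powRVK (ltW e0) (lt0r_neq0 p0)).
  by rewrite ge0_ler_powR ?nnegrE ?powR_ge0 ?(ltW p0)// ltW.
by move=> h; split;
  [exact: le_trans (ler_wpDr m2 (lexx _)) h|exact: le_trans (ler_wpDl m1 (lexx _)) h].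
Qed.

Lemma E0_limitI (x : nat -> R -> R) u v : (forall k, S (x k)) ->
  Lp_fun T p u -> Lp_fun T p v ->
  (forall k t, `|x k t - u t| <= dyadic k) ->
  (forall k, Lp_mass T p (fun t => D (x k) t - v t) <= dyadic k `^ p) ->
  E0_limit alpha p T u v.
Proof.
move=> Sx Lu Lv xu xv; exists x => //.
have Lxu k : Lp_fun T p (fun t => x k t - u t).
  by apply: Lp_funB => //; exact: Lp_fun_C0infty.
have Lxv k : Lp_fun T p (fun t => D (x k) t - v t).
  by apply: Lp_funB => //; exact: (Lp_fun_derive p1 ap a1 T0).
apply: (@cvg_EFin0 _ _ (fun k => (Lp_mass T p (fun t => x k t - u t) +
             Lp_mass T p (fun t => D (x k) t - v t)) `^ p^-1)).
  by move=> k; rewrite -(E0_normE (Lxu k) (Lxv k)) frac_derive.unlock.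
apply: (@dyadic_cvg_le _ _ ((T + 1) `^ p^-1)); first exact: powR_ge0.
move=> k; rewrite powR_ge0/=.
have d0 := @dyadic_gt0 R k.
have m1 := @Lp_mass_ge0 _ T p (fun t => x k t - u t).
have m2 := @Lp_mass_ge0 _ T p (fun t => D (x k) t - v t).
have h1 : Lp_mass T p (fun t => x k t - u t) <= dyadic k `^ p * T.
  rewrite -(integral_itv_cst _ T0'); apply: integral_itv_le; first exact: (Lxu k).2.
    exact/bounded_mfun_integrable/bounded_mfun_cst.
  by move=> t _; rewrite ge0_ler_powR ?nnegrE ?(ltW p0)// ltW.
have h : Lp_mass T p (fun t => x k t - u t) + Lp_mass T p (fun t => D (x k) t - v t) <=
    (T + 1) * dyadic k `^ p.
  by rewrite mulrDl mul1r lerD// mulrC.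
have -> : (T + 1) `^ p^-1 * dyadic k = ((T + 1) * dyadic k `^ p) `^ p^-1.
  rewrite powRM ?powR_ge0 ?addr_ge0// -powRrM mulfV ?gt_eqF// powRr1//.
  exact: ltW.
have p0' : 0 <= p^-1 by rewrite invr_ge0 ltW.
have r0 : 0 <= (T + 1) * dyadic k `^ p by rewrite mulr_ge0 ?powR_ge0// addr_ge0.
exact: (ge0_ler_powR p0' (addr_ge0 m1 m2) r0 h).
Qed.

(** Fractional integrals of order [1 - alpha] are controlled by the essential
supremum. *)
Lemma rlint_le (A : set (measurableTypeR R)) a eps t : measurable A -> mu A = 0%E ->
  S a -> 0 <= eps -> 0 <= t <= T -> (forall s, 0 <= s <= T -> ~ A s -> `|a s| <= eps) ->
  `|rlint alpha a t| <= eps * (t `^ (- alpha + 1) / (- alpha + 1)).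
Proof.
move=> mA A0 Sa e0 tT ae; have /andP[t0 tT'] := tT.
have b1 : -1 < - alpha by rewrite ltrN2.
have [ik Ek] := integral_kern_itv b1 tT.
have ma : measurable_fun `[0, T] a by case: (C0infty_bounded_mfun T0 Sa).
pose a' s := Num.max (- eps) (Num.min eps (a s)).
have a'e s : `|a' s| <= eps.
  by rewrite ler_norml /a' le_max lexx ge_max ge_min lexx/= andbT; lra.
have a'E s : 0 <= s <= T -> ~ A s -> a' s = a s.
  move=> sT As; have := ae s sT As; rewrite ler_norml => /andP[h1 h2].
  by rewrite /a' (min_idPr h2) (max_idPr h1).
have ma' : measurable_fun `[0, T] a'.
  by apply: measurable_maxr; [exact: measurable_cst|apply: measurable_minr => //; exact: measurable_cst].
have an0 : - alpha != 0 by rewrite oppr_eq0 gt_eqF//; case/andP: alpha01.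
have -> : rlint alpha a t = \int[mu]_(s in `[0, T]) (kern (- alpha) (t - s) * a s).
  rewrite /rlint Rintegral_mkcond [RHS]Rintegral_mkcond (@patch_itv _ T t)//; last first.
    by move=> s ts; rewrite kern_le0 ?mul0r// subr_le0 ltW.
  congr (fine _); apply: eq_integral => s _; rewrite !patchE; case: ifPn => //.
  by rewrite inE/= in_itv/= => /andP[_ st]; rewrite kern_ge0E// subr_ge0.
rewrite (integral_off_null mT mA A0 (h2 := fun s => kern (- alpha) (t - s) * a' s)); last first.
  by move=> s; rewrite /= in_itv/= => sT As; rewrite a'E.
have ia' : integrable_itv T (fun s => kern (- alpha) (t - s) * a' s).
  by apply: (@integrable_bounded_mul _ _ (fun s => kern (- alpha) (t - s)) _ eps).
rewrite (le_trans (integral_itv_norm ia'))// -Ek -integral_itvZ//.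
apply: integral_itv_le; [exact: integrable_itv_norm|exact: integrable_itvZ|].
by move=> s _; rewrite normrM ger0_norm ?kern_ge0// mulrC ler_wpM2r ?kern_ge0.
Qed.

Lemma integral_prefix_eq0 (h : R -> R) : integrable_itv T h ->
  (forall t, 0 <= t <= T -> \int[mu]_(s in `[0, t]) h s = 0) ->
  exists2 A : set (measurableTypeR R), measurable A /\ mu A = 0%E &
    forall t, 0 <= t <= T -> ~ A t -> h t = 0.
Proof.
move=> ih h0; pose H : R -> R := h \_ `[0, T].
have iH : mu.-integrable setT (EFin \o H).
  by rewrite /H -restrict_EFin; apply: (iffLR (integrable_mkcond _ mT)).
have locH : locally_integrable setT H by exact: integrable_locally mT ih.
have iHy y : mu.-integrable [set` Interval (BLeft 0) (BRight y)] (EFin \o H).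
  apply: integrableS iH => //; exact: measurable_itv.
have [A [mA A0 HA]] := FTC1 iHy locH.
exists (A `|` ([set 0] `|` [set T])).
  have m2 : measurable ([set 0] `|` [set T] : set (measurableTypeR R)).
    by apply: measurableU; exact: measurable_set1.
  split; first exact: measurableU.
  apply/eqP; rewrite -measure_le0.
  have s0 z : (mu ([set z] : set (measurableTypeR R)) <= 0)%E.
    by have := @lebesgue_measure_set1 R z; rewrite /= => ->.
  have m0 : mu ([set 0] `|` [set T]) = 0%E.
    apply/eqP; rewrite -measure_le0.
    have := measureU2 mu (measurable_set1 (0 : measurableTypeR R)) (measurable_set1 T).
    move=> /le_trans; apply; have := leeD (s0 0) (s0 T).
    by rewrite adde0.
  have A0' : (mu A <= 0)%E by have := lexx (0%E : \bar R); rewrite -{1}A0.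
  have m0' : (mu ([set 0%R] `|` [set T]) <= 0)%E.
    by have := lexx (0%E : \bar R); rewrite -{1}m0.
  have := measureU2 mu mA m2; move=> /le_trans; apply.
  by have := leeD A0' m0'; rewrite adde0.
move=> t /andP[t0 tT] nA.
have t00 : 0 < t.
  by rewrite lt_neqAle t0 andbT; apply/eqP => t0'; apply: nA; right; left.
have tTT : t < T.
  by rewrite lt_neqAle tT andbT; apply/eqP => t0'; apply: nA; right; right.
have nAt : ~ A t by move=> At; apply: nA; left.
have /contrapT Ft := contra_not (@HA t) nAt.
have [|_] := Ft.
  by rewrite /= lte_fin.
have -> : H t = h t by rewrite /H patchE mem_set//= in_itv/= t0 tT.
move=> <-; rewrite derive1E.
have nearc : \forall x \near t, cst (0 : R) x = \int[mu]_(s in `[0, x]) H s.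
  have := @near_in_itvoo R 0 T t.
  rewrite in_itv/= t00 tTT => /(_ isT); apply: filterS => x.
  rewrite in_itv/= => /andP[x0 xT]; have xT2 : 0 <= x <= T by rewrite !ltW.
  apply: (etrans (esym (h0 x xT2))); apply: eq_Rintegral => s; rewrite inE/= in_itv/= => /andP[s0 sx].
  by rewrite /H patchE mem_set//= in_itv/= s0 (le_trans sx (ltW xT)).
by rewrite -(near_eq_derive _ nearc) derive_cst.
Qed.

End closure.

Section closability.
Context {R : realType}.
Local Notation mu := (@lebesgue_measure R).
Variables (alpha T p : R).
Hypothesis p1 : 1 < p.
Hypothesis ap : p^-1 < alpha.
Hypothesis a1 : alpha < 1.
Hypothesis T0 : 0 < T.

Local Notation D := (frac_derive alpha).
Local Notation S := (C0infty T).
Local Notation E := (energy alpha T p).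

Let p0 : 0 < p. Proof. exact: lt_trans p1. Qed.
Let T0' : 0 <= T. Proof. exact: ltW. Qed.
Let alpha01 : 0 < alpha < 1.
Proof. by rewrite a1 andbT (lt_trans _ ap)// invr_gt0. Qed.
Let mT : measurable (`[0, T]%classic : set (measurableTypeR R)).
Proof. exact: measurable_itv. Qed.
Let two_p : 0 < 2 `^ p :> R. Proof. by rewrite powR_gt0. Qed.

Lemma prefix_integral (h : R -> R) t : 0 <= t <= T ->
  \int[mu]_(s in `[0, t]) h s = \int[mu]_(s in `[0, T]) (\1_(`[0, t]%classic) s * h s).
Proof.
move=> /andP[t0 tT]; rewrite Rintegral_mkcond [RHS]Rintegral_mkcond.
congr (fine _); apply: eq_integral => s _; rewrite !patchE indicE.
case: ifPn => st; last by rewrite mul0r; case: ifP.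
rewrite mul1r mem_set//; move: st; rewrite inE/= !in_itv/= => /andP[-> st].
exact: le_trans tT.
Qed.

Section null_limit.
Variables (a : nat -> R -> R) (h : R -> R).
Hypothesis Sa : forall k, S (a k).
Hypothesis Lh : Lp_fun T p h.
Hypothesis ah : forall eps, 0 < eps -> \forall k \near \oo,
  Lp_mass T p (a k) <= eps /\ Lp_mass T p (fun t => D (a k) t - h t) <= eps.

(* the sequence is uniformly Cauchy, and its limit in L^p is zero *)
Lemma null_limit_sup (eps : R) : 0 < eps -> \forall k \near \oo,
  exists2 A : set (measurableTypeR R), measurable A /\ mu A = 0%E &
    forall s, 0 <= s <= T -> ~ A s -> `|a k s| <= eps.
Proof.
move=> e0; have [c c0 Hc] := sup_le_energy p1 ap a1 T0.
have ec : 0 < (eps / c) `^ p by rewrite powR_gt0// divr_gt0.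
pose eta := (eps / c) `^ p / (2 `^ p * 2).
have eta0 : 0 < eta by rewrite divr_gt0// mulr_gt0.
have [K _ HK] := ah eta0.
have LD k : Lp_fun T p (fun t => D (a k) t - h t).
  by apply: Lp_funB => //; exact: (Lp_fun_derive p1 ap a1 T0).
have cauchy j k t : (K <= j)%N -> (K <= k)%N -> 0 <= t <= T -> `|a j t - a k t| <= eps.
  move=> Kj Kk tT; have [_ mj] := HK _ Kj; have [_ mk] := HK _ Kk.
  have Sjk := C0inftyB (Sa j) (Sa k).
  have Ejk : E (a j - a k) <= (eps / c) `^ p.
    rewrite -(Lp_mass_deriveB p1 ap a1 T0 (Sa j) (Sa k)).
    have -> : Lp_mass T p (fun t => D (a j) t - D (a k) t) =
        Lp_mass T p (fun t => (D (a j) t - h t) + - (D (a k) t - h t)).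
      by apply: integral_itv_eq => s _; congr (`|_| `^ p); ring.
    rewrite (le_trans (Lp_massD p1 (LD j) (Lp_funN (LD k))))//.
    have -> : Lp_mass T p (fun t => - (D (a k) t - h t)) =
        Lp_mass T p (fun t => D (a k) t - h t).
      by apply: integral_itv_eq => s _; rewrite normrN.
    rewrite -ler_pdivlMl// (le_trans (lerD mj mk))//.
    have -> : eta + eta = (2 `^ p)^-1 * (eps / c) `^ p by rewrite /eta; field; rewrite gt_eqF.
    by [].
  have := Hc _ _ Sjk tT; rewrite [leLHS]/= => /le_trans; apply.
  rewrite mulrC -ler_pdivlMr// -(@powRVK _ (eps / c) p^-1) ?invr_neq0 ?gt_eqF//; last first.
    by rewrite ltW// divr_gt0.
  by rewrite invrK ge0_ler_powR ?nnegrE ?invr_ge0 ?(ltW p0) ?energy_ge0 ?powR_ge0.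
exists K => // k /= Kk.
pose f s := Num.max 0 (`|a k s| - eps).
have bak := C0infty_bounded_mfun T0 (Sa k).
have mf : measurable_fun `[0, T] f.
  apply: measurable_maxr; first exact: measurable_cst.
  apply: measurable_funB; last exact: measurable_cst.
  by apply: measurableT_comp => //; case: bak.
have fle (X : R) (z : R) : `|a k z| - eps <= X -> 0 <= X -> `|f z| <= X.
  by move=> h1 h2; rewrite /f ger0_norm ?le_max ?lexx// ge_max h2.
have fj j z : (K <= j)%N -> 0 <= z <= T -> `|f z| `^ p <= `|a j z| `^ p.
  move=> Kj zT; rewrite ge0_ler_powR ?nnegrE ?(ltW p0)//; apply: fle => //.
  rewrite lerBlDl -(subrK (a j z) (a k z)) (le_trans (ler_normD _ _))// lerD2r.
  exact: cauchy.
have iaj j := (Lp_fun_C0infty p1 T0 (Sa j)).2.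
have iff_ : integrable_itv T (fun s => `|f s| `^ p).
  apply: integrable_itv_le (iaj k); first exact: measurable_norm_powR.
  by move=> z zT; rewrite ger0_norm ?powR_ge0//; exact: fj.
have f0 : Lp_mass T p f = 0.
  apply/eqP; rewrite eq_le Lp_mass_ge0 andbT; apply/ler_addgt0Pr => e e_gt0.
  rewrite add0r; have [J _ HJ] := ah e_gt0.
  have [h1 _] := HJ (maxn J K) (leq_maxl _ _); apply: le_trans h1.
  by apply: integral_itv_le => // z zT; apply: fj => //; exact: leq_maxr.
have [A A0 HA] := integral_itv_eq0 iff_ (fun t _ => powR_ge0 _ _) f0.
exists A => // s sT As; have /eqP := HA s sT As.
rewrite powR_eq0 normr_eq0 => /andP[/eqP fs _].
by rewrite -subr_le0 -fs /f le_max lexx orbT.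
Qed.

(** Closability of the fractional derivative: its primitive is a fractional
integral, a bounded operator, so that the limit of the derivatives of a null
sequence has a vanishing primitive. *)
Lemma null_limit_derivative : exists2 A : set (measurableTypeR R),
  measurable A /\ mu A = 0%E & forall t, 0 <= t <= T -> ~ A t -> h t = 0.
Proof.
have [B1 _ H1] := @Lp_mass_integral R T p p1 T0' 1 ltr01.
have [ih _] := H1 _ Lh.
apply: (integral_prefix_eq0 ih) => t tT; have /andP[t0 _] := tT.
apply/eqP; rewrite -normr_le0; apply/ler_addgt0Pr => k k0; rewrite add0r.
have k30 : 0 < k / 3 by rewrite divr_gt0.
pose Ga := (Gamma (1 - alpha))^-1.
pose X := t `^ (- alpha + 1) / (- alpha + 1).
have X0 : 0 <= X.
  by rewrite divr_ge0 ?powR_ge0// addrC subr_ge0 ltW.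
have GX : 0 < `|Ga| * X + 1 by rewrite ltr_wpDl// mulr_ge0.
have T1 : 0 < T + 1 by rewrite addr_gt0.
have [B B0 HB] := @Lp_mass_integral R T p p1 T0' _ (divr_gt0 k30 T1).
have N1 := null_limit_sup (divr_gt0 k30 GX).
have N2 := ah (divr_gt0 k30 B0).
near \oo => n.
have [A [mA A0] HA] : exists2 A : set (measurableTypeR R), measurable A /\ mu A = 0%E &
    forall s, 0 <= s <= T -> ~ A s -> `|a n s| <= k / 3 / (`|Ga| * X + 1) by near: n.
have [_ mn] : Lp_mass T p (a n) <= k / 3 / B /\
    Lp_mass T p (fun t => D (a n) t - h t) <= k / 3 / B by near: n.
have e1 : 0 <= k / 3 / (`|Ga| * X + 1) by rewrite ltW// divr_gt0.
have hr := rlint_le p1 ap a1 T0 mA A0 (Sa n) e1 tT HA.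
have LDh : Lp_fun T p (fun t => D (a n) t - h t).
  by apply: Lp_funB => //; exact: (Lp_fun_derive p1 ap a1 T0).
have [iDh hDh] := HB _ LDh.
have bI : bounded_mfun T (\1_(`[0, t]%classic) : R -> R).
  split; last by exists 1 => s _; rewrite indicE; case: (_ \in _); rewrite ?normr1 ?normr0.
  by apply: measurable_indic; exact: measurable_itv.
have intI (f : R -> R) : integrable_itv T f ->
    integrable_itv T (fun s => \1_(`[0, t]%classic) s * f s).
  move=> jf; apply: (integrable_itv_le _ _ (integrable_itv_norm jf)).
    apply: measurable_funM; first by case: bI.
    by case/integrableP: jf => /measurable_EFinP.
  move=> s _; rewrite normrM indicE; case: (_ \in _); rewrite ?normr1 ?normr0 ?mul1r ?mul0r//.
have iD : integrable_itv T (D (a n)).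
  exact/bounded_mfun_integrable/(bounded_mfun_derive p1 ap a1 T0).
have ED : \int[mu]_(s in `[0, T]) (\1_(`[0, t]%classic) s * D (a n) s) = Ga * rlint alpha (a n) t.
  by rewrite -prefix_integral// frac_derive.unlock (integral_RLd alpha01 T0 (Sa n) tT).
rewrite prefix_integral//.
have -> : \int[mu]_(s in `[0, T]) (\1_(`[0, t]%classic) s * h s) =
    Ga * rlint alpha (a n) t -
    \int[mu]_(s in `[0, T]) (\1_(`[0, t]%classic) s * (D (a n) s - h s)).
  rewrite -ED -(integral_itvB (intI _ iD) (intI _ iDh)).
  by apply: integral_itv_eq => s _; ring.
rewrite (le_trans (ler_normB _ _))//.
have -> : k = k / 3 + (k / 3 + k / 3) by field.
apply: lerD.
  rewrite normrM (le_trans (ler_wpM2l (normr_ge0 _) hr))// -/X mulrCA.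
  rewrite -[leRHS](divfK (lt0r_neq0 GX)) ler_wpM2l// lerDl.
  by [].
rewrite (le_trans (integral_itv_norm (intI _ iDh)))//.
apply: (@le_trans _ _ (\int[mu]_(s in `[0, T]) `|D (a n) s - h s|)).
  apply: integral_itv_le.
  - exact: integrable_itv_norm (intI _ iDh).
  - exact: integrable_itv_norm.
  move=> s _; rewrite normrM indicE.
  by case: (_ \in _); rewrite ?normr1 ?normr0 ?mul1r ?mul0r.
rewrite (le_trans hDh)// lerD//.
  by rewrite mulrAC ler_pdivrMr// ler_pM2l// lerDl.
by rewrite mulrC -ler_pdivlMr.
Unshelve. all: by end_near. Qed.

End null_limit.

Lemma E0_limit_unique u v1 v2 : Lp_fun T p u -> Lp_fun T p v1 -> Lp_fun T p v2 ->
  E0_limit alpha p T u v1 -> E0_limit alpha p T u v2 ->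
  exists2 A : set (measurableTypeR R), measurable A /\ mu A = 0%E &
    forall t, 0 <= t <= T -> ~ A t -> v1 t = v2 t.
Proof.
move=> Lu L1 L2 /(E0_limit_approx p1 ap a1 T0 Lu L1)[w1 S1 H1].
move=> /(E0_limit_approx p1 ap a1 T0 Lu L2)[w2 S2 H2].
have Sa k : S (w1 k - w2 k) by exact: C0inftyB.
have [||A A0 HA] := @null_limit_derivative (fun k => w1 k - w2 k) (fun t => v1 t - v2 t) Sa.
- exact: Lp_funB.
- move=> eps e0; have e20 : 0 < eps / (2 `^ p * 2) by rewrite divr_gt0// mulr_gt0.
  have ar (z1 z2 : R -> R) : Lp_fun T p z1 -> Lp_fun T p z2 ->
      Lp_mass T p z1 <= eps / (2 `^ p * 2) -> Lp_mass T p z2 <= eps / (2 `^ p * 2) ->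
      Lp_mass T p (fun t => z1 t + - z2 t) <= eps.
    move=> Lz1 Lz2 h1 h2; rewrite (le_trans (Lp_massD p1 Lz1 (Lp_funN Lz2)))//.
    have -> : Lp_mass T p (fun t => - z2 t) = Lp_mass T p z2.
      by apply: integral_itv_eq => s _; rewrite normrN.
    rewrite -ler_pdivlMl// (le_trans (lerD h1 h2))//.
    have -> : eps / (2 `^ p * 2) + eps / (2 `^ p * 2) = (2 `^ p)^-1 * eps.
      by field; rewrite gt_eqF.
    by [].
  apply: filterS2 (H1 _ e20) (H2 _ e20) => k [h11 h12] [h21 h22]; split.
    have -> : Lp_mass T p (w1 k - w2 k) =
        Lp_mass T p (fun t => (w1 k t - u t) + - (w2 k t - u t)).
      apply: integral_itv_eq => s _; congr (`|_| `^ p).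
      by rewrite opprB addrA subrK.
    by apply: ar => //; apply: Lp_funB => //; exact: Lp_fun_C0infty.
  have -> : Lp_mass T p (fun t => D (w1 k - w2 k) t - (v1 t - v2 t)) =
      Lp_mass T p (fun t => (D (w1 k) t - v1 t) + - (D (w2 k) t - v2 t)).
    apply: integral_itv_eq => s sT; congr (`|_| `^ p).
    by rewrite (frac_deriveB p1 ap a1 T0)//; ring.
  by apply: ar => //; apply: Lp_funB => //; exact: (Lp_fun_derive p1 ap a1 T0).
by exists A => // t tT At; apply/eqP; rewrite -subr_eq0; apply/eqP; exact: HA.
Qed.

(** A weak equation tested on smooth functions extends to their closure. *)
Lemma weak_equation_closure v G phi psi : Lp_fun T p v -> bounded_mfun T G ->
  Lp_fun T p phi -> Lp_fun T p psi -> E0_limit alpha p T phi psi ->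
  (forall e, S e -> \int[mu]_(t in `[0, T]) (dualmap p (v t) * D e t) =
                    \int[mu]_(t in `[0, T]) (G t * e t)) ->
  \int[mu]_(t in `[0, T]) (dualmap p (v t) * psi t) = \int[mu]_(t in `[0, T]) (G t * phi t).
Proof.
move=> Lv bG Lphi Lpsi /(E0_limit_approx p1 ap a1 T0 Lphi Lpsi)[w Sw Hw] eqS.
apply/eqP; rewrite -subr_eq0 -normr_le0; apply/ler_addgt0Pr => k k0; rewrite add0r.
have ar (x y z : R) : x - y = (z - y) - (z - x) by ring.
have [mG [K GK]] := bG.
have K0 : 0 <= K by apply: le_trans (GK 0 _); rewrite ?lexx.
have k40 : 0 < k / 4 by rewrite divr_gt0.
have mv0 := @Lp_mass_ge0 _ T p v.
have mv1 : 0 < Lp_mass T p v + 1 by rewrite ltr_wpDl.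
have [B1 B10 H1] := @Lp_pair_le R T p p1 _ (divr_gt0 k40 mv1).
have KT : 0 < K * T + 1 by rewrite ltr_wpDl// mulr_ge0.
have [B2 B20 H2] := @Lp_mass_integral R T p p1 T0' _ (divr_gt0 k40 KT).
have KB : 0 < K * B2 + 1 by rewrite ltr_wpDl// mulr_ge0// ltW.
have N1 := Hw _ (divr_gt0 k40 B10); have N2 := Hw _ (divr_gt0 k40 KB).
near \oo => n.
have [_ m1] : Lp_mass T p (fun t => w n t - phi t) <= k / 4 / B1 /\
  Lp_mass T p (fun t => D (w n) t - psi t) <= k / 4 / B1 by near: n.
have [m2 _] : Lp_mass T p (fun t => w n t - phi t) <= k / 4 / (K * B2 + 1) /\
  Lp_mass T p (fun t => D (w n) t - psi t) <= k / 4 / (K * B2 + 1) by near: n.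
have LDw := Lp_fun_derive p1 ap a1 T0 (Sw n).
have Lw := Lp_fun_C0infty p1 T0 (Sw n).
have Ld := Lp_funB p1 LDw Lpsi; have Ldw := Lp_funB p1 Lw Lphi.
have [iw hw] := H2 _ Ldw.
have [iphi _] := H2 _ Lphi; have [iwn _] := H2 _ Lw.
have intG (z : R -> R) : integrable_itv T z -> integrable_itv T (fun t => G t * z t).
  move=> iz; apply: (integrable_itv_le _ _ (integrable_itvZ K (integrable_itv_norm iz))).
    by apply: measurable_funM => //; case/integrableP: iz => /measurable_EFinP.
  by move=> t tT; rewrite normrM ler_wpM2r ?GK.
have -> : \int[mu]_(t in `[0, T]) (dualmap p (v t) * psi t) -
    \int[mu]_(t in `[0, T]) (G t * phi t) =
    \int[mu]_(t in `[0, T]) (G t * (w n t - phi t)) -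
    \int[mu]_(t in `[0, T]) (dualmap p (v t) * (D (w n) t - psi t)).
  have -> : \int[mu]_(t in `[0, T]) (G t * (w n t - phi t)) =
      \int[mu]_(t in `[0, T]) (G t * w n t) - \int[mu]_(t in `[0, T]) (G t * phi t).
    rewrite -(integral_itvB (intG _ iwn) (intG _ iphi)).
    by apply: integral_itv_eq => t _; rewrite mulrBr.
  have -> : \int[mu]_(t in `[0, T]) (dualmap p (v t) * (D (w n) t - psi t)) =
      \int[mu]_(t in `[0, T]) (dualmap p (v t) * D (w n) t) -
      \int[mu]_(t in `[0, T]) (dualmap p (v t) * psi t).
    rewrite -(integral_itvB (integrable_Lp_pair p1 Lv LDw) (integrable_Lp_pair p1 Lv Lpsi)).
    by apply: integral_itv_eq => t _; rewrite mulrBr.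
  rewrite (eqS _ (Sw n)); exact: ar.
rewrite (le_trans (ler_normB _ _))//.
have -> : k = (k / 4 + k / 4) + (k / 4 + k / 4) by field.
apply: lerD; last first.
  rewrite (le_trans (H1 _ _ Lv Ld))// lerD//; last by rewrite mulrC -ler_pdivlMr.
  by rewrite mulrAC ler_pdivrMr// ler_pM2l// lerDl.
rewrite (le_trans (integral_itv_norm (intG _ iw)))//.
have iK := integrable_itvZ K (integrable_itv_norm iw).
apply: (@le_trans _ _ (\int[mu]_(t in `[0, T]) (K * `|w n t - phi t|))).
  apply: integral_itv_le => //; first exact: integrable_itv_norm (intG _ iw).
  by move=> t tT; rewrite normrM ler_wpM2r ?GK.
rewrite integral_itvZ; last exact: integrable_itv_norm.
rewrite (le_trans (ler_wpM2l K0 hw))// mulrDr lerD//.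
  by rewrite mulrCA mulrAC ler_pdivrMr// ler_pM2l// lerDl.
rewrite mulrA; apply: (@le_trans _ _ ((K * B2 + 1) * (k / 4 / (K * B2 + 1)))).
  by rewrite ler_pM ?mulr_ge0 ?(ltW B20) ?Lp_mass_ge0// lerDl.
by rewrite mulrC divfK ?gt_eqF.
Unshelve. all: by end_near. Qed.

End closability.

Section nontriviality.
Context {R : realType}.
Local Notation mu := (@lebesgue_measure R).
Variables (alpha T p C q c0 M : R) (g : R -> R -> R).
Hypothesis p1 : 1 < p.
Hypothesis ap : p^-1 < alpha.
Hypothesis a1 : alpha < 1.
Hypothesis T0 : 0 < T.
Hypothesis C0 : 0 < C.
Hypothesis q1 : 1 <= q.
Hypothesis c00 : 0 < c0.
Hypothesis M0 : 0 <= M.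

Local Notation D := (frac_derive alpha).
Local Notation S := (C0infty T).
Local Notation E := (energy alpha T p).
Local Notation N := (energy_norm alpha T p).
Local Notation F t := (primitive0 (g t)).
Local Notation Phi := (action alpha T p g).
Local Notation dPhi := (daction alpha T p g).

Hypothesis sup_le : forall w t, S w -> 0 <= t <= T -> `|w t| <= c0 * N w.
Hypothesis mg : forall x, measurable_fun setT (g ^~ x).
Hypothesis cg : forall t, continuous (g t).
Hypothesis g_growth : forall t x, `|g t x| <= C * (1 + `|x| `^ (q - 1)).

(** An almost critical function of small mean has a small value: testing with
the function itself shows that its energy is small. *)
Lemma almost_critical_value : exists2 L, 0 < L & forall s d x,
  almost_critical alpha T p M g s x -> 0 <= s ->
  \int[mu]_(t in `[0, T]) `|x t| <= d -> Phi x <= L * (s + d).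
Proof.
have p0 : 0 < p by exact: lt_trans p1.
have [K K0 gK] := growth_bounded C0 q1 g_growth (c0 * M).
pose L := (M + 1) / p + K / p + K + 1.
have L0 : 0 < L.
  by rewrite ltr_wpDl// !addr_ge0// divr_ge0 ?addr_ge0// ltW.
exists L => // s d x [Sx Nx Hx] s0 xd.
have bx := C0infty_bounded_mfun T0 Sx.
have ix := integrable_itv_norm (bounded_mfun_integrable bx).
have d0 : 0 <= d.
  by rewrite (le_trans _ xd)//; apply: integral_itv_ge0.
have xM t : `|x t| <= c0 * M by exact: (C0infty_bounded_everywhere c00 M0 sup_le).
have iKx := integrable_itvZ K ix.
have Kd : \int[mu]_(t in `[0, T]) (K * `|x t|) <= K * d.
  by rewrite integral_itvZ// ler_wpM2l.
have bnd h : integrable_itv T h -> (forall t, `|h t| <= K * `|x t|) ->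
    `|\int[mu]_(t in `[0, T]) h t| <= K * d.
  move=> ih hK; apply: le_trans Kd; rewrite (le_trans (integral_itv_norm ih))//.
  by apply: integral_itv_le => //; exact: integrable_itv_norm.
have hg : `|\int[mu]_(t in `[0, T]) (g t (x t) * x t)| <= K * d.
  apply: bnd; first exact: (integrable_nonlinear_pair T0 C0 q1 sup_le mg cg g_growth).
  by move=> t; rewrite normrM ler_wpM2r// gK.
have hF : `|\int[mu]_(t in `[0, T]) F t (x t)| <= K * d.
  apply: bnd; last by move=> t; exact: (primitive0_le cg gK).
  apply: bounded_mfun_integrable.
  exact: (bounded_mfun_potential C0 q1 sup_le mg cg g_growth).
have hE : `|E x - \int[mu]_(t in `[0, T]) (g t (x t) * x t)| <= s * (M + 1).
  have -> : E x - \int[mu]_(t in `[0, T]) (g t (x t) * x t) = dPhi x x.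
    rewrite /daction; congr (_ - _); rewrite energyE.
    by apply: integral_itv_eq => t _; rewrite dualmapM.
  by rewrite (le_trans (Hx _ Sx))// ler_wpM2l// lerD2r.
have ar (e G H : R) : `|G| <= K * d -> `|H| <= K * d -> `|e - G| <= s * (M + 1) ->
    e / p - H <= L * (s + d).
  rewrite !ler_norml => /andP[h1 h2] /andP[h3 h4] /andP[h5 h6].
  have he : e <= s * (M + 1) + K * d by lra.
  have : e / p <= (s * (M + 1) + K * d) / p by rewrite ler_pM2r ?invr_gt0.
  have -> : (s * (M + 1) + K * d) / p = s * ((M + 1) / p) + K / p * d.
    by field; rewrite gt_eqF.
  have : 0 <= K / p * s by rewrite mulr_ge0// divr_ge0// ltW.
  have : 0 <= K * s by rewrite mulr_ge0.
  have : 0 <= (M + 1) / p * d by rewrite mulr_ge0// divr_ge0 ?addr_ge0// ltW.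
  by rewrite /L; lra.
exact: ar hg hF hE.
Qed.

Lemma limit_nontrivial (x : nat -> R -> R) (u : R -> R) kappa : 0 < kappa ->
  (forall k, almost_critical alpha T p M g (dyadic k) (x k)) ->
  (forall k, kappa <= Phi (x k)) ->
  measurable_fun setT u -> (forall k t, `|x k t - u t| <= dyadic k) ->
  ~ {ae mu, forall t, t \in `[0, T] -> u t = 0}.
Proof.
move=> k0 xc xk mu_ xu [A [mA A0 HA]].
have [L L0 HL] := almost_critical_value.
have mT : measurable (`[0, T]%classic : set (measurableTypeR R)) by exact: measurable_itv.
have LT : 0 < L * (1 + T) by rewrite mulr_gt0// addr_gt0.
have [n _ /(_ n (leqnn _)) /= Hn] := near_dyadic_le (divr_gt0 (divr_gt0 k0 (ltr0Sn _ 1)) LT).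
have [Sx _ _] := xc n.
have hI : \int[mu]_(t in `[0, T]) `|x n t| <= dyadic n * T.
  rewrite (integral_off_null mT mA A0 (h2 := fun t => `|x n t - u t|)); last first.
    move=> t tT At; rewrite (_ : u t = 0) ?subr0//.
    by apply: contrapT => ut; apply: At; apply: HA => /= H; apply: ut; exact: H.
  rewrite -(integral_itv_cst _ (ltW T0)); apply: integral_itv_le.
  - apply: integrable_itv_norm; apply: bounded_mfun_integrable; split.
      apply: measurable_funB; first by case: (C0infty_bounded_mfun T0 Sx).
      exact: measurable_funTS.
    by exists (dyadic n) => t _.
  - exact/bounded_mfun_integrable/bounded_mfun_cst.
  - by move=> t _.
have := HL _ _ _ (xc n) (ltW (dyadic_gt0 n)) hI.
move=> /(le_trans (xk n)); rewrite leNgt => /negP; apply.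
have -> : L * (dyadic n + dyadic n * T) = L * (1 + T) * dyadic n by ring.
rewrite mulrC (@le_lt_trans _ _ (kappa / 2))//; first by rewrite -ler_pdivlMr.
by rewrite ltr_pdivrMr// ltr_pMr// ltr1n.
Qed.

End nontriviality.

Theorem theorem1p1 (R : realType) (T p alpha q : R) (f : R -> R -> R)
  (hT : 0 < T) (hp : 1 < p) (halpha : p^-1 < alpha) (halpha1 : alpha < 1)
  (hq : p < q) (hf : caratheodory_function T f)
  (h1 : exists2 C : R, 0 < C &
    {ae @lebesgue_measure R, forall t, t \in `[0, T] ->
      forall xi, `|f t xi| <= C * (1 + `|xi| `^ (q - 1))})
  (h2 : exists m r : R, [/\ p < m, 0 < r &
    {ae @lebesgue_measure R, forall t, t \in `[0, T] ->
      forall xi, r <= `|xi| ->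
        0 < m * primitive0 (f t) xi <= xi * f t xi}])
  (h3 : forall eps : R, 0 < eps -> exists2 delta : R, 0 < delta &
    {ae @lebesgue_measure R, forall t, t \in `[0, T] ->
      forall xi, 0 < `|xi| < delta -> `|f t xi / `|xi| `^ (p - 1)| < eps}) :
  exists u : R -> R,
    [/\ E0 alpha p T u,
        ~ {ae @lebesgue_measure R, forall t, t \in `[0, T] -> u t = 0} &
        forall phi : R -> R, E0 alpha p T phi ->
          \int[@lebesgue_measure R]_(t in `[0, T])
            (`|E0_derivative alpha p T u t| `^ (p - 2)
             * E0_derivative alpha p T u t * E0_derivative alpha p T phi t)
          = \int[@lebesgue_measure R]_(t in `[0, T]) (f t (u t) * phi t)].
Proof.
have p0 : 0 < p by exact: lt_trans hp.
have q1 : 1 <= q by rewrite (le_trans (ltW hp))// ltW.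
have mT : measurable (`[0, T]%classic : set (measurableTypeR R)) by exact: measurable_itv.
have [c0 c00 sup_le'] := sup_le_energy hp halpha halpha1 hT.
have sup_le w t : C0infty T w -> 0 <= t <= T -> `|w t| <= c0 * energy_norm alpha T p w.
  by rewrite energy_norm.unlock; exact: sup_le'.
pose eps := (c0 `^ p * T * (2 * p))^-1.
have eps_den : 0 < c0 `^ p * T * (2 * p).
  by rewrite !mulr_gt0// powR_gt0.
have eps0 : 0 < eps by rewrite invr_gt0.
have eps_small : eps * c0 `^ p * T * (2 * p) <= 1.
  by rewrite -2!mulrA (mulrA (c0 `^ p)) mulVf ?gt_eqF.
have [C C0 growth] := h1; have [m [r [pm r0 AR]]] := h2.
have [delta delta0 small] := h3 _ eps0.
have m0 : 0 < m by exact: lt_trans pm.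
have q10 : 0 <= q - 1 by rewrite subr_ge0.
have [g [Nul [mNul Nul0] [gf [mg cg] g_growth g_small [g_AR F_pos]]]] :=
  regularization C0 q10 m0 eps0 hf growth AR small.
have [M [kappa kappa0 crit]] := almost_critical_points hp halpha halpha1 hT C0 q1 c00
  sup_le mg cg g_growth pm r0 eps0 delta0 eps_small g_small g_AR mNul Nul0 F_pos.
have M0 : 0 <= M.
  have [x [_ xM _ _]] := crit 1 ltr01.
  exact: le_trans (energy_norm_ge0 _ _ _ x) xM.
have /choice[w Hw] : forall n : nat, exists x,
    almost_critical alpha T p M g (dyadic n) x /\ kappa <= action alpha T p g x.
  by move=> n; have [x [? ? ? ?]] := crit _ (@dyadic_gt0 R n); exists x.
have [k [u [v [kk mu_ wu Lv wv]]]] := almost_critical_limit hp halpha halpha1 hT C0 q1 c00 M0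
  sup_le mg cg g_growth (fun n => (Hw n).1).
pose x n := w (k n).
have xc n : almost_critical alpha T p M g (dyadic n) (x n).
  by apply: almost_critical_le (Hw (k n)).1; exact: dyadic_le.
have Sx n : C0infty T (x n) by case: (xc n).
have bu : bounded_mfun T u.
  split; first exact: measurable_funTS.
  exists (c0 * M + 1) => t _.
  exact: (limit_bounded c00 M0 sup_le xc wu).
have Lu : Lp_fun T p u by exact: Lp_fun_bounded.
have uv : E0_limit alpha p T u v by exact: (E0_limitI hp halpha halpha1 hT Sx Lu Lv wu wv).
have E0P phi : E0 alpha p T phi -> Lp_fun T p phi /\
    (Lp_fun T p (E0_derivative alpha p T phi) /\
     E0_limit alpha p T phi (E0_derivative alpha p T phi)).
  move=> [Lphi [psi Lpsi lim]]; split; first exact/in_LpP.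
  have : exists psi, in_Lp p T psi /\ E0_limit alpha p T phi psi by exists psi.
  by move=> /getPex[] /in_LpP.
have E0u : E0 alpha p T u.
  by split; [exact/in_LpP|exists v => //; exact/in_LpP].
exists u; split=> //.
  have xk n : kappa <= action alpha T p g (x n) by exact: (Hw (k n)).2.
  have nt := limit_nontrivial hp hT C0 q1 c00 M0 sup_le mg cg g_growth
    kappa0 xc xk mu_ wu.
  exact: nt.
move=> phi /E0P[Lphi [Lpsi lim]]; have [_ [LV limV]] := E0P _ E0u.
set V := E0_derivative alpha p T u; set psi := E0_derivative alpha p T phi.
have [A [mA A0] HA] := E0_limit_unique hp halpha halpha1 hT Lu LV Lv limV uv.
rewrite (integral_off_null mT mA A0 (h2 := fun t => dualmap p (v t) * psi t)); last first.
  by move=> t; rewrite /= in_itv/= => tT At; rewrite /V HA.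
rewrite (integral_off_null mT mNul Nul0 (h1 := fun t => f t (u t) * phi t)
  (h2 := fun t => g t (u t) * phi t)); last first.
  by move=> t; rewrite /= in_itv/= => tT At; rewrite gf.
apply: (weak_equation_closure hp halpha halpha1 hT Lv _ Lphi Lpsi lim).
  exact: (limit_nonlinearity_bounded C0 q1 c00 M0 sup_le mg cg g_growth xc mu_ wu).
exact: (limit_equation hp halpha halpha1 hT C0 q1 c00 M0 sup_le mg cg g_growth xc mu_ wu Lv wv).
Qed.
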